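(* Let $R>0$ and $\alpha>0$. The integral operator $$\mathcal{A}^{\alpha}_{R,slice}\varphi(q)=\left(1-\frac{q}{R}\right)^{-\alpha-1}\int_0^{+\infty}\exp\left(\frac{tq}{q-R}\right)\varphi(t)\frac{t^\alpha e^{-t}}{\Gamma(\alpha+1)}\,dt,\qquad q\in\mathbb{B}_R,$$ defines a unitary isometry from $L^{2,\alpha}(\mathbb{R}^+,\mathbb{H})$ onto the slice hyperholomorphic Bergman space $A^{2,\alpha}_{slice}(\mathbb{B}_R)$. Moreover, for every $n=0,1,2,\dots$, $\mathcal{A}^{\alpha}_{R,slice}\phi_n(q)=f_n(q)$, where $$\phi_n(x)=\left(\frac{\Gamma(n+1)\Gamma(\alpha+1)}{\Gamma(\alpha+n+1)}\right)^{1/2}L^{(\alpha)}_n(x),\qquad f_n(q)=\left(\frac{\Gamma(n+\alpha+1)}{n!\,\Gamma(\alpha+1)}\right)^{1/2}\left(\frac{q}{R}\right)^n$$ are the orthogonal bases of $L^{2,\alpha}(\mathbb{R}^+,\mathbb{H})$ and $A^{2,\alpha}_{slice}(\mathbb{B}_R)$, respectively.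
   Context: $\mathbb{H}$ is the algebra of quaternions, with conjugation $q\mapsto\overline q$ and modulus $|q|$; $\mathbb{S}=\{I\in\mathbb{H}: I^2=-1\}$; for $I\in\mathbb{S}$, $\mathbb{C}_I=\mathbb{R}+\mathbb{R}I$. $\mathbb{B}_R=\{q\in\mathbb{H}:|q|<R\}$ and $\mathbb{B}_{R,I}=\mathbb{B}_R\cap\mathbb{C}_I$. A real differentiable function $f:\mathbb{B}_R\to\mathbb{H}$ is (left) slice regular if for every $I\in\mathbb{S}$ its restriction $f_I$ to $\mathbb{B}_{R,I}$ has continuous partial derivatives and satisfies $\left(\frac{\partial}{\partial x}+I\frac{\partial}{\partial y}\right)f_I(x+yI)=0$. The slice hyperholomorphic Bergman space $A^{2,\alpha}_{slice}(\mathbb{B}_R)$ is the right $\mathbb{H}$-vector space of slice regular functions $f$ on $\mathbb{B}_R$ whose restriction to $\mathbb{B}_{R,I}$ is square integrable with respect to $d\lambda^\alpha_{I,R}(x+yI)=\frac{\alpha}{\pi R^2}\left(1-\frac{|x+yI|^2}{R^2}\right)^{\alpha-1}dx\,dy$ (the space does not depend on $I\in\mathbb{S}$), a right quaternionic Hilbert space with norm $\|f\|_{\alpha,slice}^2=\int_{\mathbb{B}_{R,I}}|f|^2\,d\lambda^\alpha_{I,R}$. $L^{2,\alpha}(\mathbb{R}^+,\mathbb{H})$ is the right quaternionic Hilbert space of $\mathbb{H}$-valued functions on $\mathbb{R}^+$ with $\|\varphi\|^2=\int_0^\infty|\varphi(t)|^2\frac{t^\alpha e^{-t}}{\Gamma(\alpha+1)}dt<\infty$.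 $L^{(\alpha)}_n(t)=\sum_{k=0}^n\frac{\Gamma(\alpha+n+1)}{\Gamma(n-k+1)\Gamma(\alpha+k+1)}\frac{(-t)^k}{k!}$ is the generalized Laguerre polynomial. Functions of $q$ such as $\left(1-\frac qR\right)^{-\alpha-1}$ and $\exp\left(\frac{tq}{q-R}\right)$ are computed in a slice $\mathbb{C}_I$ containing $q$, with principal powers. A unitary isometry from one right quaternionic Hilbert space onto another is a surjective right $\mathbb{H}$-linear map that preserves the norm. *)

(* Defs.v *)
From HB Require Import structures.
From mathcomp Require Import all_boot all_order all_algebra.
From mathcomp Require Import ring lra.
From mathcomp Require Import all_classical all_reals all_analysis.

Set Implicit Arguments.
Unset Strict Implicit.
Unset Printing Implicit Defensive.

Import Order.TTheory GRing.Theory Num.Theory.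
Import numFieldNormedType.Exports.

Local Open Scope classical_set_scope.
Local Open Scope ring_scope.

Record quat (R : realType) := Quat { qre : R; qi : R; qj : R; qk : R }.

Definition quat_tuple (R : realType) (q : quat R) : R * R * R * R :=
  (qre q, qi q, qj q, qk q).
Definition tuple_quat (R : realType) (x : R * R * R * R) : quat R :=
  let: (a, b, c, d) := x in Quat a b c d.
Lemma quat_tupleK (R : realType) : cancel (@quat_tuple R) (@tuple_quat R).
Proof. by case. Qed.

HB.instance Definition _ (R : realType) :=
  Choice.copy (quat R) (can_type (@quat_tupleK R)).

Lemma quatP (R : realType) (p q : quat R) :
  qre p = qre q -> qi p = qi q -> qj p = qj q -> qk p = qk q -> p = q.
Proof. by case: p q => [????] [????] /= -> -> -> ->. Qed.

Definition qadd (R : realType) (p q : quat R) :=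
  Quat (qre p + qre q) (qi p + qi q) (qj p + qj q) (qk p + qk q).
Definition qopp (R : realType) (p : quat R) :=
  Quat (- qre p) (- qi p) (- qj p) (- qk p).
Definition qzero (R : realType) : quat R := Quat 0 0 0 0.

Lemma qaddA (R : realType) : associative (@qadd R).
Proof. by move=> p q s; apply: quatP => /=; rewrite addrA. Qed.
Lemma qaddC (R : realType) : commutative (@qadd R).
Proof. by move=> p q; apply: quatP => /=; rewrite addrC. Qed.
Lemma qadd0 (R : realType) : left_id (@qzero R) (@qadd R).
Proof. by move=> p; apply: quatP => /=; rewrite add0r. Qed.
Lemma qaddN (R : realType) : left_inverse (@qzero R) (@qopp R) (@qadd R).
Proof. by move=> p; apply: quatP => /=; rewrite addNr. Qed.

HB.instance Definition _ (R : realType) := GRing.isZmodule.Build (quat R)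
  (@qaddA R) (@qaddC R) (@qadd0 R) (@qaddN R).

Definition qmul (R : realType) (p q : quat R) := Quat
  (qre p * qre q - qi p * qi q - qj p * qj q - qk p * qk q)
  (qre p * qi q + qi p * qre q + qj p * qk q - qk p * qj q)
  (qre p * qj q - qi p * qk q + qj p * qre q + qk p * qi q)
  (qre p * qk q + qi p * qj q - qj p * qi q + qk p * qre q).
Definition qone (R : realType) : quat R := Quat 1 0 0 0.

Lemma qmulA (R : realType) : associative (@qmul R).
Proof. by move=> p q s; apply: quatP => /=; ring. Qed.
Lemma qmul1 (R : realType) : left_id (@qone R) (@qmul R).
Proof. by move=> p; apply: quatP => /=; ring. Qed.
Lemma qmulr1 (R : realType) : right_id (@qone R) (@qmul R).
Proof. by move=> p; apply: quatP => /=; ring. Qed.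
Lemma qmulDl (R : realType) : left_distributive (@qmul R) (@qadd R).
Proof. by move=> p q s; apply: quatP => /=; ring. Qed.
Lemma qmulDr (R : realType) : right_distributive (@qmul R) (@qadd R).
Proof. by move=> p q s; apply: quatP => /=; ring. Qed.
Lemma qone_neq0 (R : realType) : qone R != 0.
Proof. by apply/eqP => -[] /eqP; rewrite oner_eq0. Qed.

HB.instance Definition _ (R : realType) := GRing.Zmodule_isNzRing.Build (quat R)
  (@qmulA R) (@qmul1 R) (@qmulr1 R) (@qmulDl R) (@qmulDr R) (@qone_neq0 R).

Definition qscale (R : realType) (a : R) (q : quat R) :=
  Quat (a * qre q) (a * qi q) (a * qj q) (a * qk q).

Lemma qscaleA (R : realType) (a b : R) (q : quat R) :
  qscale a (qscale b q) = qscale (a * b) q.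
Proof. by apply: quatP => /=; rewrite mulrA. Qed.
Lemma qscale1 (R : realType) : left_id 1 (@qscale R).
Proof. by move=> q; apply: quatP => /=; rewrite mul1r. Qed.
Lemma qscaleDr (R : realType) : right_distributive (@qscale R) +%R.
Proof. by move=> a p q; apply: quatP => /=; rewrite mulrDr. Qed.
Lemma qscaleDl (R : realType) (q : quat R) :
  {morph (@qscale R)^~ q : a b / a + b}.
Proof. by move=> a b; apply: quatP => /=; rewrite mulrDl. Qed.

HB.instance Definition _ (R : realType) := GRing.Zmodule_isLmodule.Build R
  (quat R) (@qscaleA R) (@qscale1 R) (@qscaleDr R) (@qscaleDl R).

Lemma qscaleAl (R : realType) (a : R) (p q : quat R) :
  a *: (p * q) = (a *: p) * q.
Proof. by apply: quatP => /=; ring. Qed.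
HB.instance Definition _ (R : realType) :=
  GRing.Lmodule_isLalgebra.Build R (quat R) (@qscaleAl R).
Lemma qscaleAr (R : realType) (a : R) (p q : quat R) :
  a *: (p * q) = p * (a *: q).
Proof. by apply: quatP => /=; ring. Qed.
HB.instance Definition _ (R : realType) :=
  GRing.Lalgebra_isAlgebra.Build R (quat R) (@qscaleAr R).

Definition qconj (R : realType) (q : quat R) :=
  Quat (qre q) (- qi q) (- qj q) (- qk q).
Definition qsqmod (R : realType) (q : quat R) :=
  qre q ^+ 2 + qi q ^+ 2 + qj q ^+ 2 + qk q ^+ 2.

Lemma qsqmod_ge0 (R : realType) (q : quat R) : 0 <= qsqmod q.
Proof. by rewrite !addr_ge0 ?sqr_ge0. Qed.
Lemma qsqmod_eq0 (R : realType) (q : quat R) : (qsqmod q == 0) = (q == 0).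
Proof.
apply/idP/eqP => [|->]; last by rewrite /qsqmod /= expr0n /= !addr0.
rewrite !paddr_eq0 ?addr_ge0 ?sqr_ge0// !sqrf_eq0.
by move=> /andP[/andP[/andP[/eqP ? /eqP ?] /eqP ?] /eqP ?]; apply: quatP.
Qed.

Definition qunit (R : realType) : pred (quat R) := fun q => q != 0.
Definition qinv (R : realType) (q : quat R) : quat R :=
  (qsqmod q)^-1 *: qconj q.

Lemma qmulVq (R : realType) : {in @qunit R, left_inverse 1 (@qinv R) *%R}.
Proof.
move=> q; rewrite unfold_in /qunit -qsqmod_eq0 => q0.
by apply: quatP => /=; rewrite /qsqmod in q0 *; field.
Qed.
Lemma qmulqV (R : realType) : {in @qunit R, right_inverse 1 (@qinv R) *%R}.
Proof.
move=> q; rewrite unfold_in /qunit -qsqmod_eq0 => q0.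
by apply: quatP => /=; rewrite /qsqmod in q0 *; field.
Qed.
Lemma qunitP (R : realType) (p q : quat R) :
  q * p = 1 /\ p * q = 1 -> qunit p.
Proof.
by move=> [+ _]; apply: contra_eqN => /eqP ->; rewrite mulr0 eq_sym oner_eq0.
Qed.
Lemma qinv_out (R : realType) : {in [predC @qunit R], @qinv R =1 id}.
Proof.
move=> q; rewrite inE /= negbK => /eqP ->.
by apply: quatP; rewrite /= ?oppr0 mulr0.
Qed.
HB.instance Definition _ (R : realType) :=
  GRing.NzRing_hasMulInverse.Build (quat R)
    (@qmulVq R) (@qmulqV R) (@qunitP R) (@qinv_out R).

Definition qmod (R : realType) (q : quat R) : R := Num.sqrt (qsqmod q).

Lemma qmodD (R : realType) (p q : quat R) : qmod (p + q) <= qmod p + qmod q.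
Proof.
rewrite -(@ler_pXn2r _ 2)// ?nnegrE ?addr_ge0 ?sqrtr_ge0//.
rewrite sqrrD !sqr_sqrtr ?qsqmod_ge0//.
have cs : (qre p * qre q + qi p * qi q + qj p * qj q + qk p * qk q) <=
    qmod p * qmod q.
  rewrite -sqrtrM ?qsqmod_ge0//.
  apply: (le_trans (ler_norm _)).
  rewrite -sqrtr_sqr ler_sqrt ?mulr_ge0 ?qsqmod_ge0//.
  rewrite -subr_ge0 /qsqmod.
  set X := (X in 0 <= X).
  have -> : X = (qre p * qi q - qi p * qre q) ^+ 2
     + (qre p * qj q - qj p * qre q) ^+ 2 + (qre p * qk q - qk p * qre q) ^+ 2
     + (qi p * qj q - qj p * qi q) ^+ 2 + (qi p * qk q - qk p * qi q) ^+ 2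
     + (qj p * qk q - qk p * qj q) ^+ 2 by rewrite /X; ring.
  by rewrite !addr_ge0 ?sqr_ge0.
rewrite -mulr_natl; move: cs; set P := qmod p * qmod q.
by rewrite /qsqmod /=; lra.
Qed.
Lemma qmodZ (R : realType) (a : R) (q : quat R) : qmod (a *: q) = `|a| * qmod q.
Proof.
rewrite /qmod -sqrtr_sqr -sqrtrM ?sqr_ge0//; congr Num.sqrt.
by rewrite /qsqmod /=; ring.
Qed.
Lemma qmod0_eq0 (R : realType) (q : quat R) : qmod q = 0 -> q = 0.
Proof.
move=> /eqP; rewrite sqrtr_eq0 => q0; apply/eqP; rewrite -qsqmod_eq0.
by rewrite eq_le q0 qsqmod_ge0.
Qed.
HB.instance Definition _ (R : realType) :=
  Lmodule_isNormed.Build R (quat R) (@qmodD R) (@qmodZ R) (@qmod0_eq0 R).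

Lemma qnormE (R : realType) (q : quat R) :
  `|q| = Num.sqrt (qre q ^+ 2 + qi q ^+ 2 + qj q ^+ 2 + qk q ^+ 2).
Proof. by []. Qed.

Definition qim (R : realType) (q : quat R) : quat R :=
  Quat 0 (qi q) (qj q) (qk q).

Definition usphere (R : realType) : set (quat R) := [set I | I ^+ 2 = - 1].

Definition qball (R : realType) (r : R) : set (quat R) := [set q | `|q| < r].

(* The point x + yI of the slice C_I. *)
Definition slice_pt (R : realType) (I : quat R) (z : R * R) : quat R :=
  z.1%:A + z.2 *: I.

(* The imaginary unit of a slice containing q.  It is 0 when q is real; the
   functions below only use it multiplied by a coefficient which then vanishes
   (for qpow, off the negative real axis). *)
Definition qdir (R : realType) (q : quat R) : quat R := `|qim q|^-1 *: qim q.

Definition qexp (R : realType) (q : quat R) : quat R :=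
  expR (qre q) *: ((cos `|qim q|)%:A + sin `|qim q| *: qdir q).

(* Principal argument in the slice oriented by qdir q, where Im q >= 0. *)
Definition qarg (R : realType) (q : quat R) : R := acos (qre q / `|q|).

Definition qpow (R : realType) (q : quat R) (s : R) : quat R :=
  (`|q| `^ s) *: ((cos (s * qarg q))%:A + sin (s * qarg q) *: qdir q).

Lemma usphere_re (R : realType) (I : quat R) : usphere I -> qre I = 0.
Proof.
case: I => a b c d; rewrite /usphere /= expr2 => -[] /=.
move=> h1 h2 h3 h4; have [//|a0] := eqVneq a 0.
have b0 : b = 0 by apply: (mulfI a0); lra.
have c0 : c = 0 by apply: (mulfI a0); lra.
have d0 : d = 0 by apply: (mulfI a0); lra.
by move: h1; rewrite b0 c0 d0; have := sqr_ge0 a; rewrite expr2; lra.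
Qed.

Lemma usphere_norm (R : realType) (I : quat R) : usphere I -> `|I| = 1.
Proof.
move=> SI; have r0 := usphere_re SI.
case: I r0 SI => a b c d /= ->; rewrite /usphere /= expr2 => -[] /= h _ _ _.
by rewrite qnormE /= -[RHS]sqrtr1; congr Num.sqrt; lra.
Qed.

Lemma qim_slice (R : realType) (I : quat R) (z : R * R) : usphere I ->
  qim (slice_pt I z) = z.2 *: I.
Proof.
move=> /usphere_re r0; apply: quatP; rewrite /= ?r0 ?mulr0 ?add0r//.
Qed.

Lemma qre_slice (R : realType) (I : quat R) (z : R * R) : usphere I ->
  qre (slice_pt I z) = z.1.
Proof. by move=> /usphere_re r0; rewrite /= r0 mulr0 mulr1 addr0. Qed.

Lemma qdir_slice (R : realType) (I : quat R) (z : R * R) : usphere I ->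
  qdir (slice_pt I z) = Num.sg z.2 *: I.
Proof.
move=> SI; rewrite /qdir qim_slice// normrZ (usphere_norm SI) mulr1 scalerA.
have [->|y0] := eqVneq z.2 0; first by rewrite mulr0 sgr0.
by rewrite {2}[z.2]numEsg mulrCA mulVf ?normr_eq0// mulr1.
Qed.

Lemma norm_slice (R : realType) (I : quat R) (z : R * R) : usphere I ->
  `|slice_pt I z| = Num.sqrt (z.1 ^+ 2 + z.2 ^+ 2).
Proof.
move=> SI; have := usphere_norm SI; have r0 := usphere_re SI.
move=> /(congr1 (fun u => u ^+ 2)).
rewrite !qnormE sqr_sqrtr ?qsqmod_ge0// r0 expr1n => h.
congr Num.sqrt; rewrite /= r0.
by rewrite -[in RHS](mulr1 (z.2 ^+ 2)) -[X in _ ^+ 2 * X]h; ring.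
Qed.

Lemma qexp_slice (R : realType) (I : quat R) (x y : R) : usphere I ->
  qexp (slice_pt I (x, y)) = expR x *: slice_pt I (cos y, sin y).
Proof.
move=> SI; rewrite /qexp qre_slice// qdir_slice// qim_slice//=.
rewrite normrZ usphere_norm// mulr1 /slice_pt/=; congr (_ *: (_ + _)).
  by case: (ger0P y) => // _; rewrite cosN.
rewrite scalerA; congr (_ *: _).
case: (ltrgt0P y) => [y0|y0|->]; last by rewrite sin0 mul0r.
  by rewrite gtr0_sg ?mulr1.
by rewrite ltr0_sg// sinN mulrN1 opprK.
Qed.

Lemma qpow_slice (R : realType) (I : quat R) (m theta s : R) : usphere I ->
  0 < m -> `|theta| < pi ->
  qpow (m *: slice_pt I (cos theta, sin theta)) s =
  (m `^ s) *: slice_pt I (cos (s * theta), sin (s * theta)).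
Proof.
move=> SI m0 tpi.
have E : m *: slice_pt I (cos theta, sin theta) =
    slice_pt I (m * cos theta, m * sin theta).
  by rewrite /slice_pt/= scalerDr !scalerA.
have N : `|m *: slice_pt I (cos theta, sin theta)| = m.
  by rewrite normrZ norm_slice//= cos2Dsin2 sqrtr1 mulr1 gtr0_norm.
have A : qarg (m *: slice_pt I (cos theta, sin theta)) = `|theta|.
  rewrite /qarg N E qre_slice//= mulrAC mulfV ?gt_eqF// mul1r.
  have -> : cos theta = cos `|theta| by case: (ger0P theta) => // _; rewrite cosN.
  by rewrite cosK// in_itv/= normr_ge0 ltW.
rewrite /qpow N A E qdir_slice//= sgrM gtr0_sg// mul1r.
rewrite /slice_pt/=; congr (_ *: (_ + _)).
  by case: (ger0P theta) => // _; rewrite mulrN cosN.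
rewrite scalerA; congr (_ *: _).
case: (ltrgt0P theta) => [t0|t0|->].
- by rewrite gtr0_sg ?mulr1// sin_gt0_pi// t0 -(gtr0_norm t0).
- have sn : sin theta < 0.
    by rewrite -oppr_gt0 -sinN sin_gt0_pi// oppr_gt0 t0 -(ltr0_norm t0).
  by rewrite (ltr0_sg sn) (mulrN s) sinN mulrN1 opprK.
- by rewrite mulr0 sin0 mul0r.
Qed.

Definition qmeasurable d (T : measurableType d) (R : realType)
    (D : set T) (f : T -> quat R) : Prop :=
  [/\ measurable_fun D (fun x => qre (f x)), measurable_fun D (fun x => qi (f x)),
      measurable_fun D (fun x => qj (f x)) & measurable_fun D (fun x => qk (f x))].

Definition qintegrable d (T : measurableType d) (R : realType)
    (mu : {measure set T -> \bar R}) (D : set T) (f : T -> quat R) : Prop :=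
  [/\ mu.-integrable D (fun x => (qre (f x))%:E),
      mu.-integrable D (fun x => (qi (f x))%:E),
      mu.-integrable D (fun x => (qj (f x))%:E) &
      mu.-integrable D (fun x => (qk (f x))%:E)].

Definition qintegral d (T : measurableType d) (R : realType)
    (mu : {measure set T -> \bar R}) (D : set T) (f : T -> quat R) : quat R :=
  Quat (\int[mu]_(x in D) qre (f x)) (\int[mu]_(x in D) qi (f x))
       (\int[mu]_(x in D) qj (f x)) (\int[mu]_(x in D) qk (f x)).

(* H-valued L^2 for the measure w dmu on D. *)
Definition L2_mem d (T : measurableType d) (R : realType)
    (mu : {measure set T -> \bar R}) (D : set T) (w : T -> R)
    (f : T -> quat R) : Prop :=
  qmeasurable D f /\ (\int[mu]_(x in D) (`|f x| ^+ 2 * w x)%:E < +oo)%E.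

Definition L2_norm d (T : measurableType d) (R : realType)
    (mu : {measure set T -> \bar R}) (D : set T) (w : T -> R)
    (f : T -> quat R) : R :=
  Num.sqrt (\int[mu]_(x in D) (`|f x| ^+ 2 * w x)).

(* Right-linear in the first argument. *)
Definition L2_inner d (T : measurableType d) (R : realType)
    (mu : {measure set T -> \bar R}) (D : set T) (w : T -> R)
    (f g : T -> quat R) : quat R :=
  qintegral mu D (fun x => w x *: (qconj (g x) * f x)).

Lemma L2_norm_inner d (T : measurableType d) (R : realType)
    (mu : {measure set T -> \bar R}) (D : set T) (w : T -> R)
    (f : T -> quat R) :
  L2_norm mu D w f = Num.sqrt (qre (L2_inner mu D w f f)).
Proof.
rewrite /L2_norm /L2_inner /=; congr (Num.sqrt (Rintegral _ _ _)).
apply/funext => x /=; rewrite qnormE sqr_sqrtr ?qsqmod_ge0//; ring.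
Qed.

(* A right quaternionic inner product space of functions X -> H.  A vector is
   represented by any function in fs_mem, two functions representing the same
   vector when related by fs_eq; addition and the right action of H are
   pointwise. *)
Record fspace (R : realType) (X : Type) := FSpace {
  fs_mem : set (X -> quat R);
  fs_eq : (X -> quat R) -> (X -> quat R) -> Prop;
  fs_norm : (X -> quat R) -> R;
  fs_inner : (X -> quat R) -> (X -> quat R) -> quat R }.

Definition unitary_isometry (R : realType) (X Y : Type)
    (V : fspace R X) (W : fspace R Y)
    (A : (X -> quat R) -> (Y -> quat R)) : Prop :=
  [/\ (forall f, fs_mem V f -> fs_mem W (A f)),
      (forall f g, fs_mem V f -> fs_mem V g -> fs_eq V f g ->
         fs_eq W (A f) (A g)),
      (forall f g (a b : quat R), fs_mem V f -> fs_mem V g ->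
         fs_eq W (A (fun x => f x * a + g x * b))
                 (fun y => A f y * a + A g y * b)),
      (forall f, fs_mem V f -> fs_norm W (A f) = fs_norm V f) &
      (forall g, fs_mem W g -> exists2 f, fs_mem V f & fs_eq W (A f) g)].

Definition orthogonal_basis (R : realType) (X : Type) (V : fspace R X)
    (e : nat -> X -> quat R) : Prop :=
  [/\ (forall n, fs_mem V (e n)),
      (forall n, fs_norm V (e n) != 0),
      (forall m n, m != n -> fs_inner V (e m) (e n) = 0) &
      (forall f, fs_mem V f -> forall eps : R, 0 < eps ->
         exists (N : nat) (c : nat -> quat R),
           fs_norm V (fun x => f x - \sum_(k < N) e k x * c k) < eps)].

Definition Gamma (R : realType) (x : R) : R :=
  \int[lebesgue_measure]_(t in `]0, +oo[) (t `^ (x - 1) * expR (- t)).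

Definition gamma_weight (R : realType) (alpha t : R) : R :=
  t `^ alpha * expR (- t) / Gamma (alpha + 1).

Definition L2alpha (R : realType) (alpha : R) : fspace R (measurableTypeR R) :=
  {| fs_mem := L2_mem lebesgue_measure `[0, +oo[ (gamma_weight alpha);
     fs_eq := fun f g =>
       {ae lebesgue_measure, forall t : R, 0 <= t -> f t = g t};
     fs_norm := L2_norm lebesgue_measure `[0, +oo[ (gamma_weight alpha);
     fs_inner := L2_inner lebesgue_measure `[0, +oo[ (gamma_weight alpha) |}.

(* The partial derivatives of the restriction of f to C_I. *)
Definition dslice_x (R : realType) (f : quat R -> quat R) (I : quat R)
    (z : R * R) : quat R :=
  derive1 (fun x : R => f (slice_pt I (x, z.2))) z.1.
Definition dslice_y (R : realType) (f : quat R -> quat R) (I : quat R)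
    (z : R * R) : quat R :=
  derive1 (fun y : R => f (slice_pt I (z.1, y))) z.2.

Definition slice_regular (R : realType) (r : R) (f : quat R -> quat R) : Prop :=
  (forall q, qball r q -> differentiable f q) /\
  (forall I, usphere I -> forall z, qball r (slice_pt I z) ->
     [/\ derivable (fun x : R => f (slice_pt I (x, z.2))) z.1 1,
         derivable (fun y : R => f (slice_pt I (z.1, y))) z.2 1,
         {for z, continuous (dslice_x f I)},
         {for z, continuous (dslice_y f I)} &
         dslice_x f I z + I * dslice_y f I z = 0]).

(* The ball of radius r in C_I, in the coordinates (x, y) of x + yI. *)
Definition slice_ball (R : realType) (r : R) (I : quat R) :
    set (measurableTypeR R * measurableTypeR R) :=
  [set z | qball r (slice_pt I z)].

Definition slice_weight (R : realType) (r alpha : R) (I : quat R)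
    (z : R * R) : R :=
  alpha / (pi * r ^+ 2) * (1 - `|slice_pt I z| ^+ 2 / r ^+ 2) `^ (alpha - 1).

Definition plane_measure (R : realType) :
    {measure set (measurableTypeR R * measurableTypeR R) -> \bar R} :=
  (@lebesgue_measure R \x @lebesgue_measure R)%E.

Definition bergman (R : realType) (r alpha : R) (I : quat R) :
    fspace R (quat R) :=
  {| fs_mem := fun f => slice_regular r f /\
       L2_mem (plane_measure R) (slice_ball r I) (slice_weight r alpha I)
         (fun z => f (slice_pt I z));
     fs_eq := fun f g => forall q, qball r q -> f q = g q;
     fs_norm := fun f =>
       L2_norm (plane_measure R) (slice_ball r I) (slice_weight r alpha I)
         (fun z => f (slice_pt I z));
     fs_inner := fun f g =>
       L2_inner (plane_measure R) (slice_ball r I) (slice_weight r alpha I)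
         (fun z => f (slice_pt I z)) (fun z => g (slice_pt I z)) |}.

Definition Aslice_integrand (R : realType) (r alpha : R)
    (phi : measurableTypeR R -> quat R) (q : quat R) (t : R) : quat R :=
  gamma_weight alpha t *: (qexp (t *: q / (q - r%:A)) * phi t).

Definition Aslice (R : realType) (r alpha : R)
    (phi : measurableTypeR R -> quat R) (q : quat R) : quat R :=
  qpow (1 - r^-1 *: q) (- alpha - 1) *
  qintegral lebesgue_measure `[0, +oo[ (Aslice_integrand r alpha phi q).

Definition laguerre (R : realType) (alpha : R) (n : nat) (t : R) : R :=
  \sum_(k < n.+1) Gamma (alpha + n%:R + 1)
    / (Gamma (n%:R - k%:R + 1) * Gamma (alpha + k%:R + 1))
    * ((- t) ^+ k / (k`!)%:R).

Definition phi_basis (R : realType) (alpha : R) (n : nat)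
    (x : measurableTypeR R) : quat R :=
  (Num.sqrt (Gamma (n%:R + 1) * Gamma (alpha + 1) / Gamma (alpha + n%:R + 1))
   * laguerre alpha n x)%:A.

Definition f_basis (R : realType) (r alpha : R) (n : nat) (q : quat R) :
    quat R :=
  Num.sqrt (Gamma (n%:R + alpha + 1) / ((n`!)%:R * Gamma (alpha + 1)))
  *: (r^-1 *: q) ^+ n.

(* Main.v *)
Require Import Defs.
From HB Require Import structures.
From mathcomp Require Import all_boot all_order all_algebra.
From mathcomp Require Import ring lra.
From mathcomp Require Import all_classical all_reals all_analysis.
From mathcomp Require Import measurable_realfun lebesgue_integral_under.
Set Implicit Arguments.
Unset Strict Implicit.
Unset Printing Implicit Defensive.
Import Order.TTheory GRing.Theory Num.Theory.
Import numFieldNormedType.Exports.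
Local Open Scope classical_set_scope.
Local Open Scope ring_scope.

(** On every slice the operator is integration against a kernel whose Laguerre
    coefficients are multiples of the powers of q, so it carries Laguerre expansions
    to power series; both sides are then compared through their coefficients.

    Kernel. Let q lie in the slice C_J and write 1 - q/r = m e^(J th) with m > 0 and
    |th| < pi/2; the condition |q| < r becomes m < 2 cos th. The kernel (1 -
    q/r)^(-alpha-1) exp(tq/(q-r)) equals kerC(t) + J kerS(t) with two real functions
    kerC and kerS, square integrable for the Gamma weight precisely because m < 2
    cos th. Integrating t^k against it is a Laplace integral at the complex point
    e^(-J th)/m and gives (1 - q/r)^k up to Gamma factors (lap_polar). The
    coefficients of the Laguerre polynomials turn these moments into a binomial sum,
    so the n-th coefficient of the kernel is sqrt(lnorm2 n) (q/r)^n, where lnorm2 n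
    = Gamma(alpha+n+1) / (n! Gamma(alpha+1)) (ip_lag_kerC, ip_lag_kerS, powq_slice).
    The squared norm of the kernel is (1 - |q/r|^2)^(-alpha-1), whose binomial
    series is the sum of lnorm2 n |q/r|^(2n); thus the kernel satisfies Parseval's
    identity, before anything is known on completeness (ker_parseval). Consequently
    the image of phi is the sum of the power series with coefficients r^(-n)
    sqrt(lnorm2 n) <phi, lag n> (Aslice_ps).

    Completeness of the Laguerre functions. A function orthogonal to all of them is
    orthogonal to the kernels at the real points with m = 1/(k+1), which are
    multiples of exp(-kt); vanishing of all these exponential moments forces the
    function to vanish almost everywhere (lag_complete).

    Bergman space. By Cauchy's formula on each slice, a slice regular function is
    the sum of a power series on the ball; the coefficients do not depend on the
    slice since all slices share the real points (slice_regular_ps). Conversely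
    power series are slice regular (ps_slice_regular). Monomials are orthogonal on a
    disc by rotation invariance, and their norms reduce to Beta integrals: the
    squared norm of q^n is r^(2n) / lnorm2 n (cross_zero, bergman_moment). Hence the
    squared Bergman norm of a power series is the sum of |a_n|^2 r^(2n) / lnorm2 n
    (bergman_le, bergman_ge), which for the coefficients above is the sum of |<phi,
    lag n>|^2, that is, the squared norm of phi. Surjectivity is the Riesz-Fischer
    theorem (qriesz). *)

(** * Weighted real L2 spaces: Bessel, Parseval and Riesz-Fischer *)

Lemma cvg_dist0 (R : realType) (V : normedModType R) (u : nat -> V) (b : nat -> R) (l : V) :
  (forall n, `|l - u n| <= b n) -> b @ \oo --> 0 -> u @ \oo --> l.
Proof.
move=> ub /cvgrPdist_lt b0; apply/cvgrPdist_lt => e e0.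
have := b0 e e0; apply: filterS => n; rewrite sub0r normrN => bn.
by rewrite (le_lt_trans (ub n))// (le_lt_trans (ler_norm _)).
Qed.

(** Fatou's lemma in the form used for norms: a uniform bound on the integrals of an
    almost everywhere convergent sequence passes to the limit function. *)
Lemma fatou_le d (T : measurableType d) (R : realType) (mu : {measure set T -> \bar R})
    (D : set T) (mD : measurable D) (f_ : nat -> T -> \bar R) (g : T -> \bar R) (M : \bar R) :
  (forall n, measurable_fun D (f_ n)) -> (forall n x, D x -> (0 <= f_ n x)%E) ->
  measurable_fun D g -> (forall x, D x -> (0 <= g x)%E) ->
  {ae mu, forall x, D x -> f_ ^~ x @ \oo --> g x} ->
  (forall n, (\int[mu]_(x in D) f_ n x <= M)%E) ->
  (\int[mu]_(x in D) g x <= M)%E.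
Proof.
move=> mf f0 mg g0 fg fM.
have -> : (\int[mu]_(x in D) g x = \int[mu]_(x in D) limn_einf (f_ ^~ x))%E.
  apply: ge0_ae_eq_integral => //.
  - have -> : (fun x => limn_einf (f_ ^~ x)) =
              (fun x => - limn_esup (fun n => - f_ n x))%E.
      by apply/funext => x; rewrite -limn_einfN; congr limn_einf;
         apply/funext => n /=; rewrite oppeK.
    apply: measurableT_comp => //.
    by apply: measurable_fun_limn_esup => n; exact: measurableT_comp.
  - move=> x Dx; rewrite limn_einf_lim; apply: lime_ge; first exact: is_cvg_einfs.
    by apply: nearW => n; apply: le_ereal_inf_tmp => _ [k _ <-]; exact: f0.
  - apply: filterS fg => x fx Dx.
    by have [->] := cvg_limn_einf_sup (fx Dx).
apply: le_trans (fatou mu mD mf f0) _.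
rewrite limn_einf_lim; apply: lime_le; first exact: is_cvg_einfs.
apply: nearW => n; apply: le_trans (fM n).
by apply: ereal_inf_lbound; exists n => //=.
Qed.

Section weighted_L2.
Context d (T : measurableType d) (R : realType) (mu : {measure set T -> \bar R}).
Context (D : set T) (mD : measurable D) (w : T -> R).
Context (mw : measurable_fun D w) (w0 : forall x, D x -> 0 <= w x).
Implicit Types f g h : T -> R.

(** Square integrability and inner product are kept at the level of functions and
    relative to a density w, with no passage to classes modulo null sets: the spaces
    of the theorem are described by functions too. *)
Definition sqi f : Prop :=
  measurable_fun D f /\ mu.-integrable D (fun x => (f x ^+ 2 * w x)%:E).

Definition ip f g : R := \int[mu]_(x in D) (f x * g x * w x).

Lemma sqi_mul f g : sqi f -> sqi g ->
  mu.-integrable D (fun x => (f x * g x * w x)%:E).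
Proof.
move=> [mf iff] [mg igg].
apply: (@le_integrable _ _ _ _ _ mD _
   (fun x => (f x ^+ 2 * w x + g x ^+ 2 * w x)%:E)).
- apply/measurable_EFinP; apply: measurable_funM => //.
  exact: measurable_funM.
- move=> x Dx /=; rewrite lee_fin normrM (ger0_norm (w0 Dx)) -mulrDl [leRHS]ger0_norm.
    apply: ler_wpM2r; first exact: w0.
    have := sqr_ge0 (`|f x| - `|g x|); rewrite sqrrB !real_normK ?num_real//.
    rewrite normrM; move: (sqr_ge0 (f x)) (sqr_ge0 (g x)).
    move: (_ * _) => P; lra.
  by rewrite mulr_ge0 ?addr_ge0 ?sqr_ge0 ?w0.
- under eq_fun do rewrite EFinD; exact: integrableD.
Qed.

Lemma ipC f g : ip f g = ip g f.
Proof. by rewrite /ip; apply: eq_Rintegral => x _; rewrite (mulrC (f x)). Qed.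

Lemma sqiZ a f : sqi f -> sqi (fun x => a * f x).
Proof.
move=> [mf iff]; split; first exact: measurable_funM.
under eq_fun do rewrite exprMn -mulrA EFinM.
exact: integrableZl.
Qed.

Lemma sqiD f g : sqi f -> sqi g -> sqi (fun x => f x + g x).
Proof.
move=> sf sg; have [mf iff] := sf; have [mg igg] := sg.
split; first exact: measurable_funD.
have -> : (fun x => ((f x + g x) ^+ 2 * w x)%:E) =
  (fun x => (f x ^+ 2 * w x)%:E + (g x ^+ 2 * w x)%:E +
            2%:E * (f x * g x * w x)%:E)%E.
  by apply/funext => x; rewrite -EFinM -!EFinD; congr EFin; ring.
apply: integrableD => //; first exact: integrableD.
by apply: integrableZl => //; exact: sqi_mul.
Qed.

Lemma sqi0 : sqi (fun=> 0).
Proof.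
split; first exact: measurable_cst.
under eq_fun do rewrite expr0n mul0r; exact: integrable0.
Qed.

Lemma sqi_sum n (F : nat -> T -> R) : (forall k, sqi (F k)) ->
  sqi (fun x => \sum_(k < n) F k x).
Proof.
move=> sF; elim: n => [|n ih].
  by under eq_fun do rewrite big_ord0; exact: sqi0.
by under eq_fun do rewrite big_ord_recr /=; exact: sqiD.
Qed.

Lemma sqiB f g : sqi f -> sqi g -> sqi (fun x => f x - g x).
Proof.
move=> sf sg; under eq_fun do rewrite -mulN1r; apply: sqiD => //; exact: sqiZ.
Qed.

Lemma ipDl f g h : sqi f -> sqi g -> sqi h ->
  ip (fun x => f x + g x) h = ip f h + ip g h.
Proof.
move=> sf sg sh; rewrite /ip -RintegralD//; try exact: sqi_mul.
by apply: eq_Rintegral => x _; rewrite !mulrDl.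
Qed.

Lemma ipZl a f h : sqi f -> sqi h -> ip (fun x => a * f x) h = a * ip f h.
Proof.
move=> sf sh; rewrite /ip -RintegralZl//; last exact: sqi_mul.
by apply: eq_Rintegral => x _; rewrite !mulrA.
Qed.

Lemma ip0l h : ip (fun=> 0) h = 0.
Proof.
rewrite /ip /Rintegral; under eq_integral do rewrite !mul0r.
by rewrite integral0.
Qed.

Lemma ipBl f g h : sqi f -> sqi g -> sqi h ->
  ip (fun x => f x - g x) h = ip f h - ip g h.
Proof.
move=> sf sg sh.
have -> : (fun x => f x - g x) = (fun x => f x + (-1) * g x).
  by apply/funext => x; rewrite mulN1r.
by rewrite ipDl ?ipZl ?mulN1r//; exact: sqiZ.
Qed.

Lemma ip_suml n (F : nat -> T -> R) h : (forall k, sqi (F k)) -> sqi h ->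
  ip (fun x => \sum_(k < n) F k x) h = \sum_(k < n) ip (F k) h.
Proof.
move=> sF sh; elim: n => [|n ih].
  by rewrite big_ord0; under eq_fun do rewrite big_ord0; rewrite ip0l.
rewrite big_ord_recr /= -ih -ipDl//; last exact: sqi_sum.
by congr ip; apply/funext => x; rewrite big_ord_recr.
Qed.

Lemma ip_ge0 f : 0 <= ip f f.
Proof.
by apply: Rintegral_ge0 => x Dx; rewrite mulr_ge0 ?w0// -expr2 sqr_ge0.
Qed.

Lemma ip_sqrBZ f g t : sqi f -> sqi g ->
  ip (fun x => f x - t * g x) (fun x => f x - t * g x) =
  ip f f - 2 * t * ip f g + t ^+ 2 * ip g g.
Proof.
move=> sf sg; have st := sqiZ t sg; have sb := sqiB sf st.
rewrite ipBl// ipZl// (ipC f) (ipC g) !ipBl// !ipZl// (ipC g f); ring.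
Qed.

Lemma ip_CS f g : sqi f -> sqi g -> ip f g ^+ 2 <= ip f f * ip g g.
Proof.
move=> sf sg; have P t := ip_ge0 (fun x => f x - t * g x).
have {}P t : 0 <= ip f f - 2 * t * ip f g + t ^+ 2 * ip g g.
  by rewrite -ip_sqrBZ.
have := ip_ge0 g; rewrite le_eqVlt => /predU1P[g0|g0].
  rewrite -g0 mulr0; have [->|fg0] := eqVneq (ip f g) 0; first by rewrite expr0n.
  have := P ((ip f f + 1) / (2 * ip f g)); rewrite -g0 mulr0 addr0.
  have -> : 2 * ((ip f f + 1) / (2 * ip f g)) * ip f g = ip f f + 1 by field.
  lra.
have := P (ip f g / ip g g).
have -> : ip f f - 2 * (ip f g / ip g g) * ip f g + (ip f g / ip g g) ^+ 2 * ip g g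
  = (ip f f * ip g g - ip f g ^+ 2) / ip g g by field; rewrite gt_eqF.
by rewrite pmulr_lge0 ?invr_gt0// subr_ge0.
Qed.

Lemma ip_eq0 f g : sqi f -> sqi g -> ip f f = 0 -> ip f g = 0.
Proof.
move=> sf sg f0; apply/eqP; rewrite -sqrf_eq0; apply/eqP/le_anti.
by rewrite sqr_ge0 andbT (le_trans (ip_CS sf sg))// f0 mul0r.
Qed.

Lemma ip_norm_le f g : sqi f -> sqi g ->
  `|ip f g| <= Num.sqrt (ip f f) * Num.sqrt (ip g g).
Proof.
move=> sf sg; rewrite -sqrtrM ?ip_ge0// -sqrtr_sqr ler_sqrt ?mulr_ge0 ?ip_ge0//.
exact: ip_CS.
Qed.

Section orthonormal.
Variable e : nat -> T -> R.
Hypothesis se : forall n, sqi (e n).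
Hypothesis oe : forall m n, ip (e m) (e n) = (m == n)%:R.

Definition comb (c : nat -> R) n : T -> R := fun x => \sum_(k < n) c k * e k x.

Lemma sqi_comb c n : sqi (comb c n).
Proof. by apply: (@sqi_sum n (fun k x => c k * e k x)) => k; exact: sqiZ. Qed.

Lemma ip_comb_l c n h : sqi h -> ip (comb c n) h = \sum_(k < n) c k * ip (e k) h.
Proof.
move=> sh; rewrite /comb (@ip_suml n (fun k x => c k * e k x))//; last first.
  by move=> k; exact: sqiZ.
by apply: eq_bigr => k _; rewrite ipZl.
Qed.

Lemma ip_comb_e c n m : ip (comb c n) (e m) = if (m < n)%N then c m else 0.
Proof.
rewrite ip_comb_l//.
under eq_bigr do rewrite oe.
case: ltnP => mn.
  rewrite (bigD1 (Ordinal mn))//= eqxx mulr1 big1 ?addr0// => i.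
  by rewrite -val_eqE/= => /negbTE ->; rewrite mulr0.
rewrite big1// => i _; rewrite (_ : (_ == _) = false) ?mulr0//.
by apply/negbTE; rewrite neq_ltn (leq_trans (ltn_ord i) mn).
Qed.

Lemma ip_comb c n : ip (comb c n) (comb c n) = \sum_(k < n) c k ^+ 2.
Proof.
rewrite ip_comb_l; last exact: sqi_comb.
by apply: eq_bigr => k _; rewrite ipC ip_comb_e ltn_ord expr2.
Qed.

Lemma ip_sub_comb f n c : (forall k, c k = ip f (e k)) -> sqi f ->
  let r := (fun x => f x - comb c n x) in
  ip r r = ip f f - \sum_(k < n) c k ^+ 2.
Proof.
move=> cE sf /=; have sc := sqi_comb c n.
have := @ip_sqrBZ f (comb c n) 1 sf sc; under eq_fun do rewrite mul1r.
move=> ->; rewrite ip_comb ipC ip_comb_l//.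
have -> : \sum_(k < n) c k * ip (e k) f = \sum_(k < n) c k ^+ 2.
  by apply: eq_bigr => k _; rewrite ipC -cE -expr2.
ring.
Qed.

Lemma bessel f n : sqi f -> \sum_(k < n) ip f (e k) ^+ 2 <= ip f f.
Proof.
move=> sf; rewrite -subr_ge0.
have := @ip_sub_comb f n _ (fun=> erefl) sf => /= <-.
exact: ip_ge0.
Qed.

(** If the Fourier expansion of f alone converges to f, then the inner product with
    an arbitrary g is the sum of the products of coefficients: the remainder of f
    tends to 0 and Cauchy-Schwarz applies. Completeness of the family is not
    assumed, and this is what allows completeness of the Laguerre family to be
    derived from the kernels. *)
Lemma parseval_ip f g : sqi f -> sqi g ->
  (\sum_(k < n) ip f (e k) ^+ 2) @[n --> \oo] --> ip f f ->
  (\sum_(k < n) ip f (e k) * ip g (e k)) @[n --> \oo] --> ip f g.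
Proof.
move=> sf sg cf; pose c k := ip f (e k).
have B n : `|ip f g - \sum_(k < n) ip f (e k) * ip g (e k)| <=
   Num.sqrt (ip f f - \sum_(k < n) ip f (e k) ^+ 2) * Num.sqrt (ip g g).
  have -> : \sum_(k < n) ip f (e k) * ip g (e k) = ip (comb c n) g.
    by rewrite ip_comb_l//; apply: eq_bigr => k _; rewrite (ipC g).
  rewrite -ipBl//; last exact: sqi_comb.
  rewrite (le_trans (ip_norm_le _ _))//; first exact: sqiB (sqi_comb _ _).
  by rewrite (@ip_sub_comb f n c).
have L : (fun n => Num.sqrt (ip f f - \sum_(k < n) ip f (e k) ^+ 2) * Num.sqrt (ip g g))
   @ \oo --> Num.sqrt (ip f f - ip f f) * Num.sqrt (ip g g).
  apply: cvgM; last exact: cvg_cst.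
  apply: continuous_cvg; first exact: sqrt_continuous.
  by apply: cvgB => //; exact: cvg_cst.
rewrite subrr sqrtr0 mul0r in L.
exact: cvg_dist0 B L.
Qed.

Lemma ip_comb_diff c m n : (m <= n)%N ->
  let r := (fun x => comb c n x - comb c m x) in
  ip r r = \sum_(k < n) c k ^+ 2 - \sum_(k < m) c k ^+ 2.
Proof.
move=> mn /=; have sn := sqi_comb c n; have sm := sqi_comb c m.
have := @ip_sqrBZ (comb c n) (comb c m) 1 sn sm; under eq_fun do rewrite mul1r.
move=> ->; rewrite !ip_comb (ipC (comb c n)) ip_comb_l//.
have -> : \sum_(k < m) c k * ip (e k) (comb c n) = \sum_(k < m) c k ^+ 2.
  apply: eq_bigr => k _; rewrite ipC ip_comb_e expr2.
  by rewrite (leq_trans (ltn_ord k) mn).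
ring.
Qed.

(** A subsequence along which the remainders of the sum of squares are below 4^(-k)
    has increments whose weighted L1 norms are summable (the total mass of w is
    finite), hence converges almost everywhere where w is nonzero; the distance of
    its limit to the partial sums is controlled by Fatou's lemma. *)
Lemma riesz_fischer (c : nat -> R) (L : R) : mu.-integrable D (EFin \o w) ->
  (\sum_(k < n) c k ^+ 2) @[n --> \oo] --> L ->
  exists psi, sqi psi /\
    forall n, let r := (fun x => psi x - comb c n x) in
      ip r r <= L - \sum_(k < n) c k ^+ 2.
Proof.
move=> iw; set s := fun n => \sum_(k < n) c k ^+ 2 => sL.
have s_nd : {homo s : m n / (m <= n)%N >-> m <= n}.
  apply/nondecreasing_seqP => n; rewrite /s big_ord_recr/= lerDl sqr_ge0//.
have sleL n : s n <= L.
  by rewrite -(cvg_lim _ sL)//; apply: nondecreasing_cvgn_le => //; exact/cvgP/sL.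
(* Choice of a strictly controlled subsequence N k. *)
have exN k : exists N, L - s N <= (4^-1) ^+ k.
  move/cvgrPdist_le : sL => /(_ ((4^-1) ^+ k)) [|N _ HN]; first by rewrite exprn_gt0.
  by exists N; rewrite (le_trans (ler_norm _))// HN//=.
have {exN}[M HM] := choice exN.
pose N k := (\sum_(j < k.+1) (M j).+1)%N.
have NS k : (N k <= N k.+1)%N by rewrite /N [leqRHS]big_ord_recr leq_addr.
have MN k : (M k <= N k)%N.
  by rewrite /N big_ord_recr/=; apply: leq_trans (leq_addl _ _).
have kN k : (k <= N k)%N.
  elim: k => // k ih; by rewrite /N big_ord_recr/= addnS ltnS (leq_trans ih)// leq_addr.
have tN k : L - s (N k) <= (4^-1) ^+ k.
  by apply: le_trans (HM k); rewrite lerB// s_nd.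
pose Dl k x := comb c (N k.+1) x - comb c (N k) x.
have sDl k : sqi (Dl k) by apply: sqiB; exact: sqi_comb.
have ipDl_le k : ip (Dl k) (Dl k) <= (4^-1) ^+ k.
  rewrite (@ip_comb_diff c _ _ (NS k)); apply: le_trans (tN k).
  by rewrite lerB// sleL.
pose W := \int[mu]_(x in D) w x.
have W0 : 0 <= W by apply: Rintegral_ge0.
(* |D| <= 2^k D^2 + 2^(-k), so the increments are summable in L1(w). *)
have h_le k : (\int[mu]_(x in D) (`|Dl k x| * w x)%:E <=
    (geometric (1 + W) (2^-1) k)%:E)%E.
  have iDl2 : mu.-integrable D (fun x => (2 ^+ k * (Dl k x * Dl k x * w x))%:E).
    by under eq_fun do rewrite EFinM; apply: integrableZl => //; exact: sqi_mul.
  have iw2 : mu.-integrable D (fun x => ((2^-1) ^+ k * w x)%:E).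
    by under eq_fun do rewrite EFinM; exact: integrableZl.
  apply: (@le_trans _ _ (\int[mu]_(x in D) ((2 ^+ k * (Dl k x * Dl k x * w x))%:E +
       ((2^-1) ^+ k * w x)%:E))%E).
    apply: ge0_le_integral => //.
    - by move=> x Dx; rewrite lee_fin mulr_ge0 ?w0.
    - apply/measurable_EFinP/measurable_funM => //.
      by apply: measurableT_comp => //; case: (sDl k).
    - apply: emeasurable_funD; first exact: measurable_int iDl2.
      exact: measurable_int iw2.
    - move=> x Dx; rewrite -EFinD lee_fin mulrA -mulrDl ler_wpM2r ?w0//.
      have p0 : 0 < 2 ^+ k :> R by rewrite exprn_gt0.
      have -> : Dl k x * Dl k x = `|Dl k x| ^+ 2 by rewrite real_normK ?num_real// expr2.
      rewrite exprVn -subr_ge0.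
      have -> : 2 ^+ k * `|Dl k x| ^+ 2 + (2 ^+ k)^-1 - `|Dl k x| =
         ((2 ^+ k * `|Dl k x| - 2^-1) ^+ 2 + 3 / 4) / 2 ^+ k :> R.
        by field; rewrite gt_eqF.
      by rewrite divr_ge0 ?addr_ge0 ?sqr_ge0// ltW.
  rewrite integralD//=.
  under [X in (X + _)%E]eq_integral do rewrite EFinM.
  under [X in (_ + X)%E]eq_integral do rewrite EFinM.
  rewrite !integralZl//; last exact: sqi_mul.
  have E f : mu.-integrable D (EFin \o f) ->
     (\int[mu]_(x in D) (f x)%:E = (\int[mu]_(x in D) f x)%:E)%E.
    by move=> fi; rewrite /Rintegral fineK//; exact: integrable_fin_num.
  rewrite !E//; last exact: sqi_mul.
  rewrite -!EFinM -EFinD lee_fin /geometric /= mulrDl mul1r.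
  rewrite [X in _ <= X + _](_ : _ = 2 ^+ k * (4^-1) ^+ k); last first.
    by rewrite -exprMn; congr (_ ^+ _); field.
  by rewrite (mulrC (_ ^+ _) W) lerD2r ler_wpM2l ?exprn_ge0//; exact: ipDl_le.
have mh k : measurable_fun D (fun x => (`|Dl k x| * w x)%:E).
  apply/measurable_EFinP/measurable_funM => //.
  by apply: measurableT_comp => //; case: (sDl k).
have h0 k x : D x -> (0 <= (`|Dl k x| * w x)%:E)%E.
  by move=> Dx; rewrite lee_fin mulr_ge0 ?w0.
have aeh : {ae mu, forall x, D x -> (\sum_(0 <= k <oo) (`|Dl k x| * w x)%:E < +oo)%E}.
  suff /integrable_ae : mu.-integrable D
      (fun x => \sum_(0 <= k <oo) (`|Dl k x| * w x)%:E)%E.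
    move=> /(_ mD); apply: filterS => x fx Dx; rewrite ltey_eq fx//.
  apply/integrableP; split.
    by apply: ge0_emeasurable_sum => // k x Dx _; exact: h0.
  under eq_integral.
    move=> x xD; rewrite gee0_abs; last first.
      by apply: nneseries_ge0 => k _ _; apply: h0; rewrite inE in xD.
    over.
  rewrite integral_nneseries//.
  apply: (@le_lt_trans _ _ (\sum_(0 <= k <oo) (geometric (1 + W) (2^-1) k)%:E)%E).
    by apply: lee_nneseries => // k _ _; apply: integral_ge0 => x Dx; exact: h0.
  have cg := @cvg_geometric_series R (1 + W) 2^-1.
  rewrite (_ : (\sum_(0 <= k <oo) _)%E = ((1 + W) / (1 - 2^-1))%:E) ?ltry//.
  apply/cvg_lim => //.
  under eq_fun do rewrite sumEFin.
  apply: cvg_EFin; first exact: nearW.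
  by apply: cg; rewrite ger0_norm// invf_lt1// ltr1n.
(* An upper limit is measurable everywhere and equals the limit where it exists. *)
pose psi x := fine (limn_esup (fun k => (comb c (N k) x)%:E)).
have cvgpsi x l : comb c (N k) x @[k --> \oo] --> l -> psi x = l.
  move=> cl; rewrite /psi.
  have /cvg_limn_einf_sup[_ ->]// : (fun k => (comb c (N k) x)%:E) @ \oo --> l%:E.
  by apply: cvg_EFin => //; exact: nearW.
have mpsi : measurable_fun D psi.
  have mfi : measurable_fun [set: \bar R] (@fine R) by exact: fine_measurable.
  apply: (measurableT_comp mfi).
  apply: measurable_fun_limn_esup => n; apply/measurable_EFinP.
  by case: (sqi_comb c (N n)).
have aecv : {ae mu, forall x, D x -> w x != 0 -> comb c (N k) x @[k --> \oo] --> psi x}.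
  apply: filterS aeh => x fx Dx wx; have {fx} fx := fx Dx.
  have wx0 : 0 < w x by rewrite lt_neqAle eq_sym wx w0.
  suff : cvgn (fun k => comb c (N k) x).
    by move=> /cvg_ex[l cl]; rewrite (cvgpsi _ _ cl).
  pose u k := comb c (N k) x.
  have -> : (fun k => comb c (N k) x) = (fun n => u 0%N + series (telescope u) n).
    by apply/funext => n; rewrite -eq_sum_telescope.
  apply: is_cvgD; first exact: is_cvg_cst.
  apply: (@normed_cvg R R^o).
  apply: nondecreasing_is_cvgn.
    move=> m n mn; rewrite -[X in X <= _]/(\sum_(0 <= k < m) `|Dl k x|).
    rewrite -[X in _ <= X]/(\sum_(0 <= k < n) `|Dl k x|) (big_cat_nat (leq0n m) mn)/=.
    by rewrite lerDl sumr_ge0.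
  exists (fine (\sum_(0 <= k <oo) (`|Dl k x| * w x)%:E)%E / w x) => _ [n _ <-].
  rewrite ler_pdivlMr// -lee_fin fineK; last first.
    by rewrite ge0_fin_numE//; apply: nneseries_ge0 => k _ _; exact: h0.
  rewrite /series/= mulr_suml -sumEFin.
  by apply: nneseries_lim_ge => k _ _; exact: h0.
have bd n : (\int[mu]_(x in D) ((psi x - comb c n x) ^+ 2 * w x)%:E <= (L - s n)%:E)%E.
  apply: (@fatou_le _ _ _ mu D mD
     (fun k x => ((comb c (N (k + n)%N) x - comb c n x) ^+ 2 * w x)%:E)).
  - move=> k; apply/measurable_EFinP/measurable_funM => //.
    apply: measurable_funX; apply: measurable_funB; first by case: (sqi_comb c (N (k + n)%N)).
    by case: (sqi_comb c n).
  - by move=> k x Dx; rewrite lee_fin mulr_ge0 ?w0// sqr_ge0.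
  - apply/measurable_EFinP/measurable_funM => //.
    apply: measurable_funX; apply: measurable_funB => //.
    by case: (sqi_comb c n).
  - by move=> x Dx; rewrite lee_fin mulr_ge0 ?w0// sqr_ge0.
  - apply: filterS aecv => x cx Dx; have [->|wx] := eqVneq (w x) 0.
      under eq_fun do rewrite mulr0; rewrite mulr0; exact: cvg_cst.
    apply: cvg_EFin; first exact: nearW.
    apply: cvgM; last exact: cvg_cst.
    have cx' : (comb c (N (k + n)%N) x - comb c n x) @[k --> \oo] --> psi x - comb c n x.
      apply: cvgB; last exact: cvg_cst.
      by have := cx Dx wx; rewrite -(@cvg_shiftn n _ (fun k => comb c (N k) x)).
    by under eq_fun do rewrite expr2; rewrite expr2; exact: cvgM.
  - move=> k.
    have le_n : (n <= N (k + n))%N by rewrite (leq_trans (leq_addl k n)).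
    rewrite -(fineK (_ : \int[mu]_(x in D) _ \is a fin_num)%E); last first.
      have [_] := sqiB (sqi_comb c (N (k + n))) (sqi_comb c n).
      exact: integrable_fin_num.
    rewrite lee_fin; have := @ip_comb_diff c _ _ le_n; rewrite /ip /Rintegral.
    under eq_integral do rewrite -expr2.
    by move=> ->; rewrite lerB// sleL.
have spn n : sqi (fun x => psi x - comb c n x).
  split; first by apply: measurable_funB => //; case: (sqi_comb c n).
  apply/integrableP; split.
    apply/measurable_EFinP/measurable_funM => //.
    by apply: measurable_funX; apply: measurable_funB => //; case: (sqi_comb c n).
  under eq_integral.
    move=> x /[!inE] Dx; rewrite gee0_abs; last by rewrite lee_fin mulr_ge0 ?w0// sqr_ge0.
    over.
  by rewrite (le_lt_trans (bd n))// ltry.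
exists psi; split.
  have := sqiD (spn 0%N) (sqi_comb c 0); congr sqi.
  by apply/funext => x; rewrite subrK.
move=> n /=; rewrite -lee_fin; apply: le_trans (bd n).
rewrite /ip /Rintegral fineK; last by apply: integrable_fin_num => //; exact: sqi_mul.
by under eq_integral do rewrite -expr2.
Qed.

Lemma riesz_fischer_coef (c : nat -> R) (L : R) psi : sqi psi ->
  (\sum_(k < n) c k ^+ 2) @[n --> \oo] --> L ->
  (forall n, let r := (fun x => psi x - comb c n x) in
      ip r r <= L - \sum_(k < n) c k ^+ 2) ->
  forall k, ip psi (e k) = c k.
Proof.
move=> sp sL H k; apply/eqP; rewrite -subr_eq0 -normr_le0.
apply/ler_addgt0Pr => eps eps0; rewrite add0r.
have : \forall n \near \oo, L - \sum_(k < n) c k ^+ 2 <= eps ^+ 2.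
  move/cvgrPdist_le : sL => /(_ (eps ^+ 2)); rewrite exprn_gt0// => /(_ isT).
  by apply: filterS => n; apply: le_trans; exact: ler_norm.
move=> /(filterI (nbhs_infty_gt k)) /filter_ex[n [kn Ln]].
have -> : ip psi (e k) - c k = ip (fun x => psi x - comb c n x) (e k).
  by rewrite ipBl//; [rewrite ip_comb_e kn|exact: sqi_comb].
have sr : sqi (fun x => psi x - comb c n x) by apply: sqiB => //; exact: sqi_comb.
rewrite (le_trans (ip_norm_le sr (se k)))// oe eqxx sqrtr1 mulr1.
rewrite -(ger0_norm (ltW eps0)) -sqrtr_sqr ler_sqrt ?sqr_ge0//.
exact: le_trans (H n) Ln.
Qed.

Definition complete_system :=
  forall f, sqi f -> (forall k, ip f (e k) = 0) -> ip f f = 0.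

(** The function built from the coefficients of f by the Riesz-Fischer theorem
    differs from f by a function orthogonal to the whole family, so completeness
    identifies the two. *)
Lemma parseval_complete f : mu.-integrable D (EFin \o w) -> complete_system ->
  sqi f -> (\sum_(k < n) ip f (e k) ^+ 2) @[n --> \oo] --> ip f f.
Proof.
move=> iw ce sf; pose c k := ip f (e k).
have /cvg_ex[L sL] : cvgn (fun n => \sum_(k < n) c k ^+ 2).
  apply: nondecreasing_is_cvgn.
    by apply/nondecreasing_seqP => n; rewrite big_ord_recr/= lerDl sqr_ge0.
  by exists (ip f f) => _ [n _ <-]; exact: bessel.
have [psi [sp H]] := riesz_fischer iw sL.
have cp := riesz_fischer_coef sp sL H.
have s1 : sqi (fun x => f x - psi x) by exact: sqiB.
have f1 : ip (fun x => f x - psi x) (fun x => f x - psi x) = 0.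
  by apply: ce => // k; rewrite ipBl// cp subrr.
suff -> : ip f f = L by [].
apply/eqP; rewrite eq_le; apply/andP; split; last first.
  by rewrite -(cvg_lim _ sL)//; apply: limr_le; [exact/cvgP/sL|apply: nearW => n; exact: bessel].
have := ip_eq0 s1 sf f1; rewrite ipBl// => /eqP; rewrite subr_eq0 => /eqP ff.
have := ip_eq0 s1 sp f1; rewrite ipBl// => /eqP; rewrite subr_eq0 ipC => /eqP fp.
have := H 0%N; rewrite big_ord0 subr0 /comb /=.
under [X in ip X]eq_fun do rewrite big_ord0 subr0.
under [X in ip _ X]eq_fun do rewrite big_ord0 subr0.
by rewrite ff fp.
Qed.

End orthonormal.
End weighted_L2.

(** * Derivatives, integrals depending on a parameter, exhaustion *)

Section derivatives.
Context {R : realType}.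
Implicit Types (f g : R -> R) (x a b : R).

(** The lemmas der_... are stated for functions written pointwise, so that proof
    terms assembled from them compute the derivative of an explicit expression;
    der_eq then adjusts its value. *)
Lemma der_eq f x a b : is_derive x 1 f a -> a = b -> is_derive x 1 f b.
Proof. by move=> ? <-. Qed.
Lemma der_mul f g x a b : is_derive x 1 f a -> is_derive x 1 g b ->
  is_derive x 1 (fun t => f t * g t) (a * g x + f x * b).
Proof.
move=> df dg; have H : is_derive x 1 (f * g) (f x *: b + g x *: a) by apply: is_deriveM.
by apply: (der_eq H); rewrite /GRing.scale/=; ring.
Qed.
Lemma der_add f g x a b : is_derive x 1 f a -> is_derive x 1 g b ->
  is_derive x 1 (fun t => f t + g t) (a + b).
Proof.
by move=> df dg; have H : is_derive x 1 (f + g) (a + b) by apply: is_deriveD.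
Qed.
Lemma der_sub f g x a b : is_derive x 1 f a -> is_derive x 1 g b ->
  is_derive x 1 (fun t => f t - g t) (a - b).
Proof.
by move=> df dg; have H : is_derive x 1 (f - g) (a - b) by apply: is_deriveB.
Qed.
Lemma der_opp f x a : is_derive x 1 f a -> is_derive x 1 (fun t => - f t) (- a).
Proof.
by move=> df; have H : is_derive x 1 (- f) (- a) by apply: is_deriveN.
Qed.
Lemma der_id x : is_derive x 1 (fun t : R => t) 1.
Proof. exact: is_derive_id. Qed.
Lemma der_cst c x : is_derive x 1 (fun _ : R => c) (0 : R).
Proof. exact: is_derive_cst. Qed.
Lemma der_comp f g x a b : is_derive (g x) 1 f a -> is_derive x 1 g b ->
  is_derive x 1 (fun t => f (g t)) (a * b).
Proof. by move=> df dg; exact: is_derive1_comp. Qed.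
Lemma der_exp g x b : is_derive x 1 g b ->
  is_derive x 1 (fun t => expR (g t)) (expR (g x) * b).
Proof. by move=> dg; apply: (@der_comp expR). Qed.
Lemma der_cos g x b : is_derive x 1 g b ->
  is_derive x 1 (fun t => cos (g t)) (- sin (g x) * b).
Proof. by move=> dg; apply: (@der_comp cos). Qed.
Lemma der_sin g x b : is_derive x 1 g b ->
  is_derive x 1 (fun t => sin (g t)) (cos (g x) * b).
Proof. by move=> dg; apply: (@der_comp sin). Qed.
Lemma der_pow p g x b : 0 < g x -> is_derive x 1 g b ->
  is_derive x 1 (fun t => g t `^ p) (p * g x `^ (p - 1) * b).
Proof. by move=> g0 dg; apply: (@der_comp (fun t => t `^ p)); exact: is_derive1_powR. Qed.
Lemma der_atan g x b : is_derive x 1 g b ->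
  is_derive x 1 (fun t => atan (g t)) ((1 + g x ^+ 2)^-1 * b).
Proof. by move=> dg; apply: (@der_comp atan). Qed.
Lemma der_scale c x : is_derive x 1 (fun t : R => t * c) c.
Proof. by apply: (der_eq (der_mul (der_id x) (der_cst c x))); ring. Qed.
Lemma der_continuous f x a : is_derive x 1 f a -> {for x, continuous f}.
Proof. by move=> [df _]; apply/differentiable_continuous/derivable1_diffP. Qed.
Lemma der_derive1 f x a : is_derive x 1 f a -> f^`()%classic x = a.
Proof. by move=> [_ <-]; rewrite derive1E. Qed.

End derivatives.

Section integrable_real.
Context d (T : measurableType d) {R : realType} (nu : {measure set T -> \bar R}) (D : set T) (mD : measurable D).
Implicit Types f g : T -> R.

Lemma intZ k f : nu.-integrable D (EFin \o f) -> nu.-integrable D (EFin \o (fun x => k * f x)).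
Proof. by move=> fi; have := integrableZl mD k fi; congr integrable. Qed.
Lemma intD f g : nu.-integrable D (EFin \o f) -> nu.-integrable D (EFin \o g) ->
  nu.-integrable D (EFin \o (fun x => f x + g x)).
Proof. by move=> fi gi; have := integrableD mD fi gi; congr integrable. Qed.
Lemma intB f g : nu.-integrable D (EFin \o f) -> nu.-integrable D (EFin \o g) ->
  nu.-integrable D (EFin \o (fun x => f x - g x)).
Proof. by move=> fi gi; have := integrableB mD fi gi; congr integrable. Qed.
Lemma int0 : nu.-integrable D (EFin \o (fun=> 0 : R)).
Proof. exact: integrable0. Qed.
Lemma int_sum n (F : nat -> T -> R) : (forall k, nu.-integrable D (EFin \o F k)) ->
  nu.-integrable D (EFin \o (fun x => \sum_(k < n) F k x)).
Proof.
move=> Fi; elim: n => [|n ih].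
  by under [X in EFin \o X]eq_fun do rewrite big_ord0; exact: int0.
by under [X in EFin \o X]eq_fun do rewrite big_ord_recr/=; exact: intD.
Qed.
Lemma int_le f g : measurable_fun D f -> (forall x, D x -> `|f x| <= g x) ->
  nu.-integrable D (EFin \o g) -> nu.-integrable D (EFin \o f).
Proof.
move=> mf fg; apply: le_integrable => //; first exact/measurable_EFinP.
by move=> x Dx /=; rewrite lee_fin (le_trans (fg x Dx))// ler_norm.
Qed.
Lemma Rintegral_sum n (F : nat -> T -> R) : (forall k, nu.-integrable D (EFin \o F k)) ->
  \int[nu]_(x in D) (\sum_(k < n) F k x) = \sum_(k < n) \int[nu]_(x in D) F k x.
Proof.
move=> Fi; elim: n => [|n ih].
  rewrite big_ord0 /Rintegral; under eq_integral do rewrite big_ord0.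
  by rewrite integral0.
rewrite big_ord_recr/= -ih -RintegralD//; last exact: int_sum.
by apply: eq_Rintegral => x _; rewrite big_ord_recr.
Qed.

End integrable_real.

Lemma continuous_meas {R : realType} (D : set (measurableTypeR R)) (f : R -> R) :
  (forall x : R, {for x, continuous f}) -> measurable_fun D f.
Proof.
by move=> cf; apply: measurable_funS (continuous_measurable_fun cf).
Qed.

Lemma der_integral d (Y : measurableType d) {R : realType} (nu : {measure set Y -> \bar R})
    (B : set Y) (mB : measurable B) (f f' : R -> Y -> R) (G : Y -> R) (y u v : R) :
  u < y < v ->
  (forall z, u < z < v -> nu.-integrable B (EFin \o f z)) ->
  (forall z t, u < z < v -> B t -> is_derive z 1 (fun s => f s t) (f' z t)) ->
  (forall z t, u < z < v -> B t -> `|f' z t| <= G t) ->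
  nu.-integrable B (EFin \o G) ->
  is_derive y 1 (fun s => \int[nu]_(t in B) f s t) (\int[nu]_(t in B) f' y t).
Proof.
move=> uyv fi df fG Gi.
have yI : `]u, v[%classic y by rewrite /= in_itv.
have A1 z : `]u, v[%classic z -> nu.-integrable B (EFin \o f z).
  by rewrite /= in_itv; exact: fi.
have A2 z t : `]u, v[%classic z -> B t -> derivable (fun s => f s t) z 1.
  by rewrite /= in_itv /= => zI Bt; have [] := df z t zI Bt.
have E z t : `]u, v[%classic z -> B t -> partial1of2 f z t = f' z t.
  by rewrite /= in_itv/= => zI Bt; exact: (der_derive1 (df z t zI Bt)).
have A3 t : 0 <= `|G t| by [].
have A4 : nu.-integrable B (EFin \o (fun t => `|G t|)).
  have := integrable_norm Gi; congr integrable.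
have A5 z t : `]u, v[%classic z -> B t -> `|partial1of2 f z t| <= `|G t|.
  move=> zI Bt; rewrite E// (le_trans _ (ler_norm _))//; exact: fG.
have D := derivable_under_integral mB yI A1 A2 A3 A4 A5.
have := differentiation_under_integral mB yI A1 A2 A3 A4 A5.
rewrite derive1E => DE; apply: DeriveDef; first exact: D.
by rewrite [LHS]DE; apply: eq_Rintegral => t /[!inE] Bt; rewrite E.
Qed.

Lemma dominated_Rintegral d (T : measurableType d) {R : realType}
    (nu : {measure set T -> \bar R}) (D : set T) (mD : measurable D)
    (f_ : nat -> T -> R) (f g : T -> R) :
  (forall n, measurable_fun D (f_ n)) -> measurable_fun D f ->
  {ae nu, forall x, D x -> f_ n x @[n --> \oo] --> f x} ->
  (forall n x, D x -> `|f_ n x| <= g x) -> nu.-integrable D (EFin \o g) ->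
  nu.-integrable D (EFin \o f) /\
  (\int[nu]_(x in D) f_ n x) @[n --> \oo] --> \int[nu]_(x in D) f x.
Proof.
move=> mfn mf cf fg gi.
have mfn' n : measurable_fun D (EFin \o f_ n) by exact/measurable_EFinP.
have mf' : measurable_fun D (EFin \o f) by exact/measurable_EFinP.
have cf' : {ae nu, forall x, D x -> (f_ n x)%:E @[n --> \oo] --> (EFin \o f) x}.
  by apply: filterS cf => x cx Dx; apply: cvg_EFin; [exact: nearW|exact: cx].
have bf' : {ae nu, forall x n, D x -> (`|(f_ n x)%:E| <= (EFin \o g) x)%E}.
  by apply: aeW => x n Dx; rewrite lee_fin fg.
have [fi _ H] := dominated_convergence mD mfn' mf' cf' gi bf'.
split => //; rewrite /Rintegral; apply: fine_cvg; rewrite fineK//.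
exact: integrable_fin_num.
Qed.

Section integral_exhaustion.
Context {R : realType}.
Local Notation mu := (@lebesgue_measure R).

Lemma cvg_Rintegral_exhaust d (T : measurableType d) (nu : {measure set T -> \bar R})
    (D : set T) (mD : measurable D) (E : nat -> set T) (f : T -> R) :
  (forall n, measurable (E n)) -> (forall n, E n `<=` D) ->
  (forall x, D x -> \forall n \near \oo, E n x) ->
  nu.-integrable D (EFin \o f) ->
  (\int[nu]_(x in E n) f x) @[n --> \oo] --> \int[nu]_(x in D) f x.
Proof.
move=> mE ED cE fi; have mf := measurable_int nu fi.
have H n : (\int[nu]_(x in E n) (f x)%:E = \int[nu]_(x in D) (f \_ (E n) x)%:E)%E.
  rewrite -[E n in LHS](setIidr (ED n)) integral_mkcondr; apply: eq_integral => x _.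
  by rewrite !patchE; case: ifP.
have mfn n : measurable_fun D (fun x => (f \_ (E n) x)%:E).
  apply/measurable_EFinP; apply/(measurable_restrict _ (mE n) mD).
  rewrite setIidr//; have := measurable_int nu (integrableS mD (mE n) (ED n) fi).
  by move/measurable_EFinP.
have cfn : {ae nu, forall x, D x -> (f \_ (E n) x)%:E @[n --> \oo] --> (EFin \o f) x}.
  apply: aeW => x Dx; apply: cvg_near_cst; near=> n.
  by rewrite patchE mem_set//; near: n; exact: cE.
have bfn : {ae nu, forall x n, D x -> (`|(f \_ (E n) x)%:E| <= `|f x|%:E)%E}.
  by apply: aeW => x n Dx; rewrite patchE; case: ifP => _ /=; rewrite lee_fin ?normr0.
have [_ _] := dominated_convergence mD mfn mf cfn (integrable_norm fi) bfn.
move=> H2; rewrite /Rintegral; apply: fine_cvg; rewrite fineK; last exact: integrable_fin_num.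
by under eq_fun do rewrite H.
Unshelve. all: by end_near. Qed.

(** The fundamental theorem of calculus on an arbitrary interval J, bounded or not,
    exhausted by compact intervals; integrability over J is assumed, so the boundary
    values need only exist as limits along the exhaustion. *)
Lemma FTC_open (a_ b_ : nat -> R) (J : set R) (f F : R -> R) (l0 l1 : R) :
  measurable J -> (forall n, a_ n < b_ n) ->
  (forall n, `[a_ n, b_ n] `<=` J) ->
  (forall x, J x -> \forall n \near \oo, `[a_ n, b_ n]%classic x) ->
  (forall x, J x -> is_derive x 1 F (f x)) ->
  (forall x, J x -> {for x, continuous f}) ->
  mu.-integrable J (EFin \o f) ->
  F (a_ n) @[n --> \oo] --> l0 -> F (b_ n) @[n --> \oo] --> l1 ->
  \int[mu]_(x in J) f x = l1 - l0.
Proof.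
move=> mJ ab abJ cJ dF cf fi F0 F1.
have H := @cvg_Rintegral_exhaust _ _ mu J mJ (fun n => `[a_ n, b_ n]%classic) f
   (fun n => measurable_itv _) abJ cJ fi.
suff E : (fun n => \int[mu]_(x in `[a_ n, b_ n]) f x) = (fun n => F (b_ n) - F (a_ n)).
  by rewrite E in H; apply: (cvg_unique _ H) => //; exact: cvgB.
apply/funext => n; rewrite /Rintegral (@continuous_FTC2 R f F)//=.
  - by apply: continuous_in_subspaceT => x /[!inE] xab; apply: cf; exact: abJ xab.
  - have cF x : `[a_ n, b_ n]%classic x -> {for x, continuous F}.
      by move=> /abJ /dF; exact: der_continuous.
    split.
    + move=> x xab; have [|//] := dF x; apply: (abJ n); exact: subset_itv_oo_cc xab.
    + by apply: cvg_at_right_filter; apply: cF; rewrite /= in_itv/= lexx ltW.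
    + by apply: cvg_at_left_filter; apply: cF; rewrite /= in_itv/= lexx ltW.
  - move=> x xab; apply: der_derive1; apply: dF; apply: (abJ n); exact: subset_itv_oo_cc xab.
Qed.

End integral_exhaustion.

Lemma FTC_closed {R : realType} (f F : R -> R) (a b : R) : a < b ->
  (forall x, a <= x <= b -> is_derive x 1 F (f x)) ->
  (forall x, a <= x <= b -> {for x, continuous f}) ->
  (\int[@lebesgue_measure R]_(x in `[a, b]) (f x)%:E = (F b - F a)%:E)%E.
Proof.
move=> ab dF cf; apply: continuous_FTC2 => //.
- by apply: continuous_in_subspaceT => x; rewrite inE/= in_itv/=; exact: cf.
- split.
  + by move=> x; rewrite in_itv/= => /andP[h1 h2]; case: (dF x) => //; rewrite !ltW.
  + by apply: cvg_at_right_filter; apply: (der_continuous (dF a _)); rewrite lexx ltW.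
  + by apply: cvg_at_left_filter; apply: (der_continuous (dF b _)); rewrite lexx ltW.
- by move=> x; rewrite in_itv/= => /andP[h1 h2]; apply: (der_derive1 (dF x _)); rewrite !ltW.
Qed.

(** * The Gamma function and Laplace integrals at complex points *)

Section gamma.
Context {R : realType}.
Local Notation mu := (@lebesgue_measure R).
Local Notation Rp := (`]0, +oo[%classic : set R).

(** Half of the exponential absorbs the power, by comparison with one term of the
    exponential series. *)
Lemma expR_pow_bound (p c : R) : 0 <= p -> 0 < c ->
  exists2 K : R, 0 <= K & forall t, 0 < t -> t `^ p * expR (- (c * t)) <= K * expR (- (c / 2 * t)).
Proof.
move=> p0 c0; pose n := Num.bound p.
have pn : p <= n.+1%:R by rewrite (le_trans (ltW (archi_boundP p0)))// ler_nat.
pose K0 : R := (n.+1)`!%:R * (2 / c) ^+ n.+1.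
have K00 : 0 <= K0 by rewrite mulr_ge0// exprn_ge0// divr_ge0// ltW.
exists (1 + K0); first by rewrite addr_ge0.
move=> t t0.
have -> : expR (- (c * t)) = expR (- (c / 2 * t)) * expR (- (c / 2 * t)).
  by rewrite -expRD; congr expR; field.
rewrite mulrA ler_wpM2r ?expR_ge0//.
have -> : expR (- (c / 2 * t)) = (expR (c / 2 * t))^-1 by rewrite expRN.
rewrite ler_pdivrMr ?expR_gt0//.
have ct0 : 0 <= c / 2 * t by rewrite mulr_ge0 ?divr_ge0// ltW.
have e1 : 1 <= expR (c / 2 * t) by rewrite -[X in X <= _]expR0 ler_expR.
have := expR_ge1Dxn n ct0.
have [t1|t1] := leP t 1.
  move=> _; have tp1 : t `^ p <= 1.
    have [->|p1] := eqVneq p 0; first by rewrite powRr0.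
    have E1 : (1 : R) `^ p = 1 by rewrite powR1.
    rewrite -[leRHS]E1; apply: ge0_ler_powR; rewrite ?nnegrE//; exact: ltW.
  by rewrite (le_trans tp1)// mulrDl mul1r (le_trans e1)// lerDl mulr_ge0// expR_ge0.
move=> H; have tp : t `^ p <= t ^+ n.+1.
  by rewrite -powR_mulrn ?(ltW t0)//; apply: ler_powR => //; exact: ltW.
rewrite (le_trans tp)// mulrDl mul1r.
have {}H : t ^+ n.+1 <= K0 * expR (c / 2 * t).
  have -> : t ^+ n.+1 = K0 * ((c / 2 * t) ^+ n.+1 / (n.+1)`!%:R).
    have E : (2 / c) ^+ n.+1 * (c / 2 * t) ^+ n.+1 = t ^+ n.+1.
      by rewrite -exprMn; congr (_ ^+ _); field; rewrite gt_eqF.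
    have F0 : (n.+1)`!%:R != 0 :> R by rewrite pnatr_eq0 -lt0n fact_gt0.
    rewrite -[LHS]E /K0.
    by move: ((2 / c) ^+ n.+1) ((c / 2 * t) ^+ n.+1) ((n.+1)`!%:R : R) F0 => A X F F0; field.
  by rewrite ler_wpM2l// (le_trans _ H)// lerDr.
by rewrite (le_trans H)// lerDr expR_ge0.
Qed.

Lemma integrable_expR (c : R) : 0 < c ->
  mu.-integrable Rp (fun t => (expR (- (c * t)))%:E).
Proof.
move=> c0.
have cont x : {for x, continuous (fun t : R => expR (- (c * t)))}.
  by apply: (der_continuous (der_exp (der_opp (der_mul (der_cst c x) (der_id x))))).
have : mu.-integrable `[0, +oo[ (fun t => (expR (- (c * t)))%:E).
  apply/integrableP; split.
    by apply/measurable_EFinP; exact: continuous_meas.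
  under eq_integral do rewrite gee0_abs ?lee_fin ?expR_ge0//.
  rewrite (@ge0_continuous_FTC2y R _ (fun t => - c^-1 * expR (- (c * t))) 0 0).
  - by rewrite -EFinB ltry.
  - by move=> x _; exact: expR_ge0.
  - by apply: continuous_subspaceT => x; exact: cont.
  - rewrite -[X in _ --> X](mulr0 (- c^-1)); apply: cvgM; first exact: cvg_cst.
    apply: (cvg_comp (fun t => c * t) (fun t => expR (- t))); last exact: cvgr_expR.
    exact: gt0_cvgMry.
  - move=> x _.
    by have [] := der_mul (der_cst (- c^-1) x) (der_exp (der_opp (der_mul (der_cst c x) (der_id x)))).
  - apply: cvg_at_right_filter.
    by apply: (der_continuous (der_mul (der_cst (- c^-1) 0) (der_exp (der_opp (der_mul (der_cst c 0) (der_id 0)))))).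
  - move=> x _; apply: der_derive1.
    apply: (der_eq (der_mul (der_cst (- c^-1) x) (der_exp (der_opp (der_mul (der_cst c x) (der_id x)))))).
    by field; rewrite gt_eqF.
by apply: integrableS => // x; rewrite /= !in_itv/= !andbT => /ltW.
Qed.

Lemma measurable_pow D (p : R) : measurable_fun D (fun t : R => t `^ p).
Proof. exact: measurable_funS (measurable_powR p). Qed.

Lemma measurable_expRM D (c : R) : measurable_fun D (fun t : R => expR (- (c * t))).
Proof.
apply: continuous_meas => x.
by apply: (der_continuous (der_exp (der_opp (der_mul (der_cst c x) (der_id x))))).
Qed.

Lemma integrable_pow_expR (p c : R) : 0 <= p -> 0 < c ->
  mu.-integrable Rp (fun t => (t `^ p * expR (- (c * t)))%:E).
Proof.
move=> p0 c0; have [K K0 HK] := expR_pow_bound p0 c0.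
apply: (@le_integrable _ _ _ mu Rp _ _ (fun t => (K * expR (- (c / 2 * t)))%:E)) => //.
- apply/measurable_EFinP/measurable_funM; [exact: measurable_pow|exact: measurable_expRM].
- move=> t /=; rewrite in_itv/= andbT => t0.
  rewrite lee_fin !ger0_norm; [exact: HK| |]; rewrite mulr_ge0 ?expR_ge0 ?powR_ge0//.
- apply: intZ => //; by apply: integrable_expR; rewrite divr_gt0.
Qed.

(* The two components of t^b exp(-(x - J y) t). *)
Definition wave b x y t : R := t `^ b * expR (- (x * t)) * cos (t * y).
Definition wavs b x y t : R := t `^ b * expR (- (x * t)) * sin (t * y).

Lemma measurable_cosM D (y : R) : measurable_fun D (fun t : R => cos (t * y)).
Proof.
by apply: continuous_meas => x; apply: (der_continuous (der_cos (der_scale y x))).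
Qed.
Lemma measurable_sinM D (y : R) : measurable_fun D (fun t : R => sin (t * y)).
Proof.
by apply: continuous_meas => x; apply: (der_continuous (der_sin (der_scale y x))).
Qed.

Lemma integrable_osc (b x : R) (h : R -> R) : 0 <= b -> 0 < x ->
  measurable_fun Rp h -> (forall t, `|h t| <= 1) ->
  mu.-integrable Rp (fun t => (t `^ b * expR (- (x * t)) * h t)%:E).
Proof.
move=> b0 x0 mh h1.
apply: (@le_integrable _ _ _ mu Rp _ _ (fun t => (t `^ b * expR (- (x * t)))%:E)) => //.
- apply/measurable_EFinP/measurable_funM => //.
  by apply: measurable_funM; [exact: measurable_pow|exact: measurable_expRM].
- move=> t _; rewrite lee_fin normrM -[leRHS]mulr1 ler_wpM2l//.
- exact: integrable_pow_expR.
Qed.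

Lemma integrable_wave (b x y : R) : 0 <= b -> 0 < x -> mu.-integrable Rp (EFin \o wave b x y).
Proof.
move=> b0 x0; apply: integrable_osc => //; first exact: measurable_cosM.
by move=> t; rewrite ler_norml cos_geN1 cos_le1.
Qed.
Lemma integrable_wavs (b x y : R) : 0 <= b -> 0 < x -> mu.-integrable Rp (EFin \o wavs b x y).
Proof.
move=> b0 x0; apply: integrable_osc => //; first exact: measurable_sinM.
by move=> t; rewrite ler_norml sin_geN1 sin_le1.
Qed.

(** lapC and lapS are the components of the Laplace integral of t^b at the complex
    number x - J y, for any imaginary unit J. *)
Definition lapC b x y : R := \int[mu]_(t in Rp) wave b x y t.
Definition lapS b x y : R := \int[mu]_(t in Rp) wavs b x y t.

Lemma cvg_pow_exp_end (p c : R) (h : R -> R) : 0 <= p -> 0 < c -> (forall t, `|h t| <= 1) ->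
  (n.+2%:R `^ p * expR (- (c * n.+2%:R)) * h n.+2%:R) @[n --> \oo] --> (0 : R).
Proof.
move=> p0 c0 h1; have [K K0 HK] := expR_pow_bound p0 c0.
apply: (@cvg_dist0 R R^o _ (fun n => K * expR (- (c / 2 * n.+2%:R)))) => [n|].
  rewrite sub0r normrN normrM (@le_trans _ _ `|n.+2%:R `^ p * expR (- (c * n.+2%:R))|)//.
    by rewrite -[leRHS]mulr1 ler_wpM2l.
  rewrite ger0_norm; last by rewrite mulr_ge0 ?expR_ge0 ?powR_ge0.
  by apply: HK; rewrite ltr0n.
rewrite -[X in _ --> X](mulr0 K); apply: cvgM; first exact: cvg_cst.
apply: (cvg_comp (fun n : nat => c / 2 * n.+2%:R) (fun x => expR (- x))); last exact: cvgr_expR.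
have H : c / 2 * x @[x --> +oo] --> +oo by apply: gt0_cvgMry; rewrite ?divr_gt0//; exact: cvg_id.
apply: (cvg_comp (fun n : nat => n.+2%:R) (fun x => c / 2 * x) _ H).
apply/cvgryPge => A; near=> n; rewrite (@le_trans _ _ n%:R)//.
  by near: n; exact: nbhs_infty_ger.
by rewrite ler_nat -addn2 leq_addr.
Unshelve. all: by end_near. Qed.

Lemma cvg_pow_exp_start (p c : R) (h : R -> R) : 1 <= p -> 0 <= c -> (forall t, `|h t| <= 1) ->
  (n.+2%:R^-1 `^ p * expR (- (c * n.+2%:R^-1)) * h n.+2%:R^-1) @[n --> \oo] --> (0 : R).
Proof.
move=> p1 c0 h1; apply: (@cvg_dist0 R R^o _ (fun n => n.+1%:R^-1)) => [n|]; last first.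
  exact: cvg_harmonic.
rewrite sub0r normrN normrM (@le_trans _ _ `|n.+2%:R^-1 `^ p * expR (- (c * n.+2%:R^-1))|)//.
  by rewrite -[leRHS]mulr1 ler_wpM2l.
rewrite ger0_norm; last by rewrite mulr_ge0 ?expR_ge0 ?powR_ge0.
have e1 : expR (- (c * n.+2%:R^-1)) <= 1 by rewrite -[leRHS]expR0 ler_expR oppr_le0 mulr_ge0.
rewrite (@le_trans _ _ (n.+2%:R^-1 `^ p))//.
  by rewrite -[leRHS]mulr1 ler_wpM2l ?powR_ge0.
apply: (@le_trans _ _ n.+2%:R^-1); last by rewrite lef_pV2 ?posrE ?ltr0n// ler_nat.
rewrite -[leRHS]powRr1 ?invr_ge0//; apply: ger_powR => //.
by rewrite invr_gt0 ltr0n/= invf_le1 ?ltr0n// ler1n.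
Qed.

Lemma Rp_FTC (f F : R -> R) : (forall x : R, 0 < x -> is_derive x 1 F (f x)) ->
  (forall x : R, 0 < x -> {for x, continuous f}) ->
  mu.-integrable Rp (EFin \o f) ->
  F (n.+2%:R^-1) @[n --> \oo] --> (0 : R) -> F n.+2%:R @[n --> \oo] --> (0 : R) ->
  \int[mu]_(x in Rp) f x = 0.
Proof.
move=> dF cf fi F0 F1; rewrite -[RHS](subrr 0).
apply: (@FTC_open R (fun n => n.+2%:R^-1) (fun n => n.+2%:R) Rp f F) => //.
- by move=> n; rewrite (@lt_trans _ _ 1)// ?invf_lt1 ?ltr0n// ltr1n.
- move=> n x /=; rewrite !in_itv/= andbT => /andP[+ _]; apply: lt_le_trans.
  by rewrite invr_gt0 ltr0n.
- move=> x /=; rewrite in_itv/= andbT => x0; near=> n; rewrite in_itv/=; apply/andP; split.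
    rewrite invf_ple ?posrE ?ltr0n//.
    rewrite (@le_trans _ _ n%:R)//; first by near: n; exact: nbhs_infty_ger.
    by rewrite ler_nat -addn2 leq_addr.
  rewrite (@le_trans _ _ n%:R)//; first by near: n; exact: nbhs_infty_ger.
  by rewrite ler_nat -addn2 leq_addr.
- by move=> x /=; rewrite in_itv/= andbT => /dF.
- by move=> x /=; rewrite in_itv/= andbT => /cf.
Unshelve. all: by end_near. Qed.

Lemma der_wave (b x y t : R) : 0 < t -> is_derive t 1 (wave (b + 1) x y)
  ((b + 1) * wave b x y t - x * wave (b + 1) x y t - y * wavs (b + 1) x y t).
Proof.
move=> t0; rewrite /wave.
apply: (der_eq (der_mul (der_mul (der_pow (b+1) t0 (der_id t))
   (der_exp (der_opp (der_mul (der_cst x t) (der_id t))))) (der_cos (der_scale y t)))).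
by rewrite /wavs addrK; ring.
Qed.

Lemma der_wavs (b x y t : R) : 0 < t -> is_derive t 1 (wavs (b + 1) x y)
  ((b + 1) * wavs b x y t - x * wavs (b + 1) x y t + y * wave (b + 1) x y t).
Proof.
move=> t0; rewrite /wavs.
apply: (der_eq (der_mul (der_mul (der_pow (b+1) t0 (der_id t))
   (der_exp (der_opp (der_mul (der_cst x t) (der_id t))))) (der_sin (der_scale y t)))).
by rewrite /wave addrK; ring.
Qed.

Lemma wave_cont (b x y t : R) : 0 < t -> {for t, continuous (wave b x y)}.
Proof.
move=> t0; apply: (der_continuous (der_mul (der_mul (der_pow b t0 (der_id t))
   (der_exp (der_opp (der_mul (der_cst x t) (der_id t))))) (der_cos (der_scale y t)))).
Qed.
Lemma wavs_cont (b x y t : R) : 0 < t -> {for t, continuous (wavs b x y)}.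
Proof.
move=> t0; apply: (der_continuous (der_mul (der_mul (der_pow b t0 (der_id t))
   (der_exp (der_opp (der_mul (der_cst x t) (der_id t))))) (der_sin (der_scale y t)))).
Qed.

Lemma cos_norm1 (u : R) : `|cos u| <= 1.
Proof. by rewrite ler_norml cos_geN1 cos_le1. Qed.
Lemma sin_norm1 (u : R) : `|sin u| <= 1.
Proof. by rewrite ler_norml sin_geN1 sin_le1. Qed.

(** Integration by parts in the Laplace integral; lap_parts_C and lap_parts_S are
    the two components of (b+1) F_b(z) = z F_(b+1)(z) at z = x - J y. For y = 0 and
    x = 1 this is the functional equation of Gamma. *)
Lemma lap_parts_C (b x y : R) : 0 <= b -> 0 < x ->
  (b + 1) * lapC b x y = x * lapC (b + 1) x y + y * lapS (b + 1) x y.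
Proof.
move=> b0 x0; have b1 : 0 <= b + 1 by rewrite addr_ge0.
pose f t := (b + 1) * wave b x y t - x * wave (b + 1) x y t - y * wavs (b + 1) x y t.
have i0 := integrable_wave y b0 x0; have i1 := integrable_wave y b1 x0.
have i2 := integrable_wavs y b1 x0.
have j0 : mu.-integrable Rp (EFin \o (fun t => (b + 1) * wave b x y t)).
  exact: intZ.
have j1 : mu.-integrable Rp (EFin \o (fun t => x * wave (b + 1) x y t)).
  exact: intZ.
have j2 : mu.-integrable Rp (EFin \o (fun t => y * wavs (b + 1) x y t)).
  exact: intZ.
have j01 : mu.-integrable Rp (EFin \o (fun t => (b + 1) * wave b x y t - x * wave (b + 1) x y t)).
  exact: intB.
have /eqP : \int[mu]_(t in Rp) f t = 0.
  apply: (@Rp_FTC f (wave (b + 1) x y)).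
  - by move=> t; exact: der_wave.
  - move=> t t0; rewrite /f.
    apply: cvgB; first apply: cvgB; apply: cvgM; try exact: cvg_cst; try exact: wave_cont.
    exact: wavs_cont.
  - exact: intB.
  - apply: (@cvg_pow_exp_start _ _ (fun t => cos (t * y))); rewrite ?lerDr// ?(ltW x0)//.
    by move=> t; exact: cos_norm1.
  - apply: (@cvg_pow_exp_end _ _ (fun t => cos (t * y))) => //.
    by move=> t; exact: cos_norm1.
rewrite /f RintegralB// RintegralB// !RintegralZl// -/(lapC _ _ _) -/(lapC _ _ _) -/(lapS _ _ _).
by rewrite -addrA -opprD subr_eq0 => /eqP.
Qed.

Lemma lap_parts_S (b x y : R) : 0 <= b -> 0 < x ->
  (b + 1) * lapS b x y = x * lapS (b + 1) x y - y * lapC (b + 1) x y.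
Proof.
move=> b0 x0; have b1 : 0 <= b + 1 by rewrite addr_ge0.
pose f t := (b + 1) * wavs b x y t - x * wavs (b + 1) x y t + y * wave (b + 1) x y t.
have i0 := integrable_wavs y b0 x0; have i1 := integrable_wavs y b1 x0.
have i2 := integrable_wave y b1 x0.
have j0 : mu.-integrable Rp (EFin \o (fun t => (b + 1) * wavs b x y t)).
  exact: intZ.
have j1 : mu.-integrable Rp (EFin \o (fun t => x * wavs (b + 1) x y t)).
  exact: intZ.
have j2 : mu.-integrable Rp (EFin \o (fun t => y * wave (b + 1) x y t)).
  exact: intZ.
have j01 : mu.-integrable Rp (EFin \o (fun t => (b + 1) * wavs b x y t - x * wavs (b + 1) x y t)).
  exact: intB.
have /eqP : \int[mu]_(t in Rp) f t = 0.
  apply: (@Rp_FTC f (wavs (b + 1) x y)).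
  - by move=> t; exact: der_wavs.
  - move=> t t0; rewrite /f.
    apply: cvgD; first apply: cvgB; apply: cvgM; try exact: cvg_cst; try exact: wavs_cont.
    exact: wave_cont.
  - exact: intD.
  - apply: (@cvg_pow_exp_start _ _ (fun t => sin (t * y))); rewrite ?lerDr// ?(ltW x0)//.
    by move=> t; exact: sin_norm1.
  - apply: (@cvg_pow_exp_end _ _ (fun t => sin (t * y))) => //.
    by move=> t; exact: sin_norm1.
rewrite /f RintegralD// RintegralB// !RintegralZl// -/(lapC _ _ _) -/(lapS _ _ _) -/(lapS _ _ _).
by rewrite -addrA [X in _ + X == _]addrC -opprB subr_eq0 => /eqP.
Qed.

Lemma lapS0 (b x : R) : lapS b x 0 = 0.
Proof.
rewrite /lapS /Rintegral; under eq_integral do rewrite /wavs mulr0 sin0 mulr0.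
by rewrite integral0.
Qed.

Lemma Gamma_lapC (b : R) : Gamma (b + 1) = lapC b 1 0.
Proof.
rewrite /Gamma /lapC addrK; apply: eq_Rintegral => t _.
by rewrite /wave mulr0 cos0 mulr1 mul1r.
Qed.

Lemma GammaS (b : R) : 0 <= b -> Gamma (b + 1 + 1) = (b + 1) * Gamma (b + 1).
Proof.
by move=> b0; rewrite !Gamma_lapC lap_parts_C ?ltr01// mul0r addr0 mul1r.
Qed.

Lemma Gamma1 : Gamma 1 = 1 :> R.
Proof.
rewrite -[X in Gamma X]add0r /Gamma addrK.
have -> : \int[mu]_(t in Rp) (t `^ 0 * expR (- t)) = \int[mu]_(t in `[0, +oo[) expR (- t).
  rewrite -Rintegral_itv_obnd_cbnd//.
    by apply: eq_Rintegral => t _; rewrite powRr0 mul1r.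
  by apply: eq_integrable (integrable_expR ltr01) => // t _ /=; rewrite mul1r.
rewrite (@Rintegral_ge0_continuous_FTC2y R _ (fun t => - expR (- t)) 0 0).
- by rewrite oppr0 expR0 sub0r opprK.
- by move=> x _; exact: expR_ge0.
- by apply: continuous_subspaceT => x; apply: (der_continuous (der_exp (der_opp (der_id x)))).
- by rewrite -[X in _ --> X]oppr0; apply: cvgN; exact: cvgr_expR.
- by move=> x _; have [] := der_opp (der_exp (der_opp (der_id x))).
- apply: cvg_at_right_filter.
  by apply: (der_continuous (der_opp (der_exp (der_opp (der_id 0))))).
- move=> x _; apply: der_derive1; apply: (der_eq (der_opp (der_exp (der_opp (der_id x))))).
  by rewrite mulrN1 opprK.
Qed.

Lemma der_lapC (b x y : R) : 0 <= b -> 0 < x ->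
  is_derive y 1 (lapC b x) (- lapS (b + 1) x y).
Proof.
move=> b0 x0; have b1 : 0 <= b + 1 by rewrite addr_ge0.
have dw (z t : R) : 0 < t -> is_derive z 1 ((fun s => wave b x s t)) (- wavs (b + 1) x z t).
  move=> t0; rewrite /wave.
  apply: (der_eq (der_mul (der_cst _ z) (der_cos (der_mul (der_cst t z) (der_id z))))).
  rewrite /wavs powRD; last by apply/implyP => _; rewrite gt_eqF.
  by rewrite powRr1 ?(ltW t0)//; ring.
have yI : y - 1 < y < y + 1 by rewrite ltrBlDr ltrDl ltr01.
have -> : - lapS (b + 1) x y = \int[mu]_(t in Rp) (- wavs (b + 1) x y t).
  rewrite /lapS -mulN1r -RintegralZl//; last exact: integrable_wavs.
  by apply: eq_Rintegral => t _; rewrite mulN1r.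
apply: (@der_integral _ _ R mu Rp _ (wave b x) (fun z t => - wavs (b + 1) x z t)
  (fun t => t `^ (b + 1) * expR (- (x * t))) y _ _ yI) => //.
- by move=> z _; exact: integrable_wave.
- by move=> z t _ /=; rewrite in_itv/= andbT => t0; exact: dw.
- move=> z t _ _; rewrite ?normrN /wavs normrM ger0_norm ?mulr_ge0 ?powR_ge0 ?expR_ge0//.
  by rewrite -[leRHS]mulr1 ler_wpM2l ?mulr_ge0 ?powR_ge0 ?expR_ge0// ?sin_norm1 ?cos_norm1.
- exact: integrable_pow_expR.
Qed.

Lemma der_lapS (b x y : R) : 0 <= b -> 0 < x ->
  is_derive y 1 (lapS b x) (lapC (b + 1) x y).
Proof.
move=> b0 x0; have b1 : 0 <= b + 1 by rewrite addr_ge0.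
have dw (z t : R) : 0 < t -> is_derive z 1 ((fun s => wavs b x s t)) (wave (b + 1) x z t).
  move=> t0; rewrite /wavs.
  apply: (der_eq (der_mul (der_cst _ z) (der_sin (der_mul (der_cst t z) (der_id z))))).
  rewrite /wave powRD; last by apply/implyP => _; rewrite gt_eqF.
  by rewrite powRr1 ?(ltW t0)//; ring.
have yI : y - 1 < y < y + 1 by rewrite ltrBlDr ltrDl ltr01.
have -> : lapC (b + 1) x y = \int[mu]_(t in Rp) (wave (b + 1) x y t).
  by [].
apply: (@der_integral _ _ R mu Rp _ (wavs b x) (fun z t => wave (b + 1) x z t)
  (fun t => t `^ (b + 1) * expR (- (x * t))) y _ _ yI) => //.
- by move=> z _; exact: integrable_wavs.
- by move=> z t _ /=; rewrite in_itv/= andbT => t0; exact: dw.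
- move=> z t _ _; rewrite ?normrN /wave normrM ger0_norm ?mulr_ge0 ?powR_ge0 ?expR_ge0//.
  by rewrite -[leRHS]mulr1 ler_wpM2l ?mulr_ge0 ?powR_ge0 ?expR_ge0// ?sin_norm1 ?cos_norm1.
- exact: integrable_pow_expR.
Qed.

(** The modulus of (x - J y)^(b+1). *)
Definition radius_pow b x y : R := (x ^+ 2 + y ^+ 2) `^ ((b + 1) / 2).

(** The complex function z^(b+1) F_b(z) is constant on a vertical line: its
    derivative in y vanishes by der_lapC, der_lapS and the integration by parts.
    This replaces a rotation of the contour of integration. Here rho and -th are the
    modulus and the argument of z^(b+1), z = x - J y. *)
Lemma lap_contour (b x y : R) : 0 <= b -> 0 < x ->
  let rho := radius_pow b x y in let th := (b + 1) * atan (y / x) in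
  rho * (cos th * lapC b x y + sin th * lapS b x y) = x `^ (b + 1) * lapC b x 0 /\
  rho * (cos th * lapS b x y - sin th * lapC b x y) = 0.
Proof.
move=> b0 x0 /=.
have x2 (z : R) : 0 < x ^+ 2 + z ^+ 2 by rewrite ltr_wpDr ?sqr_ge0// exprn_gt0.
have xN0 : x != 0 by rewrite gt_eqF.
have dsq (z : R) : is_derive z 1 (fun s : R => x ^+ 2 + s ^+ 2) (2 * z).
  have := der_add (der_cst (x ^+ 2) z) (der_mul (der_id z) (der_id z)).
  rewrite /=; under eq_fun do rewrite -expr2; move=> H; apply: (der_eq H); ring.
have drho (z : R) : is_derive z 1 (radius_pow b x)
    ((b + 1) * z / (x ^+ 2 + z ^+ 2) * radius_pow b x z).
  rewrite /radius_pow; apply: (der_eq (@der_pow _ ((b + 1) / 2) (fun s => x ^+ 2 + s ^+ 2) z _ (x2 z) (dsq z))).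
  rewrite powRB; last by apply/implyP => _; rewrite gt_eqF.
  rewrite powRr1 ?(ltW (x2 z))//; field; rewrite gt_eqF//.
have dth (z : R) : is_derive z 1 (fun s : R => (b + 1) * atan (s / x))
    ((b + 1) * x / (x ^+ 2 + z ^+ 2)).
  apply: (der_eq (der_mul (der_cst (b + 1) z) (der_atan (der_scale x^-1 z)))).
  rewrite mul0r add0r -!mulrA; congr (_ * _).
  have -> : 1 + (z / x) ^+ 2 = (x ^+ 2 + z ^+ 2) / x ^+ 2 by field.
  by field; rewrite xN0 gt_eqF.
have dC (z : R) := der_lapC z b0 x0; have dS (z : R) := der_lapS z b0 x0.
have EC (z : R) : lapC (b + 1) x z = (b + 1) * (x * lapC b x z - z * lapS b x z) / (x ^+ 2 + z ^+ 2).
  have p1 := lap_parts_C z b0 x0; have p2 := lap_parts_S z b0 x0.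
  have -> : (b + 1) * (x * lapC b x z - z * lapS b x z) =
     x * ((b + 1) * lapC b x z) - z * ((b + 1) * lapS b x z) by ring.
  by rewrite p1 p2; field; rewrite gt_eqF.
have ES (z : R) : lapS (b + 1) x z = (b + 1) * (x * lapS b x z + z * lapC b x z) / (x ^+ 2 + z ^+ 2).
  have p1 := lap_parts_C z b0 x0; have p2 := lap_parts_S z b0 x0.
  have -> : (b + 1) * (x * lapS b x z + z * lapC b x z) =
     x * ((b + 1) * lapS b x z) + z * ((b + 1) * lapC b x z) by ring.
  by rewrite p1 p2; field; rewrite gt_eqF.
have r0 : radius_pow b x 0 = x `^ (b + 1).
  rewrite /radius_pow expr0n/= addr0 -powR_mulrn ?(ltW x0)// -powRrM.
  by congr powR; field.
pose A z := radius_pow b x z * (cos ((b + 1) * atan (z / x)) * lapC b x z +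
                                sin ((b + 1) * atan (z / x)) * lapS b x z).
pose B z := radius_pow b x z * (cos ((b + 1) * atan (z / x)) * lapS b x z -
                                sin ((b + 1) * atan (z / x)) * lapC b x z).
have -> : x `^ (b + 1) * lapC b x 0 = A 0.
  by rewrite /A r0 mul0r atan0 mulr0 cos0 sin0 mul1r mul0r addr0.
have {2}-> : 0 = B 0.
  by rewrite /B r0 mul0r atan0 mulr0 cos0 sin0 mul1r mul0r subr0 lapS0 mulr0.
split.
- apply: (@is_derive_0_is_cst R A) => z.
  apply: (der_eq (der_mul (drho z) (der_add (der_mul (der_cos (dth z)) (dC z))
     (der_mul (der_sin (dth z)) (dS z))))).
  by rewrite EC ES; field; rewrite gt_eqF.
- apply: (@is_derive_0_is_cst R B) => z.
  apply: (der_eq (der_mul (drho z) (der_sub (der_mul (der_cos (dth z)) (dS z))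
     (der_mul (der_sin (dth z)) (dC z))))).
  by rewrite EC ES; field; rewrite gt_eqF.
Qed.

(** The change of variables t -> x t, obtained without substitution in the integral:
    in the variable v with x = exp v, the left-hand side has derivative 0 by
    lap_parts_C. *)
Lemma lapC_scale (b x : R) : 0 <= b -> 0 < x -> x `^ (b + 1) * lapC b x 0 = Gamma (b + 1).
Proof.
move=> b0 x0; have b1 : 0 <= b + 1 by rewrite addr_ge0.
have dlap (v : R) : is_derive v 1 (fun s => lapC b (expR s) 0) (- expR v * lapC (b + 1) (expR v) 0).
  have vI : v - 1 < v < v + 1 by rewrite ltrBlDr ltrDl ltr01.
  have -> : - expR v * lapC (b + 1) (expR v) 0 =
      \int[mu]_(t in Rp) (- expR v * wave (b + 1) (expR v) 0 t).
    by rewrite RintegralZl//; apply: integrable_wave; rewrite ?expR_gt0.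
  apply: (@der_integral _ _ R mu Rp _ (fun s => wave b (expR s) 0)
     (fun z t => - expR z * wave (b + 1) (expR z) 0 t)
     (fun t => expR (v + 1) * (t `^ (b + 1) * expR (- (expR (v - 1) * t)))) v _ _ vI) => //.
  - by move=> z _; apply: integrable_wave; rewrite ?expR_gt0.
  - move=> z t _ /=; rewrite in_itv/= andbT => t0; rewrite /wave.
    apply: (der_eq (der_mul (der_mul (der_cst (t `^ b) z)
       (der_exp (der_opp (der_mul (der_exp (der_id z)) (der_cst t z))))) (der_cst (cos (t * 0)) z))).
    rewrite powRD; last by apply/implyP => _; rewrite gt_eqF.
    by rewrite powRr1 ?(ltW t0)//; ring.
  - move=> z t /andP[vz zv] /=; rewrite in_itv/= andbT => t0.
    have P : 0 <= t `^ (b + 1) * expR (- (expR z * t)).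
      by rewrite mulr_ge0 ?powR_ge0 ?expR_ge0.
    rewrite /wave mulr0 cos0 mulr1 normrM normrN (ger0_norm (expR_ge0 z)) (ger0_norm P).
    apply: ler_pM; rewrite ?expR_ge0 ?ler_expR ?(ltW zv)//.
    rewrite ler_wpM2l ?powR_ge0// ler_expR lerN2 ler_wpM2r ?(ltW t0)//.
    by rewrite ler_expR ltW.
  - by apply: intZ => //; apply: integrable_pow_expR; rewrite ?expR_gt0.
pose H v := expR (v * (b + 1)) * lapC b (expR v) 0.
have -> : Gamma (b + 1) = H 0 by rewrite /H mul0r expR0 mul1r Gamma_lapC.
have -> : x `^ (b + 1) * lapC b x 0 = H (ln x).
  by rewrite /H lnK ?posrE// /powR gt_eqF// (mulrC (b + 1)).
apply: (@is_derive_0_is_cst R H) => v.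
apply: (der_eq (der_mul (der_exp (der_scale (b + 1) v)) (dlap v))).
have := lap_parts_C 0 b0 (expR_gt0 v); rewrite mul0r addr0 => E.
have -> : expR (v * (b + 1)) * (b + 1) * lapC b (expR v) 0 =
  expR (v * (b + 1)) * ((b + 1) * lapC b (expR v) 0) by ring.
by rewrite E; ring.
Qed.

(** The Laplace transform of t^b is Gamma(b+1) z^(-b-1), here at z = e^(-J th)/m, in
    the right half plane. *)
Lemma lap_polar (b m th : R) : 0 <= b -> 0 < m -> `|th| < pi / 2 ->
  lapC b (cos th / m) (sin th / m) = Gamma (b + 1) * m `^ (b + 1) * cos ((b + 1) * th) /\
  lapS b (cos th / m) (sin th / m) = Gamma (b + 1) * m `^ (b + 1) * sin ((b + 1) * th).
Proof.
move=> b0 m0; rewrite ltr_norml => thb.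
have c0 : 0 < cos th by rewrite cos_gt0_pihalf.
have x0 : 0 < cos th / m by rewrite divr_gt0.
have mN : m != 0 by rewrite gt_eqF.
have := lap_contour (sin th / m) b0 x0; rewrite /= lapC_scale//.
have -> : sin th / m / (cos th / m) = tan th by rewrite /tan; field; rewrite mN gt_eqF.
rewrite tanK ?in_itv//=; set C := lapC _ _ _; set S := lapS _ _ _.
have -> : radius_pow b (cos th / m) (sin th / m) = (m `^ (b + 1))^-1.
  rewrite /radius_pow.
  have -> : (cos th / m) ^+ 2 + (sin th / m) ^+ 2 = m^-1 ^+ 2.
    by rewrite !exprMn -mulrDl cos2Dsin2 mul1r.
  rewrite -powR_mulrn ?invr_ge0 ?(ltW m0)// -powRrM.
  have -> : 2 * ((b + 1) / 2) = b + 1 by field.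
  rewrite -powR_inv1 ?(ltW m0)// -powRrM mulN1r powRN//.
have p0 : m `^ (b + 1) != 0 by rewrite gt_eqF// powR_gt0.
set p := m `^ (b + 1) in p0 *; set phi := (b + 1) * th; move=> [e1 e2].
have cs := cos2Dsin2 phi.
have {}e1 : cos phi * C + sin phi * S = Gamma (b + 1) * p by rewrite -e1; field.
have {}e2 : cos phi * S - sin phi * C = 0.
  by apply: (mulfI (invr_neq0 p0)); rewrite e2 mulr0.
split.
- have -> : C = cos phi * (cos phi * C + sin phi * S) - sin phi * (cos phi * S - sin phi * C).
    by rewrite -[LHS]mul1r -cs; ring.
  by rewrite e1 e2; ring.
- have -> : S = sin phi * (cos phi * C + sin phi * S) + cos phi * (cos phi * S - sin phi * C).
    by rewrite -[LHS]mul1r -cs; ring.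
  by rewrite e1 e2; ring.
Qed.

(** The integrand is at least exp(-2) on the interval from 1 to 2. *)
Lemma Gamma_gt0 (b : R) : 0 <= b -> 0 < Gamma (b + 1).
Proof.
move=> b0; rewrite Gamma_lapC lt_neqAle; apply/andP; split; last first.
  apply: Rintegral_ge0 => t _; rewrite /wave mulr0 cos0 mulr1.
  by rewrite mulr_ge0 ?powR_ge0 ?expR_ge0.
apply/negP => /eqP E.
pose B := (`]1, 2[%classic : set R).
have iB : mu.-integrable Rp (EFin \o wave b 1 0) by exact: integrable_wave.
have : expR (- 2) <= \int[mu]_(t in Rp) wave b 1 0 t.
  have mB : measurable B by exact: measurable_itv.
  have BR : B `<=` Rp.
    by move=> t /=; rewrite !in_itv/= andbT => /andP[+ _]; apply: lt_trans.
  rewrite /Rintegral -lee_fin fineK; last exact: integrable_fin_num.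
  apply: (@le_trans _ _ (\int[mu]_(t in B) (cst (expR (- 2))%:E) t)%E).
    rewrite integral_cst//= /B lebesgue_measure_itv/= lte_fin ltr1n -EFinB.
    by rewrite -EFinM lee_fin (_ : 2 - 1 = 1) ?mulr1//; ring.
  apply: (@le_trans _ _ (\int[mu]_(t in B) (wave b 1 0 t)%:E)%E).
    apply: ge0_le_integral => //.
    - by move=> t _; rewrite lee_fin expR_ge0.
    - by apply: measurable_funS (measurable_int mu iB).
    - move=> t; rewrite /B /= in_itv/= => /andP[t1 t2]; rewrite lee_fin /wave mulr0 cos0 mulr1 mul1r.
      rewrite -[leLHS]mul1r; apply: ler_pM; rewrite ?expR_ge0//; last by rewrite ler_expR lerN2 ltW.
      by have := ler_powR (ltW t1) b0; rewrite powRr0.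
  apply: ge0_subset_integral => //; first exact: measurable_int iB.
  move=> t _; rewrite lee_fin /wave mulr0 cos0 mulr1.
  by rewrite mulr_ge0 ?powR_ge0 ?expR_ge0.
by rewrite -/(lapC b 1 0) -E leNgt expR_gt0.
Qed.

End gamma.

(** * Orthonormality of the Laguerre functions *)

Section laguerre_system.
Context {R : realType} (alpha : R) (alpha0 : 0 < alpha).
Local Notation mu := (@lebesgue_measure R).
Local Notation Rp := (`]0, +oo[%classic : set R).
Local Notation R0 := (`[0, +oo[%classic : set R).
Local Notation w := (gamma_weight alpha).
Local Notation G := (@Gamma R).
#[local] Opaque Gamma.

Lemma Gamma_nat (n : nat) : G (n%:R + 1) = n`!%:R.
Proof.
elim: n => [|n ih]; first by rewrite add0r Gamma1.
by rewrite -natr1 GammaS// ih natr1 -natrM factS.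
Qed.

Lemma Gamma_alpha_gt0 (n : nat) : 0 < G (alpha + n%:R + 1).
Proof. by apply: Gamma_gt0; rewrite addr_ge0// ltW. Qed.
Lemma Gamma_alpha1_gt0 : 0 < G (alpha + 1).
Proof. by apply: Gamma_gt0; rewrite ltW. Qed.

Lemma integrable_R0 (f : R -> R) : measurable_fun (setT : set (measurableTypeR R)) f ->
  mu.-integrable Rp (EFin \o f) -> mu.-integrable R0 (EFin \o f).
Proof.
move=> mf /integrableP[_ fi]; apply/integrableP; split.
  by apply/measurable_EFinP; exact: measurable_funS mf.
rewrite -integral_itv_obnd_cbnd//.
apply: measurable_funS (measurableT) _ _ => //.
by apply: measurableT_comp => //; exact/measurable_EFinP.
Qed.

Lemma Rintegral_R0 (f : R -> R) : mu.-integrable Rp (EFin \o f) ->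
  \int[mu]_(t in R0) f t = \int[mu]_(t in Rp) f t.
Proof. by move=> fi; rewrite -Rintegral_itv_obnd_cbnd. Qed.

Lemma measurable_gamma_weight D : measurable_fun (D : set (measurableTypeR R)) w.
Proof.
apply: measurable_funM; last exact: measurable_cst.
apply: measurable_funM; first exact: measurable_pow.
apply: continuous_meas => x.
by apply: (der_continuous (der_exp (der_opp (der_id x)))).
Qed.

Lemma gamma_weight_ge0 t : R0 t -> 0 <= w t.
Proof.
by move=> _; rewrite divr_ge0 ?mulr_ge0 ?powR_ge0 ?expR_ge0// ltW ?Gamma_alpha1_gt0.
Qed.

Lemma mR0 : measurable (R0 : set (measurableTypeR R)). Proof. exact: measurable_itv. Qed.
Lemma mw : measurable_fun (R0 : set (measurableTypeR R)) w. Proof. exact: measurable_gamma_weight. Qed.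
Lemma mRp : measurable (Rp : set (measurableTypeR R)). Proof. exact: measurable_itv. Qed.
Local Notation xsqi_sum := (@sqi_sum _ _ _ mu R0 mR0 w (@mw) gamma_weight_ge0).
Local Notation xip_suml := (@ip_suml _ _ _ mu R0 mR0 w (@mw) gamma_weight_ge0).
Local Notation xipZl := (@ipZl _ _ _ mu R0 mR0 w (@mw) gamma_weight_ge0).

(** One formula covers moments, kernels and squares of kernels: the factor exp(c t)
    merges with the weight exp(-t), and the bounded factor h carries the
    oscillation. Integrals over the closed half line are moved to the open one,
    where t^alpha t^k = t^(alpha+k) holds for real exponents. *)
Lemma exp_growth_integrable (k : nat) (c : R) (h : R -> R) : c < 1 ->
  measurable_fun (setT : set (measurableTypeR R)) h -> (forall t, `|h t| <= 1) ->
  mu.-integrable R0 (EFin \o (fun t => t ^+ k * expR (c * t) * h t * w t)) /\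
  \int[mu]_(t in R0) (t ^+ k * expR (c * t) * h t * w t) =
  (G (alpha + 1))^-1 * \int[mu]_(t in Rp) (t `^ (alpha + k%:R) * expR (- ((1 - c) * t)) * h t).
Proof.
move=> c1 mh h1; have c10 : 0 < 1 - c by rewrite subr_gt0.
have ak : 0 <= alpha + k%:R by rewrite addr_ge0// ltW.
have iP : mu.-integrable Rp (EFin \o (fun t : R => t `^ (alpha + k%:R) * expR (- ((1 - c) * t)) * h t)).
  by apply: integrable_osc => //; exact: measurable_funS mh.
have E (t : R) : Rp t -> t ^+ k * expR (c * t) * h t * w t =
   (G (alpha + 1))^-1 * (t `^ (alpha + k%:R) * expR (- ((1 - c) * t)) * h t).
  rewrite /= in_itv/= andbT => t0; rewrite /gamma_weight powRD; last first.
    by apply/implyP => _; rewrite gt_eqF.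
  rewrite powR_mulrn ?(ltW t0)//.
  have -> : - ((1 - c) * t) = c * t - t by ring.
  by rewrite expRD; ring.
have iE : mu.-integrable Rp (EFin \o (fun t => t ^+ k * expR (c * t) * h t * w t)).
  have := intZ mRp (G (alpha + 1))^-1 iP; apply: eq_integrable => //.
  by move=> t /[!inE] t0; rewrite /= E.
split.
  apply: integrable_R0 => //; apply: measurable_funM; last exact: measurable_gamma_weight.
  apply: measurable_funM => //; apply: measurable_funM; first exact: measurable_funX.
  apply: continuous_meas => x.
  by apply: (der_continuous (der_exp (der_mul (der_cst c x) (der_id x)))).
rewrite Rintegral_R0// -RintegralZl//.
by apply: eq_Rintegral => t /[!inE] t0; rewrite E.
Qed.

Lemma sqi_exp_growth (k : nat) (c : R) (h : R -> R) : c < 1 / 2 ->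
  measurable_fun (setT : set (measurableTypeR R)) h -> (forall t, `|h t| <= 1) ->
  sqi mu R0 w (fun t => t ^+ k * expR (c * t) * h t).
Proof.
move=> c1 mh h1; split.
  apply: measurable_funS (measurableT) _ _ => //; apply: measurable_funM => //.
  apply: measurable_funM; first exact: measurable_funX.
  apply: continuous_meas => x.
  by apply: (der_continuous (der_exp (der_mul (der_cst c x) (der_id x)))).
have c2 : 2 * c < 1 by rewrite mulrC -ltr_pdivlMr.
have mh2 : measurable_fun (setT : set (measurableTypeR R)) (fun t => h t ^+ 2).
  exact: measurable_funX.
have h2 t : `|h t ^+ 2| <= 1 by rewrite normrX exprn_ile1.
have [] := @exp_growth_integrable (k * 2) (2 * c) _ c2 mh2 h2.
move=> + _; congr integrable; apply/funext => t /=; congr EFin.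
by rewrite !exprMn -exprM -expRM_natl mulrA.
Qed.

Lemma exp_growth0 (k : nat) : (fun t : R => t ^+ k * expR (0 * t) * 1) = (fun t => t ^+ k).
Proof. by apply/funext => t; rewrite mul0r expR0 !mulr1. Qed.

Lemma sqi_monomial (k : nat) : sqi mu R0 w (fun t => t ^+ k).
Proof.
rewrite -exp_growth0; apply: (@sqi_exp_growth k 0 (fun=> 1)) => //.
by move=> t; rewrite normr1.
Qed.

Lemma moment (k : nat) : \int[mu]_(t in R0) (t ^+ k * w t) = G (alpha + k%:R + 1) / G (alpha + 1).
Proof.
have [|_] := @exp_growth_integrable k 0 (fun=> 1) ltr01 (measurable_cst _).
  by move=> t; rewrite normr1.
under eq_Rintegral do rewrite mul0r expR0 !mulr1.
move=> ->; rewrite mulrC; congr (_ / _); rewrite Gamma_lapC /lapC.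
by apply: eq_Rintegral => t _; rewrite /wave subr0 mulr0 cos0.
Qed.

Lemma integrable_gamma_weight : mu.-integrable R0 (EFin \o w).
Proof.
have [|+ _] := @exp_growth_integrable 0 0 (fun=> 1) ltr01 (measurable_cst _).
  by move=> t; rewrite normr1.
by congr integrable; apply/funext => t /=; rewrite expr0 mul0r expR0 !mul1r.
Qed.

Definition lag_coef (n k : nat) : R :=
  G (alpha + n%:R + 1) / (G (n%:R - k%:R + 1) * G (alpha + k%:R + 1)) * ((- 1) ^+ k / (k`!)%:R).

Lemma laguerreE n t : laguerre alpha n t = \sum_(k < n.+1) lag_coef n k * t ^+ k.
Proof.
apply: eq_bigr => k _; rewrite /lag_coef -[- t]mulN1r exprMn -[RHS]mulrA.
by congr (_ * _); rewrite mulrAC.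
Qed.

Lemma sqi_laguerre n : sqi mu R0 w (laguerre alpha n).
Proof.
have -> : laguerre alpha n = (fun t => \sum_(k < n.+1) lag_coef n k * t ^+ k).
  by apply/funext => t; rewrite laguerreE.
apply: (xsqi_sum n.+1 (F := fun k t => lag_coef n k * t ^+ k)) => k.
by apply: (sqiZ mR0); exact: sqi_monomial.
Qed.

Lemma ip_laguerre_l n h : sqi mu R0 w h ->
  ip mu R0 w (laguerre alpha n) h =
  \sum_(k < n.+1) lag_coef n k * ip mu R0 w (fun t => t ^+ k) h.
Proof.
move=> sh; have -> : laguerre alpha n = (fun t => \sum_(k < n.+1) lag_coef n k * t ^+ k).
  by apply/funext => t; rewrite laguerreE.
have sm k : sqi mu R0 w (fun t : R => lag_coef n k * t ^+ k).
  by apply: (sqiZ mR0); exact: sqi_monomial.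
rewrite (xip_suml n.+1 (F := fun k t => lag_coef n k * t ^+ k))//.
apply: eq_bigr => k _; by rewrite (xipZl)//; exact: sqi_monomial.
Qed.

(** The squared norm of the n-th Laguerre polynomial; it is also the coefficient of
    u^n in the binomial series of (1 - u)^(-alpha-1), and the square of the factor
    in front of (q/r)^n in the basis of the Bergman space. *)
Definition lnorm2 (n : nat) : R := G (alpha + n%:R + 1) / (n`!%:R * G (alpha + 1)).

Lemma lnorm2_gt0 n : 0 < lnorm2 n.
Proof.
by rewrite divr_gt0 ?Gamma_alpha_gt0// mulr_gt0 ?Gamma_alpha1_gt0// ltr0n fact_gt0.
Qed.

(** The Gamma factor of the k-th moment cancels the one in the k-th coefficient,
    leaving an alternating binomial sum. All inner products with Laguerre
    polynomials are computed through this identity. *)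
Lemma lag_coef_moment n k (M : R) : (k <= n)%N ->
  lag_coef n k * (G (alpha + k%:R + 1) / G (alpha + 1) * M) =
  lnorm2 n * ((-1) ^+ k * 'C(n, k)%:R * M).
Proof.
move=> kn; rewrite /lag_coef /lnorm2 -natrB// Gamma_nat.
have := bin_fact kn => /(congr1 (fun x => x%:R : R)); rewrite !natrM => <-.
have ga := Gamma_alpha_gt0 k; have g1 := Gamma_alpha1_gt0.
have f1 : k`!%:R != 0 :> R by rewrite pnatr_eq0 -lt0n fact_gt0.
have f2 : (n - k)`!%:R != 0 :> R by rewrite pnatr_eq0 -lt0n fact_gt0.
have f3 : 'C(n, k)%:R != 0 :> R by rewrite pnatr_eq0 -lt0n bin_gt0.
have {}ga : G (alpha + k%:R + 1) != 0 by rewrite gt_eqF.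
have {}g1 : G (alpha + 1) != 0 by rewrite gt_eqF.
move: (G (alpha + k%:R + 1)) (G (alpha + 1)) (G (alpha + n%:R + 1)) (k`!%:R : R)
  ((n - k)`!%:R : R) ('C(n, k)%:R : R) ga g1 f1 f2 f3 => x1 x2 x3 x4 x5 x6 *.
by field; apply/and5P.
Qed.

Definition rising (a : R) (j : nat) : R := \prod_(i < j) (a + i%:R).

Lemma Gamma_rising (a : R) (j : nat) : 0 <= a -> G (a + j%:R + 1) = rising (a + 1) j * G (a + 1).
Proof.
move=> a0; elim: j => [|j ih]; first by rewrite addr0 /rising big_ord0 mul1r.
have -> : a + j.+1%:R + 1 = a + j%:R + 1 + 1 by rewrite -natr1 addrA.
have aj : 0 <= a + j%:R by rewrite addr_ge0.
rewrite (GammaS aj).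
rewrite ih.
rewrite /rising big_ord_recr/=.
by rewrite (addrAC a 1) mulrCA mulrA.
Qed.

Lemma rising_diff (a : R) j : rising (a + 1) j.+1 - rising a j.+1 = j.+1%:R * rising (a + 1) j.
Proof.
rewrite /rising big_ord_recr/= [X in _ - X]big_ord_recl/= addr0.
have -> : \prod_(i < j) (a + (bump 0 i)%:R) = \prod_(i < j) (a + 1 + i%:R).
  by apply: eq_bigr => i _; rewrite /bump/= natrD; ring.
rewrite -natr1; ring.
Qed.

(** The n-th finite difference of p at 0, up to the sign (-1)^n. *)
Definition altsum n (p : nat -> R) : R := \sum_(k < n.+1) (-1) ^+ k * 'C(n, k)%:R * p k.

Lemma altsumS n p : altsum n.+1 p = altsum n (fun k => p k - p k.+1).
Proof.
rewrite /altsum big_ord_recl/= expr0 bin0 mul1r.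
under eq_bigr do rewrite /bump/= add1n binS natrD exprS.
rewrite [RHS](eq_bigr (fun k : 'I_n.+1 =>
    (-1) ^+ k * 'C(n, k)%:R * p k - (-1) ^+ k * 'C(n, k)%:R * p k.+1)); last first.
  by move=> k _; ring.
rewrite sumrB [X in _ = X - _]big_ord_recl/= expr0 bin0 mul1r -addrA; congr (_ + _).
have -> : \sum_(i < n) (-1) ^+ bump 0 i * 'C(n, bump 0 i)%:R * p (bump 0 i) =
    \sum_(i < n.+1) (-1) ^+ i.+1 * 'C(n, i.+1)%:R * p i.+1.
  rewrite [RHS]big_ord_recr/= bin_small// mulr0 mul0r addr0.
  by apply: eq_bigr => i _; rewrite /bump/= add1n.
by rewrite -sumrB; apply: eq_bigr => i _; rewrite exprS; ring.
Qed.

Lemma eq_altsum n p q : p =1 q -> altsum n p = altsum n q.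
Proof. by move=> pq; apply: eq_bigr => k _; rewrite pq. Qed.

(** A rising factorial of length j is a polynomial of degree j in k, so its n-th
    difference is 0 for j < n and constant for j = n. *)
Lemma altsum_rising n j (a : R) : (j <= n)%N ->
  altsum n (fun k => rising (a + k%:R) j) = (if j == n then (-1) ^+ n * n`!%:R else 0).
Proof.
elim: n j a => [|n ih] [|j] a //= jn.
- by rewrite /altsum big_ord_recr big_ord0/= /rising big_ord0 bin0 !mulr1 add0r.
- rewrite altsumS /altsum big1// => k _.
  by rewrite /rising !big_ord0 subrr mulr0.
rewrite altsumS (@eq_altsum _ _ (fun k => (- j.+1%:R) * rising (a + 1 + k%:R) j)); last first.
  move=> k; rewrite -opprB mulNr; congr (- _).
  rewrite -natr1 addrA rising_diff; congr (_ * rising _ _); ring.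
have -> : altsum n (fun k => - j.+1%:R * rising (a + 1 + k%:R) j) =
    - j.+1%:R * altsum n (fun k => rising (a + 1 + k%:R) j).
  by rewrite /altsum mulr_sumr; apply: eq_bigr => k _; ring.
rewrite ih// eqSS; case: eqP => [->|_]; last by rewrite mulr0.
by rewrite factS natrM exprS; ring.
Qed.

Lemma ip_monomial_laguerre n j : (j <= n)%N ->
  ip mu R0 w (laguerre alpha n) (fun t => t ^+ j) =
  lnorm2 n * (if j == n then (-1) ^+ n * n`!%:R else 0).
Proof.
move=> jn; rewrite ip_laguerre_l; last exact: sqi_monomial.
rewrite -(@altsum_rising n j (alpha + 1))// /altsum mulr_sumr.
apply: eq_bigr => k _; rewrite -lag_coef_moment; last by rewrite -ltnS.
congr (_ * _); rewrite /ip; under eq_Rintegral do rewrite -exprD.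
rewrite moment natrD addrA (@Gamma_rising (alpha + k%:R)) ?addr_ge0 ?(ltW alpha0)//.
by rewrite (addrAC alpha k%:R) -mulrA mulrC.
Qed.

(** The Laguerre polynomial of degree n is orthogonal to all lower powers, so only
    the leading coefficient contributes to its norm. *)
Lemma ip_laguerre m n : ip mu R0 w (laguerre alpha m) (laguerre alpha n) =
  (if m == n then lnorm2 n else 0).
Proof.
wlog mn : m n / (m <= n)%N.
  move=> H; have [|/ltnW nm] := leqP m n; first exact: H.
  by rewrite ipC H// eq_sym; case: eqP => // ->.
rewrite ip_laguerre_l; last exact: sqi_laguerre.
rewrite (eq_bigr (fun k : 'I_m.+1 => lag_coef m k *
    (lnorm2 n * (if (k : nat) == n then (-1) ^+ n * n`!%:R else 0)))); last first.
  by move=> k _; rewrite ipC ip_monomial_laguerre// (leq_trans _ mn)// -ltnS.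
rewrite big_ord_recr/= big1 ?add0r; last first.
  by move=> k _; rewrite (_ : _ == n = false) ?mulr0//; apply: ltn_eqF; exact: leq_trans mn.
case: eqP => [->|_]; last by rewrite !mulr0.
have ga := Gamma_alpha_gt0 n.
rewrite /lag_coef subrr add0r Gamma1 mul1r divff ?gt_eqF// mul1r.
have f1 : n`!%:R != 0 :> R by rewrite pnatr_eq0 -lt0n fact_gt0.
rewrite mulrCA -[RHS]mulr1; congr (_ * _).
by rewrite mulrACA -expr2 sqrr_sign mul1r mulVf.
Qed.

Definition lag (n : nat) (t : R) : R :=
  Num.sqrt (G (n%:R + 1) * G (alpha + 1) / G (alpha + n%:R + 1)) * laguerre alpha n t.

Lemma lag_cst n : Num.sqrt (G (n%:R + 1) * G (alpha + 1) / G (alpha + n%:R + 1)) =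
  (Num.sqrt (lnorm2 n))^-1.
Proof. by rewrite Gamma_nat -sqrtrV ?ltW ?lnorm2_gt0// /lnorm2 invf_div. Qed.

Lemma sqi_lag n : sqi mu R0 w (lag n).
Proof. by apply: (sqiZ mR0); exact: sqi_laguerre. Qed.

Lemma ip_lag_l n h : sqi mu R0 w h ->
  ip mu R0 w (lag n) h = (Num.sqrt (lnorm2 n))^-1 * ip mu R0 w (laguerre alpha n) h.
Proof.
move=> sh; rewrite -lag_cst; apply: (xipZl) => //.
exact: sqi_laguerre.
Qed.

Lemma ip_lag m n : ip mu R0 w (lag m) (lag n) = (m == n)%:R.
Proof.
rewrite ip_lag_l; last exact: sqi_lag.
rewrite ipC ip_lag_l; last exact: sqi_laguerre.
rewrite ip_laguerre eq_sym; case: eqP => [->|_]; last by rewrite !mulr0.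
have c0 := lnorm2_gt0 n.
have s0 : Num.sqrt (lnorm2 n) != 0 by rewrite gt_eqF// sqrtr_gt0.
rewrite -[X in _ * (_ * X)](sqr_sqrtr (ltW c0)) expr2 mulrA -invfM mulrA.
by rewrite -mulrA mulVf// mulf_neq0.
Qed.

End laguerre_system.

(** * The kernel of the operator and its Laguerre coefficients *)

Section bernoulli.
Context {R : realType}.

Lemma bernoulli_ge (x : R) N : 0 <= x <= 1 -> 1 - N%:R * x <= (1 - x) ^+ N.
Proof.
move=> /andP[x0 x1]; elim: N => [|N ih]; first by rewrite mul0r subr0 expr0.
rewrite exprS; apply: (@le_trans _ _ ((1 - x) * (1 - N%:R * x))).
  have N0 : 0 <= N%:R * x * x :> R by rewrite !mulr_ge0.
  by rewrite -natr1; nra.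
by rewrite ler_wpM2l// subr_ge0.
Qed.

Lemma bernoulli_le (x : R) N : 0 <= x <= 1 -> (1 - x) ^+ N * (1 + N%:R * x) <= 1.
Proof.
move=> /andP[x0 x1]; elim: N => [|N ih]; first by rewrite mul0r addr0 expr0 mulr1.
have p0 : 0 <= (1 - x) ^+ N by rewrite exprn_ge0// subr_ge0.
apply: le_trans ih; rewrite exprSr -mulrA ler_wpM2l//.
have N0 : 0 <= N%:R * x * x :> R by rewrite !mulr_ge0.
have x2 : 0 <= x * x by rewrite mulr_ge0.
by rewrite -natr1; nra.
Qed.

End bernoulli.

Section kernel.
Context {R : realType} (alpha : R) (alpha0 : 0 < alpha).
Local Notation mu := (@lebesgue_measure R).
Local Notation Rp := (`]0, +oo[%classic : set R).
Local Notation R0 := (`[0, +oo[%classic : set R).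
Local Notation w := (gamma_weight alpha).
Local Notation G := (@Gamma R).
Local Notation gw0 := (gamma_weight_ge0 alpha0).

(** With 1 - q/r = m e^(J th), kerC and kerS are the components along 1 and J of the
    function t -> (1 - q/r)^(-alpha-1) exp(t q/(q - r)); indeed q/(q - r) = 1 -
    e^(-J th)/m. The hypothesis 1/2 < cos th / m below means |q| < r and makes
    exp(2(1 - cos th/m)t) integrable against exp(-t). *)
Definition kerC m th t : R :=
  m `^ (- alpha - 1) * (expR ((1 - cos th / m) * t) * cos (t * (sin th / m) - (alpha + 1) * th)).
Definition kerS m th t : R :=
  m `^ (- alpha - 1) * (expR ((1 - cos th / m) * t) * sin (t * (sin th / m) - (alpha + 1) * th)).

Variables (m th : R).
Hypotheses (m0 : 0 < m) (thb : `|th| < pi / 2) (mth : 1 / 2 < cos th / m).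
Local Notation u := (1 - 2 * m * cos th + m ^+ 2).

Let c1 : 1 - cos th / m < 1 / 2. Proof. by move: mth; lra. Qed.
Let c2 : 1 - cos th / m < 1. Proof. by move: mth; lra. Qed.
Let x0 : 0 < cos th / m. Proof. by move: mth; lra. Qed.

Let mcos : measurable_fun (setT : set (measurableTypeR R))
  (fun t => cos (t * (sin th / m) - (alpha + 1) * th)).
Proof.
apply: continuous_meas => x.
by apply: (der_continuous (der_cos (der_sub (der_scale (sin th / m) x) (der_cst ((alpha + 1) * th) x)))).
Qed.
Let msin : measurable_fun (setT : set (measurableTypeR R))
  (fun t => sin (t * (sin th / m) - (alpha + 1) * th)).
Proof.
apply: continuous_meas => x.
by apply: (der_continuous (der_sin (der_sub (der_scale (sin th / m) x) (der_cst ((alpha + 1) * th) x)))).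
Qed.

Lemma sqi_kerC : sqi mu R0 w (kerC m th).
Proof.
apply: (sqiZ mR0).
have := @sqi_exp_growth _ _ alpha0 0 _ _ c1 mcos (fun t => cos_norm1 _).
by under [X in sqi _ _ _ X]eq_fun do rewrite expr0 mul1r.
Qed.

Lemma sqi_kerS : sqi mu R0 w (kerS m th).
Proof.
apply: (sqiZ mR0).
have := @sqi_exp_growth _ _ alpha0 0 _ _ c1 msin (fun t => sin_norm1 _).
by under [X in sqi _ _ _ X]eq_fun do rewrite expr0 mul1r.
Qed.

Let ak k : 0 <= alpha + k%:R. Proof. by rewrite addr_ge0// ltW. Qed.

Let m_pow k : m `^ (- alpha - 1) * m `^ (alpha + k%:R + 1) = m ^+ k.
Proof.
rewrite -powRD; last by apply/implyP => _; rewrite gt_eqF.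
by rewrite -powR_mulrn ?(ltW m0)//; congr powR; ring.
Qed.

(** Integrating t^k against the kernel gives a Laplace integral with exponent alpha
    + k, that is, Gamma(alpha+k+1) (m e^(J th))^(alpha+k+1); the factor (m e^(J
    th))^(-alpha-1) of the kernel leaves the k-th power of 1 - q/r. *)
Lemma ip_monomial_kerC k : ip mu R0 w (fun t => t ^+ k) (kerC m th) =
  G (alpha + k%:R + 1) / G (alpha + 1) * (m ^+ k * cos (k%:R * th)).
Proof.
have [iE E] := @exp_growth_integrable _ _ alpha0 k _ _ c2 mcos (fun t => cos_norm1 _).
rewrite /ip /kerC.
rewrite (@eq_Rintegral _ _ _ mu R0 (fun t => m `^ (- alpha - 1) * (t ^+ k *
  expR ((1 - cos th / m) * t) * cos (t * (sin th / m) - (alpha + 1) * th) * w t))); last first.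
  by move=> t _; ring.
rewrite RintegralZl//.
have cE : 1 - (1 - cos th / m) = cos th / m by ring.
rewrite E cE.
have [pC pS] := lap_polar (ak k) m0 thb.
have -> : \int[mu]_(t in Rp) (t `^ (alpha + k%:R) * expR (- (cos th / m * t)) *
     cos (t * (sin th / m) - (alpha + 1) * th)) =
   cos ((alpha + 1) * th) * lapC (alpha + k%:R) (cos th / m) (sin th / m) +
   sin ((alpha + 1) * th) * lapS (alpha + k%:R) (cos th / m) (sin th / m).
  have jC := integrable_wave (sin th / m) (ak k) x0.
  have jS := integrable_wavs (sin th / m) (ak k) x0.
  rewrite -RintegralZl//.
  rewrite -RintegralZl//.
  rewrite -RintegralD; [|exact: mRp|exact: (intZ mRp)|exact: (intZ mRp)].
  by apply: eq_Rintegral => t _; rewrite /wave /wavs cosB; ring.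
rewrite pC pS.
have -> : k%:R * th = (alpha + k%:R + 1) * th - (alpha + 1) * th by ring.
rewrite cosB -(m_pow k).
move: (G _) (G _) (m `^ _) (m `^ _) (cos _) (sin _) (cos _) (sin _) => *; ring.
Qed.

Lemma ip_monomial_kerS k : ip mu R0 w (fun t => t ^+ k) (kerS m th) =
  G (alpha + k%:R + 1) / G (alpha + 1) * (m ^+ k * sin (k%:R * th)).
Proof.
have [iE E] := @exp_growth_integrable _ _ alpha0 k _ _ c2 msin (fun t => sin_norm1 _).
rewrite /ip /kerS.
rewrite (@eq_Rintegral _ _ _ mu R0 (fun t => m `^ (- alpha - 1) * (t ^+ k *
  expR ((1 - cos th / m) * t) * sin (t * (sin th / m) - (alpha + 1) * th) * w t))); last first.
  by move=> t _; ring.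
rewrite RintegralZl//.
have cE : 1 - (1 - cos th / m) = cos th / m by ring.
rewrite E cE.
have [pC pS] := lap_polar (ak k) m0 thb.
have -> : \int[mu]_(t in Rp) (t `^ (alpha + k%:R) * expR (- (cos th / m * t)) *
     sin (t * (sin th / m) - (alpha + 1) * th)) =
   cos ((alpha + 1) * th) * lapS (alpha + k%:R) (cos th / m) (sin th / m) -
   sin ((alpha + 1) * th) * lapC (alpha + k%:R) (cos th / m) (sin th / m).
  have jC := integrable_wave (sin th / m) (ak k) x0.
  have jS := integrable_wavs (sin th / m) (ak k) x0.
  rewrite -RintegralZl//.
  rewrite -RintegralZl//.
  rewrite -RintegralB; [|exact: mRp|exact: (intZ mRp)|exact: (intZ mRp)].
  by apply: eq_Rintegral => t _; rewrite /wave /wavs sinB; ring.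
rewrite pC pS.
have -> : k%:R * th = (alpha + k%:R + 1) * th - (alpha + 1) * th by ring.
rewrite sinB -(m_pow k).
move: (G _) (G _) (m `^ _) (m `^ _) (cos _) (sin _) (cos _) (sin _) => *; ring.
Qed.

(** The components of (1 - m e^(J th))^n = (q/r)^n, expanded by the binomial
    formula. *)
Definition powC n : R := altsum n (fun k => m ^+ k * cos (k%:R * th)).
Definition powS n : R := altsum n (fun k => m ^+ k * sin (k%:R * th)).

Lemma powC0 : powC 0 = 1.
Proof. by rewrite /powC /altsum big_ord1 mul0r cos0 !mulr1. Qed.
Lemma powS0 : powS 0 = 0.
Proof. by rewrite /powS /altsum big_ord1 mul0r sin0 !mulr0. Qed.

Lemma powCS n : powC n.+1 = (1 - m * cos th) * powC n + m * sin th * powS n.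
Proof.
rewrite /powC altsumS /altsum !mulr_sumr -big_split/=; apply: eq_bigr => k _.
have -> : k.+1%:R * th = k%:R * th + th by rewrite -natr1; ring.
by rewrite cosD exprS; ring.
Qed.
Lemma powSS n : powS n.+1 = (1 - m * cos th) * powS n - m * sin th * powC n.
Proof.
rewrite /powS altsumS /altsum !mulr_sumr -sumrB/=; apply: eq_bigr => k _.
have -> : k.+1%:R * th = k%:R * th + th by rewrite -natr1; ring.
by rewrite sinD exprS; ring.
Qed.

Lemma pow_sqmod n : powC n ^+ 2 + powS n ^+ 2 = u ^+ n.
Proof.
elim: n => [|n ih]; first by rewrite powC0 powS0 expr0n addr0 expr1n.
have E : m ^+ 2 = m ^+ 2 * (cos th ^+ 2 + sin th ^+ 2) by rewrite cos2Dsin2 mulr1.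
by rewrite powCS powSS [RHS]exprS -ih {1}E; ring.
Qed.

Lemma ip_lag_kerC n : ip mu R0 w (lag alpha n) (kerC m th) = Num.sqrt (lnorm2 alpha n) * powC n.
Proof.
rewrite (ip_lag_l alpha0 _ sqi_kerC) (ip_laguerre_l alpha0 _ sqi_kerC).
rewrite (eq_bigr (fun k : 'I_n.+1 => lnorm2 alpha n *
   ((-1) ^+ k * 'C(n, k)%:R * (m ^+ k * cos (k%:R * th))))); last first.
  by move=> k _; rewrite ip_monomial_kerC lag_coef_moment// -ltnS.
rewrite -mulr_sumr -/(powC n) mulrA; congr (_ * _).
have c0 := lnorm2_gt0 alpha0 n.
rewrite -[X in _ * X = _](sqr_sqrtr (ltW c0)) expr2 mulrA mulVf ?mul1r//.
by rewrite gt_eqF// sqrtr_gt0.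
Qed.

Lemma ip_lag_kerS n : ip mu R0 w (lag alpha n) (kerS m th) = Num.sqrt (lnorm2 alpha n) * powS n.
Proof.
rewrite (ip_lag_l alpha0 _ sqi_kerS) (ip_laguerre_l alpha0 _ sqi_kerS).
rewrite (eq_bigr (fun k : 'I_n.+1 => lnorm2 alpha n *
   ((-1) ^+ k * 'C(n, k)%:R * (m ^+ k * sin (k%:R * th))))); last first.
  by move=> k _; rewrite ip_monomial_kerS lag_coef_moment// -ltnS.
rewrite -mulr_sumr -/(powS n) mulrA; congr (_ * _).
have c0 := lnorm2_gt0 alpha0 n.
rewrite -[X in _ * X = _](sqr_sqrtr (ltW c0)) expr2 mulrA mulVf ?mul1r//.
by rewrite gt_eqF// sqrtr_gt0.
Qed.

(* u is the squared modulus of q/r. *)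
Let m2u : 0 < 1 - u.
Proof.
have : m < 2 * cos th by move: mth; rewrite ltr_pdivlMr//; lra.
by move=> h; have -> : 1 - u = m * (2 * cos th - m); [ring|rewrite mulr_gt0// subr_gt0].
Qed.
Let u0 : 0 <= u.
Proof.
have -> : u = (1 - m * cos th) ^+ 2 + (m * sin th) ^+ 2.
  have E : m ^+ 2 = m ^+ 2 * (cos th ^+ 2 + sin th ^+ 2) by rewrite cos2Dsin2 mulr1.
  by rewrite {1}E; ring.
by rewrite addr_ge0 ?sqr_ge0.
Qed.

Let one_norm (t : R) : `|1 : R| <= 1. Proof. by rewrite normr1. Qed.
Let mone : measurable_fun (setT : set (measurableTypeR R)) (fun=> 1 : R).
Proof. exact: measurable_cst. Qed.

(** The oscillation disappears from |kernel|^2, and what remains is a real Laplace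
    integral. *)
Lemma ker_norm : ip mu R0 w (kerC m th) (kerC m th) + ip mu R0 w (kerS m th) (kerS m th) =
  (1 - u) `^ (- (alpha + 1)).
Proof.
rewrite /ip -RintegralD; [|exact: mR0| |]; last 2 first.
- by apply: (sqi_mul mR0 (@mw _ _) gw0); exact: sqi_kerC.
- by apply: (sqi_mul mR0 (@mw _ _) gw0); exact: sqi_kerS.
pose c := 2 * (1 - cos th / m).
have c3 : c < 1 by move: c1; rewrite /c; lra.
have [iE E] := @exp_growth_integrable _ _ alpha0 0 _ _ c3 mone one_norm.
rewrite (@eq_Rintegral _ _ _ mu R0 (fun t => m `^ (- alpha - 1) * m `^ (- alpha - 1) *
   (t ^+ 0 * expR (c * t) * 1 * w t))); last first.
  move=> t _; rewrite /kerC /kerS /c.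
  set C := cos (_ - _); set S := sin (_ - _).
  have -> : expR (2 * (1 - cos th / m) * t) = expR ((1 - cos th / m) * t) ^+ 2.
    by rewrite -expRM_natl -mulrA.
  have CS : C ^+ 2 + S ^+ 2 = 1 by exact: cos2Dsin2.
  have -> : t ^+ 0 * expR ((1 - cos th / m) * t) ^+ 2 * 1 * w t =
     expR ((1 - cos th / m) * t) ^+ 2 * (C ^+ 2 + S ^+ 2) * w t by rewrite CS; ring.
  by ring.
rewrite RintegralZl//.
have ci : 0 < 1 - c by rewrite subr_gt0.
have a0 : 0 <= alpha by exact: ltW.
rewrite E -powRD; last by apply/implyP => _; rewrite gt_eqF.
rewrite (_ : \int[mu]_(t in Rp) _ = lapC alpha (1 - c) 0); last first.
  by apply: eq_Rintegral => t _; rewrite /wave addr0 mulr0 cos0.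
have -> : lapC alpha (1 - c) 0 = G (alpha + 1) * (1 - c) `^ (- (alpha + 1)).
  rewrite -(lapC_scale a0 ci) powRN mulrAC mulfV ?mul1r//.
  by rewrite gt_eqF// powR_gt0.
rewrite (mulrA (G (alpha + 1))^-1) mulVf ?mul1r; last first.
  by rewrite gt_eqF// Gamma_alpha1_gt0.
have -> : - alpha - 1 + (- alpha - 1) = 2%:R * - (alpha + 1) by ring.
rewrite powRrM powR_mulrn ?(ltW m0)// -powRM ?exprn_ge0 ?(ltW m0) ?(ltW ci)//.
by congr powR; rewrite /c; field; rewrite gt_eqF.
Qed.

End kernel.

Section binomial_series.
Context {R : realType} (alpha : R) (alpha0 : 0 < alpha).
Local Notation mu := (@lebesgue_measure R).
Local Notation Rp := (`]0, +oo[%classic : set R).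
Local Notation R0 := (`[0, +oo[%classic : set R).
Local Notation w := (gamma_weight alpha).
Local Notation G := (@Gamma R).

Lemma exp_partial_le (x : R) n : 0 <= x -> \sum_(k < n) x ^+ k / k`!%:R <= expR x.
Proof.
move=> x0; have H : nondecreasing_seq (series (exp_coeff x)).
  by apply/nondecreasing_seqP => k; rewrite seriesSr lerDl exp_coeff_ge0.
have := nondecreasing_cvgn_le H (is_cvg_series_exp_coeff x) n.
by rewrite /series/= big_mkord.
Qed.

Lemma exp_partial_cvg (x : R) : \sum_(k < n) x ^+ k / k`!%:R @[n --> \oo] --> expR x.
Proof.
have := is_cvg_series_exp_coeff x; rewrite -/(expR x).
have -> : series (exp_coeff x) = (fun n => \sum_(k < n) x ^+ k / k`!%:R).
  by apply/funext => n; rewrite /series/= big_mkord.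
by [].
Qed.

(** The weight turns the exponential series of exp(u t) into this series, since the
    k-th moment of the weight is k! lnorm2 k; the integral of exp(u t) is the power
    on the right. *)
Lemma binomial_series (u : R) : 0 <= u < 1 ->
  \sum_(k < n) lnorm2 alpha k * u ^+ k @[n --> \oo] --> (1 - u) `^ (- (alpha + 1)).
Proof.
move=> /andP[u0 u1]; have ui : 0 < 1 - u by rewrite subr_gt0.
have a0 : 0 <= alpha by exact: ltW.
have one_norm (t : R) : `|1 : R| <= 1 by rewrite normr1.
have mone : measurable_fun (setT : set (measurableTypeR R)) (fun=> 1 : R) by exact: measurable_cst.
have [iE E] := @exp_growth_integrable _ _ alpha0 0 _ _ u1 mone one_norm.
have im k : mu.-integrable R0 (EFin \o (fun t : R => u ^+ k / k`!%:R * (t ^+ k * w t))).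
  apply: (intZ mR0).
  have [+ _] := @exp_growth_integrable _ _ alpha0 k 0 _ ltr01 mone one_norm.
  by congr integrable; apply/funext => t /=; rewrite mul0r expR0 !mulr1.
have S n : \sum_(k < n) lnorm2 alpha k * u ^+ k =
    \int[mu]_(t in R0) (\sum_(k < n) (u * t) ^+ k / k`!%:R * w t).
  rewrite (@Rintegral_sum _ _ _ mu R0 mR0 n (fun k t => (u * t) ^+ k / k`!%:R * w t)); last first.
    move=> k; have := im k; congr integrable; apply/funext => t /=.
    by rewrite exprMn; congr EFin; ring.
  apply: eq_bigr => k _.
  rewrite (@eq_Rintegral _ _ _ mu R0 (fun t => u ^+ k / k`!%:R * (t ^+ k * w t))); last first.
    by move=> t _; rewrite exprMn; ring.
  rewrite RintegralZl; [|exact: mR0|]; last first.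
    have [+ _] := @exp_growth_integrable _ _ alpha0 k 0 _ ltr01 mone one_norm.
    by congr integrable; apply/funext => t /=; rewrite mul0r expR0 !mulr1.
  rewrite moment// /lnorm2 invfM.
  by move: (G _) (G _) (_^-1) => x y z; ring.
have -> : (1 - u) `^ (- (alpha + 1)) = \int[mu]_(t in R0) (expR (u * t) * w t).
  rewrite (@eq_Rintegral _ _ _ mu R0 (fun t => t ^+ 0 * expR (u * t) * 1 * w t)); last first.
    by move=> t _; rewrite expr0 mul1r mulr1.
  rewrite E (_ : \int[mu]_(t in Rp) _ = lapC alpha (1 - u) 0); last first.
    by apply: eq_Rintegral => t _; rewrite /wave addr0 mulr0 cos0.
  have := lapC_scale a0 ui; have g0 := Gamma_alpha1_gt0 alpha0.
  have p0 : 0 < (1 - u) `^ (alpha + 1) by rewrite powR_gt0.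
  move=> <-; rewrite powRN invfM -mulrA mulVf ?mulr1//.
  rewrite gt_eqF//; rewrite -(pmulr_rgt0 _ p0) lapC_scale//.
under eq_fun do rewrite S.
have mE : measurable_fun (R0 : set (measurableTypeR R)) (fun t => expR (u * t)).
  apply: continuous_meas => x.
  by apply: (der_continuous (der_exp (der_mul (der_cst u x) (der_id x)))).
apply: (@dominated_Rintegral _ _ _ mu R0 mR0 _ _ (fun t => expR (u * t) * w t) _ _ _ _ _).2.
- move=> n; apply: measurable_sum => k; apply: measurable_funM; last exact: mw.
  apply: measurable_funM => //; apply: measurable_funX; exact: measurable_funM.
- by apply: measurable_funM => //; exact: mw.
- apply: aeW => t _; under eq_fun do rewrite -mulr_suml.
  by apply: cvgM; [exact: exp_partial_cvg|exact: cvg_cst].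
- move=> n t t0; rewrite -mulr_suml normrM (ger0_norm (gamma_weight_ge0 alpha0 t0)).
  have {}t0 : 0 <= t by move: t0; rewrite /= in_itv/= andbT.
  apply: ler_wpM2r; first by apply: gamma_weight_ge0 => //; rewrite /= in_itv/= t0.
  rewrite ger0_norm; first by apply: exp_partial_le; rewrite mulr_ge0.
  by apply: sumr_ge0 => k _; rewrite divr_ge0// exprn_ge0// mulr_ge0.
- have := iE; congr integrable; apply/funext => t /=.
  by rewrite expr0 mul1r mulr1.
Qed.

(** Each of the two defects is nonnegative, hence at most their sum. *)
Lemma cvg_sum_split (a b : nat -> R) (A B : R) : (forall n, a n <= A) -> (forall n, b n <= B) ->
  (a n + b n) @[n --> \oo] --> A + B -> a n @[n --> \oo] --> A /\ b n @[n --> \oo] --> B.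
Proof.
move=> aA bB ab.
have d0 : (A + B - (a n + b n)) @[n --> \oo] --> (0 : R).
  by rewrite -(subrr (A + B)); apply: cvgB => //; exact: cvg_cst.
split; apply: (@cvg_dist0 R R^o _ _ _ _ d0) => n /=.
  by rewrite ger0_norm ?subr_ge0//; have := bB n; have := aA n; lra.
by rewrite ger0_norm ?subr_ge0//; have := bB n; have := aA n; lra.
Qed.

(** Bessel's inequality holds for kerC and for kerS, and the sum of the two
    expansions is the binomial series of the sum of the two squared norms; hence
    both inequalities are equalities. *)
Lemma ker_parseval (m th : R) : 0 < m -> `|th| < pi / 2 -> 1 / 2 < cos th / m ->
  (\sum_(k < n) ip mu R0 w (kerC alpha m th) (lag alpha k) ^+ 2) @[n --> \oo]
     --> ip mu R0 w (kerC alpha m th) (kerC alpha m th) /\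
  (\sum_(k < n) ip mu R0 w (kerS alpha m th) (lag alpha k) ^+ 2) @[n --> \oo]
     --> ip mu R0 w (kerS alpha m th) (kerS alpha m th).
Proof.
move=> m0 thb mth.
have sC := sqi_kerC alpha0 mth; have sS := sqi_kerS alpha0 mth.
have bes f n (sf : sqi mu R0 w f) := bessel mR0 (@mw _ _) (gamma_weight_ge0 alpha0)
   (sqi_lag alpha0) (ip_lag alpha0) n sf.
apply: cvg_sum_split => [n|n|]; [exact: bes|exact: bes|].
rewrite ker_norm//.
pose u := 1 - 2 * m * cos th + m ^+ 2.
have u01 : 0 <= u < 1.
  have h : m < 2 * cos th by move: mth; rewrite ltr_pdivlMr//; lra.
  have -> : u = (1 - m * cos th) ^+ 2 + (m * sin th) ^+ 2.
    have E : m ^+ 2 = m ^+ 2 * (cos th ^+ 2 + sin th ^+ 2) by rewrite cos2Dsin2 mulr1.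
    by rewrite /u {1}E; ring.
  rewrite addr_ge0 ?sqr_ge0//=.
  have -> : (1 - m * cos th) ^+ 2 + (m * sin th) ^+ 2 = 1 - m * (2 * cos th - m).
    have E : m ^+ 2 = m ^+ 2 * (cos th ^+ 2 + sin th ^+ 2) by rewrite cos2Dsin2 mulr1.
    have -> : m * (2 * cos th - m) = 2 * m * cos th - m ^+ 2 by ring.
    by rewrite {1}E; ring.
  by rewrite gtrBl mulr_gt0// subr_gt0.
rewrite -/u [X in X @ _ --> _](_ : _ = fun n => \sum_(k < n) lnorm2 alpha k * u ^+ k); last first.
  apply/funext => n; rewrite -big_split/=; apply: eq_bigr => k _.
  rewrite !(@ipC _ _ _ mu R0 w _ (lag alpha k)) ip_lag_kerC// ip_lag_kerS// !exprMn -mulrDr pow_sqmod//.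
  by rewrite sqr_sqrtr// ltW// lnorm2_gt0.
exact: binomial_series u01.
Qed.

Local Notation lagk := (lag alpha).

(** * Completeness of the Laguerre functions *)

Section complete.
Variable phi : R -> R.
Hypothesis sphi : sqi mu R0 w phi.
Hypothesis ophi : forall k, ip mu R0 w phi (lagk k) = 0.
Let psi t := phi t * w t.

Let ipsi : mu.-integrable R0 (EFin \o psi).
Proof.
have := sqi_mul mR0 (@mw _ _) (gamma_weight_ge0 alpha0) sphi (sqi_monomial alpha0 0).
by congr integrable; apply/funext => t; rewrite expr0 mulr1.
Qed.

Let mpsi : measurable_fun (R0 : set (measurableTypeR R)) psi.
Proof. by apply/measurable_EFinP; exact: measurable_int ipsi. Qed.

Let ipsiM (h : R -> R) : measurable_fun (R0 : set (measurableTypeR R)) h ->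
  (forall t, R0 t -> `|h t| <= 1) -> mu.-integrable R0 (EFin \o (fun t => psi t * h t)).
Proof.
move=> mh h1; apply: (@int_le _ _ _ mu R0 mR0 _ (fun t => `|psi t|)).
- exact: measurable_funM.
- by move=> t t0; rewrite normrM -[leRHS]mulr1 ler_wpM2l// h1.
- by have := integrable_norm ipsi; congr integrable.
Qed.

Let mexp (c : R) : measurable_fun (R0 : set (measurableTypeR R)) (fun t => expR (- (c * t))).
Proof.
apply: continuous_meas => x.
by apply: (der_continuous (der_exp (der_opp (der_mul (der_cst c x) (der_id x))))).
Qed.

Let exp01 (c t : R) : 0 <= c -> R0 t -> 0 <= expR (- (c * t)) <= 1.
Proof.
rewrite /= in_itv/= andbT => c0 t0; rewrite expR_ge0/= -[leRHS]expR0 ler_expR.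
by rewrite oppr_le0 mulr_ge0.
Qed.

(** The kernel at the real point with m = 1/(k+1), th = 0 is a multiple of exp(-k
    t). *)
Let moment0 (k : nat) : \int[mu]_(t in R0) (psi t * expR (- (k%:R * t))) = 0.
Proof.
pose m : R := (k.+1%:R)^-1.
have m0 : 0 < m by rewrite invr_gt0.
have th0 : `|0 : R| < pi / 2 by rewrite normr0 divr_gt0// pi_gt0.
have mth : 1 / 2 < cos (0 : R) / m.
  rewrite cos0 /m invrK (@lt_le_trans _ _ 1)//; first by lra.
  by rewrite mul1r ler1n.
have [H _] := ker_parseval m0 th0 mth.
have := parseval_ip mR0 (@mw _ _) (gamma_weight_ge0 alpha0) (sqi_lag alpha0)
   (ip_lag alpha0) (sqi_kerC alpha0 mth) sphi H.
under eq_fun do under eq_bigr do rewrite ophi mulr0.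
under eq_fun do rewrite big1//.
move=> /(cvg_unique _ (cvg_cst _)) => /(_ (@Rhausdorff R)).
rewrite /ip.
rewrite (@eq_Rintegral _ _ _ mu R0 (fun t => m `^ (- alpha - 1) * (psi t * expR (- (k%:R * t))))); last first.
  move=> t _; rewrite /kerC sin0 cos0 mul0r !mulr0 subrr cos0 mulr1 /psi.
  have -> : (1 - 1 / m) * t = - (k%:R * t) by rewrite /m invrK mul1r -natr1; ring.
  by ring.
rewrite RintegralZl//; last first.
  apply: ipsiM => // t t0; have /andP[e0 e1] := exp01 (ler0n _ k) t0.
  by rewrite ger0_norm.
by move/esym/eqP; rewrite mulf_eq0 gt_eqF ?powR_gt0//= => /eqP.
Qed.

(** The integrand is a combination of the exponentials of moment0. *)
Let moment1 (n N j : nat) :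
  \int[mu]_(t in R0) (psi t * (expR (- (j%:R * t)) * (1 - expR (- (n%:R * t))) ^+ N)) = 0.
Proof.
have iN M i : mu.-integrable R0 (EFin \o (fun t => psi t * (expR (- (i%:R * t)) * (1 - expR (- (n%:R * t))) ^+ M))).
  apply: ipsiM.
    by apply: measurable_funM => //; apply: measurable_funX; apply: measurable_funB.
  move=> t t0; have /andP[e0 e1] := exp01 (ler0n _ i) t0.
  have /andP[f0 f1] := exp01 (ler0n _ n) t0.
  rewrite normrM -[leRHS]mulr1 ler_pM// ?ger0_norm ?exprn_ge0 ?subr_ge0//.
  by rewrite exprn_ile1 ?subr_ge0// gerBl.
elim: N j => [|N ih] j; first by under eq_Rintegral do rewrite expr0 mulr1; exact: moment0.
rewrite (@eq_Rintegral _ _ _ mu R0 (fun t =>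
   psi t * (expR (- (j%:R * t)) * (1 - expR (- (n%:R * t))) ^+ N) -
   psi t * (expR (- ((j + n)%:R * t)) * (1 - expR (- (n%:R * t))) ^+ N))); last first.
  move=> t _; rewrite natrD exprS.
  have -> : - ((j%:R + n%:R) * t) = - (j%:R * t) - (n%:R * t) by ring.
  by rewrite expRD; ring.
by rewrite RintegralB// !ih subrr.
Qed.

(** (1 - exp(-n t))^N with N close to exp(n a) tends to 1 for t > a and to 0 for t <
    a: N exp(-n t) is close to exp(n(a - t)), and Bernoulli's inequality applies in
    both directions. *)
Let tail0 (a : R) : 0 < a -> \int[mu]_(t in `]a, +oo[) psi t = 0.
Proof.
move=> a0.
pose N n := Num.trunc (expR a ^+ n).
have Nle n : (N n)%:R <= expR a ^+ n by rewrite /N truncn_le exprn_ge0// expR_ge0.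
have Nge n : expR a ^+ n < (N n)%:R + 1.
  by rewrite natr1; have /andP[] := @truncn_itv R (expR a ^+ n) (exprn_ge0 _ (expR_ge0 _)).
pose g n (t : R) : R := (1 - expR (- (n%:R * t))) ^+ N n.
have g01 n t : R0 t -> 0 <= g n t <= 1.
  move=> t0; have /andP[f0 f1] := exp01 (ler0n _ n) t0.
  by rewrite exprn_ge0 ?subr_ge0//= exprn_ile1 ?subr_ge0// gerBl.
have eX n (t : R) : expR a ^+ n * expR (- (n%:R * t)) = expR (a - t) ^+ n.
  by rewrite -!expRM_natl -expRD; congr expR; ring.
pose ind (t : R) : R := if a < t then 1 else 0.
have g_cvg (t : R) : R0 t -> t != a -> g n t @[n --> \oo] --> ind t.
  move=> t0 ta; rewrite /ind; have [at_|at_] := ltP a t.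
    apply: (@cvg_dist0 R R^o _ (fun n => expR (a - t) ^+ n)) => [n|]; last first.
      by apply: cvg_expr; rewrite ger0_norm ?expR_ge0// -expR0 ltr_expR subr_lt0.
    have /andP[h0 h1] := g01 n t t0.
    rewrite ger0_norm ?subr_ge0//.
    have := bernoulli_ge (N n) (exp01 (ler0n _ n) t0); rewrite -/(g n t) => B.
    have : (N n)%:R * expR (- (n%:R * t)) <= expR (a - t) ^+ n.
      by rewrite -eX ler_wpM2r// expR_ge0.
    by rewrite /=; lra.
  have {ta at_} ta : t < a by rewrite lt_neqAle ta.
  apply: (@cvg_dist0 R R^o _ (fun n => expR (t - a) ^+ n)) => [n|]; last first.
    by apply: cvg_expr; rewrite ger0_norm ?expR_ge0// -expR0 ltr_expR subr_lt0.
  have /andP[h0 h1] := g01 n t t0.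
  rewrite sub0r normrN ger0_norm//.
  have := bernoulli_le (N n) (exp01 (ler0n _ n) t0); rewrite -/(g n t) => B.
  have E : expR (a - t) ^+ n <= 1 + (N n)%:R * expR (- (n%:R * t)).
    rewrite -eX; have /andP[f0 f1] := exp01 (ler0n _ n) t0.
    have : expR a ^+ n * expR (- (n%:R * t)) <= ((N n)%:R + 1) * expR (- (n%:R * t)).
      by rewrite ler_wpM2r// ltW.
    by rewrite mulrDl mul1r; lra.
  have -> : expR (t - a) ^+ n = (expR (a - t) ^+ n)^-1.
    by rewrite -exprVn -expRN opprB.
  rewrite -[leRHS]mul1r ler_pdivlMr ?exprn_gt0 ?expR_gt0//.
  by apply: le_trans B; rewrite ler_wpM2l.
have mg n : measurable_fun (R0 : set (measurableTypeR R)) (g n).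
  by apply: measurable_funX; apply: measurable_funB.
have indE : ind = \1_(`]a, +oo[%classic : set R).
  by apply/funext => t; rewrite indicE /ind mem_setE in_itv/= andbT; case: ifP.
have mind : measurable_fun (R0 : set (measurableTypeR R)) ind.
  by rewrite indE; apply: measurable_indic.
have aec : {ae mu, forall x, R0 x -> psi x * g n x @[n --> \oo] --> psi x * ind x}.
  exists [set a]; split => //; first exact: lebesgue_measure_set1.
  move=> t /= H; apply: contrapT => ta; apply: H => t0.
  by apply: cvgM; [exact: cvg_cst|apply: g_cvg => //; exact/eqP].
have bnd n x : R0 x -> `|psi x * g n x| <= `|psi x|.
  move=> x0; have /andP[h0 h1] := g01 n x x0.
  by rewrite normrM -[leRHS]mulr1 ler_wpM2l// ger0_norm.
have inorm : mu.-integrable R0 (EFin \o (fun t => `|psi t|)).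
  by have := integrable_norm ipsi; congr integrable.
have [_ H] := dominated_Rintegral mR0 (fun n => measurable_funM mpsi (mg n))
  (measurable_funM mpsi mind) aec bnd inorm.
have Z n : \int[mu]_(t in R0) (psi t * g n t) = 0.
  have := moment1 n (N n) 0; under eq_Rintegral do rewrite mul0r oppr0 expR0 mul1r.
  by [].
have : \int[mu]_(t in R0) (psi t * ind t) = 0.
  move: H; under eq_fun do rewrite Z.
  by move=> /(cvg_unique _ (cvg_cst _)) => /(_ (@Rhausdorff R)).
move=> <-; rewrite [RHS](@eq_Rintegral _ _ _ mu R0 (psi \_ (`]a, +oo[%classic : set R))).
  rewrite -Rintegral_mkcondr; congr Rintegral; rewrite setIidr//.
  by move=> t; rewrite /= !in_itv/= !andbT => /(lt_trans a0) /ltW.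
by move=> t _; rewrite indE indicE patchE; case: ifP => _; rewrite ?mulr1 ?mulr0.
Qed.

(** The primitive of psi vanishes, so psi is 0 almost everywhere by the Lebesgue
    differentiation theorem. *)
Lemma orthogonal_eq0 : ip mu R0 w phi phi = 0.
Proof.
have iRp : mu.-integrable Rp (EFin \o psi).
  by apply: integrableS ipsi => // x; rewrite /= !in_itv/= !andbT => /ltW.
pose Psi := psi \_ (R0 : set R).
have iPsi : mu.-integrable setT (EFin \o Psi).
  by have := ipsi; rewrite integrable_mkcond ?restrict_EFin//; exact: mR0.
have iy y : mu.-integrable [set` Interval (BRight 0) (BRight y)] (EFin \o Psi).
  by apply: integrableS iPsi.
have locP : locally_integrable [set: R] Psi by exact: integrable_locally_restrict.
have F0 x : 0 < x -> \int[mu]_(t in [set` Interval (BRight 0) (BRight x)]) Psi t = 0.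
  move=> x0.
  have -> : \int[mu]_(t in [set` Interval (BRight 0) (BRight x)]) Psi t =
            \int[mu]_(t in `]0, x]) psi t.
    apply: eq_Rintegral => t; rewrite inE/= in_itv/= => /andP[t0 _].
    by rewrite /Psi patchE mem_set//= in_itv/= (ltW t0).
  have p0 : \int[mu]_(t in Rp) psi t = 0.
    rewrite -Rintegral_R0//; have := moment0 0.
    by under eq_Rintegral do rewrite mul0r oppr0 expR0 mulr1.
  have := @Rintegral_itvB _ psi (BRight 0) +oo%O x iRp.
  rewrite p0 tail0// => /(_ _ _)/eqP; rewrite sub0r oppr_eq0 => H.
  by apply/eqP/H; rewrite ?bnd_simp// ltW.
have := FTC1 iy locP; move=> H.
rewrite /ip /Rintegral (@ae_eq_integral _ _ _ mu R0 (cst 0%E)) ?integral0//.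
- exact: measurable_int (sqi_mul mR0 (@mw _ _) (gamma_weight_ge0 alpha0) sphi sphi).
have an0 : {ae mu, forall x : R, x != 0}.
  exists [set 0]; split => //; first exact: lebesgue_measure_set1.
  by move=> t /= /negP; rewrite negbK => /eqP.
have aF := ae_filter_ringOfSetsType mu.
apply: filterS2 H an0 => x Hx xN0 x0.
have {}x0 : 0 < x by move: x0; rewrite /= in_itv/= andbT lt_neqAle eq_sym xN0.
have [|dF FE] := Hx; first by rewrite /= lte_fin.
suff P0 : psi x = 0 by rewrite -mulrA mulrCA -/(psi x) P0 mulr0.
have <- : Psi x = psi x by rewrite /Psi patchE mem_set//= in_itv/= (ltW x0).
rewrite -FE derive1E.
rewrite (@near_eq_derive _ _ _ _ (cst 0)) ?derive_cst//.
near=> y; rewrite F0//; near: y; exact: lt_nbhsr.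
Unshelve. all: by end_near. Qed.
End complete.

Lemma lag_complete : complete_system mu R0 w lagk.
Proof. by move=> f sf; exact: orthogonal_eq0. Qed.

End binomial_series.

(** * Quaternions: norm, slices, real functionals, limits *)

Section quat_norm.
Context {R : realType}.
Implicit Types (p q s : quat R).

Lemma qnormM p q : `|p * q| = `|p| * `|q|.
Proof.
rewrite !qnormE -sqrtrM; last exact: qsqmod_ge0.
by congr Num.sqrt => /=; ring.
Qed.

Lemma qnorm1 : `|1 : quat R| = 1.
Proof. by rewrite qnormE /= expr1n expr0n/= !addr0 sqrtr1. Qed.

Lemma qnormX q n : `|q ^+ n| = `|q| ^+ n.
Proof. by elim: n => [|n ih]; rewrite ?expr0 ?qnorm1// !exprS qnormM ih. Qed.

Lemma qnormsq q : `|q| ^+ 2 = qre q ^+ 2 + qi q ^+ 2 + qj q ^+ 2 + qk q ^+ 2.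
Proof. by rewrite qnormE sqr_sqrtr ?qsqmod_ge0. Qed.

Lemma qre_le q : `|qre q| <= `|q|.
Proof.
rewrite qnormE -sqrtr_sqr ler_sqrt ?qsqmod_ge0//.
by rewrite -!addrA lerDl !addr_ge0 ?sqr_ge0.
Qed.
Lemma qi_le q : `|qi q| <= `|q|.
Proof.
rewrite qnormE -sqrtr_sqr ler_sqrt ?qsqmod_ge0//.
by rewrite (addrC (qre q ^+ 2)) -!addrA lerDl !addr_ge0 ?sqr_ge0.
Qed.
Lemma qj_le q : `|qj q| <= `|q|.
Proof.
rewrite qnormE -sqrtr_sqr ler_sqrt ?qsqmod_ge0//.
by rewrite (addrC _ (qj q ^+ 2)) -!addrA lerDl !addr_ge0 ?sqr_ge0.
Qed.
Lemma qk_le q : `|qk q| <= `|q|.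
Proof.
rewrite qnormE -sqrtr_sqr ler_sqrt ?qsqmod_ge0//.
by rewrite (addrC _ (qk q ^+ 2)) -!addrA lerDl !addr_ge0 ?sqr_ge0.
Qed.

Lemma qsq_le_sum (x y z t : R) :
  Num.sqrt (x ^+ 2 + y ^+ 2 + z ^+ 2 + t ^+ 2) <= `|x| + `|y| + `|z| + `|t|.
Proof.
have h : 0 <= `|x| + `|y| + `|z| + `|t| by rewrite !addr_ge0.
rewrite -[leRHS](ger0_norm h) -sqrtr_sqr ler_sqrt ?sqr_ge0//.
rewrite -(real_normK (num_real x)) -(real_normK (num_real y)).
rewrite -(real_normK (num_real z)) -(real_normK (num_real t)).
move: (normr_ge0 x) (normr_ge0 y) (normr_ge0 z) (normr_ge0 t).
move: `|x| `|y| `|z| `|t| => a b c d a0 b0 c0 d0.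
have -> : (a + b + c + d) ^+ 2 = a ^+ 2 + b ^+ 2 + c ^+ 2 + d ^+ 2 +
  2 * (a * b + a * c + a * d + b * c + b * d + c * d) by ring.
by rewrite lerDl mulr_ge0// !addr_ge0// mulr_ge0.
Qed.

Lemma qnorm_le_sum q : `|q| <= `|qre q| + `|qi q| + `|qj q| + `|qk q|.
Proof. by rewrite qnormE; exact: qsq_le_sum. Qed.

Lemma q_sum_comp n (F : nat -> quat R) :
  [/\ qre (\sum_(k < n) F k) = \sum_(k < n) qre (F k),
      qi (\sum_(k < n) F k) = \sum_(k < n) qi (F k),
      qj (\sum_(k < n) F k) = \sum_(k < n) qj (F k) &
      qk (\sum_(k < n) F k) = \sum_(k < n) qk (F k)].
Proof.
elim: n => [|n [ih1 ih2 ih3 ih4]]; first by rewrite !big_ord0.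
by rewrite !big_ord_recr /= ih1 ih2 ih3 ih4.
Qed.

Lemma usphere_sqr (J : quat R) : usphere J -> J * J = - 1.
Proof. by rewrite /usphere /= expr2. Qed.

Lemma slice_ptM (J : quat R) (z z' : R * R) : usphere J ->
  slice_pt J z * slice_pt J z' =
  slice_pt J (z.1 * z'.1 - z.2 * z'.2, z.1 * z'.2 + z.2 * z'.1).
Proof.
move=> SJ; rewrite /slice_pt /= mulrDl !mulrDr.
rewrite -!scalerAl -!scalerAr !mul1r mulr1 usphere_sqr// !scalerA.
by rewrite scalerN [X in _ + X = _]addrC addrACA -scalerBl -scalerDl.
Qed.

Lemma slice_ptD (J : quat R) (z z' : R * R) :
  slice_pt J z + slice_pt J z' = slice_pt J (z.1 + z'.1, z.2 + z'.2).
Proof. by rewrite /slice_pt/= !scalerDl addrACA. Qed.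

Lemma slice_ptB (J : quat R) (z z' : R * R) :
  slice_pt J z - slice_pt J z' = slice_pt J (z.1 - z'.1, z.2 - z'.2).
Proof. by rewrite /slice_pt/= !scalerBl opprD addrACA. Qed.

Lemma slice_ptZ (J : quat R) a (z : R * R) :
  a *: slice_pt J z = slice_pt J (a * z.1, a * z.2).
Proof. by rewrite /slice_pt/= scalerDr !scalerA. Qed.

Lemma slice_pt1 (J : quat R) : slice_pt J (1, 0) = 1.
Proof. by rewrite /slice_pt/= scale1r scale0r addr0. Qed.
Lemma slice_ptr (J : quat R) x : slice_pt J (x, 0) = x%:A.
Proof. by rewrite /slice_pt/= scale0r addr0. Qed.
Lemma slice_ptC (J : quat R) z z' : usphere J ->
  slice_pt J z * slice_pt J z' = slice_pt J z' * slice_pt J z.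
Proof.
move=> SJ; rewrite !slice_ptM//; congr (slice_pt J (_, _)); ring.
Qed.

Lemma slice_pt_comm (J : quat R) z : slice_pt J z * J = J * slice_pt J z.
Proof. by rewrite /slice_pt mulrDl mulrDr -!scalerAl -!scalerAr mul1r mulr1. Qed.

(** Every quaternion lies in some slice; real ones lie in all of them, and the slice
    of the quaternion i is chosen. *)
Lemma slice_exists q : exists J z, usphere J /\ q = slice_pt J z.
Proof.
have [im0|im0] := eqVneq (qim q) 0.
  exists (Quat 0 1 0 0), (qre q, 0); split.
    by rewrite /usphere/= expr2; apply: quatP => /=; ring.
  case: q im0 => a b c d /= [-> -> ->]; apply: quatP => /=; ring.
exists (qdir q), (qre q, `|qim q|).
have n0 : `|qim q| != 0 by rewrite normr_eq0.
split.
  rewrite /usphere /= expr2 /qdir -scalerAl -scalerAr scalerA -expr2 exprVn.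
  have -> : qim q * qim q = - (`|qim q| ^+ 2 *: 1).
    by rewrite qnormsq; apply: quatP => /=; ring.
  by rewrite scalerN scalerA mulVf ?scale1r// expf_neq0.
rewrite /slice_pt /qdir /= scalerA mulfV// scale1r.
by case: q {im0 n0} => a b c d; apply: quatP => /=; ring.
Qed.

Lemma norm_slice_sq (J : quat R) z : usphere J -> `|slice_pt J z| ^+ 2 = z.1 ^+ 2 + z.2 ^+ 2.
Proof. by move=> SJ; rewrite norm_slice// sqr_sqrtr// addr_ge0 ?sqr_ge0. Qed.

End quat_norm.

Section quat_functionals.
Context {R : realType} {T : Type}.

Lemma qre_mulE (c q : quat R) : qre (c * q) =
  qre c * qre q + (- qi c) * qi q + (- qj c) * qj q + (- qk c) * qk q.
Proof. by move=> /=; ring. Qed.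

(** Statements on quaternion-valued functions are reduced to real ones through the
    functionals p -> qre (c * p), with c arbitrary. Unlike the four coordinates,
    this family is stable under multiplication by a fixed quaternion on either side,
    so calculations with products need no expansion in coordinates. *)
Lemma functional_components (Pr : (T -> R) -> Prop) (f : T -> quat R) :
  (forall c, Pr (fun x => qre (c * f x))) ->
  [/\ Pr (fun x => qre (f x)), Pr (fun x => qi (f x)), Pr (fun x => qj (f x)) &
      Pr (fun x => qk (f x))].
Proof.
move=> H; split.
- by have := H 1; congr Pr; apply/funext => x; rewrite mul1r.
- by have := H (Quat 0 (-1) 0 0); congr Pr; apply/funext => x /=; ring.
- by have := H (Quat 0 0 (-1) 0); congr Pr; apply/funext => x /=; ring.
- by have := H (Quat 0 0 0 (-1)); congr Pr; apply/funext => x /=; ring.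
Qed.

End quat_functionals.

Section quat_integral.
Context d (T : measurableType d) {R : realType} (mu : {measure set T -> \bar R}).
Context (D : set T) (mD : measurable D).

Lemma functional_qmeasurable (f : T -> quat R) :
  (forall c, measurable_fun D (fun x => qre (c * f x))) -> qmeasurable D f.
Proof. exact: (functional_components (Pr := measurable_fun D)). Qed.

Lemma functional_qintegrable (f : T -> quat R) :
  (forall c, mu.-integrable D (EFin \o (fun x => qre (c * f x)))) -> qintegrable mu D f.
Proof. exact: (functional_components (Pr := fun u => mu.-integrable D (EFin \o u))). Qed.

Lemma qre_qintegral (f : T -> quat R) c : qintegrable mu D f ->
  qre (c * qintegral mu D f) = \int[mu]_(x in D) qre (c * f x).
Proof.
move=> [h1 h2 h3 h4]; rewrite qre_mulE /qintegral -!RintegralZl//.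
under [RHS]eq_Rintegral do rewrite qre_mulE.
by rewrite !RintegralD//; do ?[apply: intD => //]; exact: intZ.
Qed.

End quat_integral.

Section quat_limits.
Context {R : realType}.
Implicit Types (p q : quat R) (u v : nat -> quat R).

Lemma cvg_quat u (s : quat R) : (fun n => qre (u n)) @ \oo --> qre s ->
  (fun n => qi (u n)) @ \oo --> qi s -> (fun n => qj (u n)) @ \oo --> qj s ->
  (fun n => qk (u n)) @ \oo --> qk s -> u @ \oo --> s.
Proof.
move=> h1 h2 h3 h4.
have d0 (f : nat -> R) l : f @ \oo --> l -> (fun n => `|l - f n|) @ \oo --> 0.
  move=> fl; rewrite -[X in _ --> X](@normr0 _ R) -(subrr l).
  by apply: cvg_norm; apply: cvgB => //; exact: cvg_cst.
apply: (@cvg_dist0 R _ u _ s _ _) => [n|]; first exact: qnorm_le_sum.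
rewrite -[X in _ --> X]addr0 -[X in _ --> X + _]addr0 -[X in _ --> X + _ + _]addr0.
by apply: cvgD; [apply: cvgD; [apply: cvgD|]|]; apply: d0.
Qed.

Lemma cvg_qdist u (s : quat R) : u @ \oo --> s -> `|s - u n| @[n --> \oo] --> (0 : R).
Proof.
move=> us; rewrite -[X in _ --> X](@normr0 _ (quat R)) -(subrr s).
by apply: cvg_norm; apply: cvgB => //; exact: cvg_cst.
Qed.

Lemma cvg_qmull u (s : quat R) p : u @ \oo --> s -> p * u n @[n --> \oo] --> p * s.
Proof.
move=> us; apply: (@cvg_dist0 R _ _ (fun n => `|p| * `|s - u n|)) => [n|].
  by rewrite -mulrBr qnormM.
by rewrite -(mulr0 `|p|); apply: cvgM; [exact: cvg_cst|exact: cvg_qdist].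
Qed.

Lemma qcvg_unique u (s t : quat R) : u @ \oo --> s -> u @ \oo --> t -> s = t.
Proof. by apply: cvg_unique; exact: norm_hausdorff. Qed.

Lemma cvg_norm_bound u (s : quat R) (B : R) : u @ \oo --> s -> (forall n, `|u n| <= B) -> `|s| <= B.
Proof.
move=> us uB; have H : `|u n| @[n --> \oo] --> `|s| by exact: cvg_norm.
rewrite -(cvg_lim _ H)//; apply: limr_le; first exact/cvgP/H.
exact: nearW.
Qed.

(** Absolute convergence, coordinate by coordinate. *)
Lemma qsum_exists (u : nat -> quat R) (B : R) :
  (forall n, \sum_(k < n) `|u k| <= B) ->
  exists s : quat R, (fun n => \sum_(k < n) u k) @ \oo --> s.
Proof.
move=> uB.
have rc (c : nat -> R) : (forall k, `|c k| <= `|u k|) -> cvgn (fun n => \sum_(k < n) c k).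
  move=> cu; have -> : (fun n => \sum_(k < n) c k) = series c.
    by apply/funext => n; rewrite /series/= big_mkord.
  apply: (@normed_cvg R R^o); apply: nondecreasing_is_cvgn.
    move=> a b ab; rewrite -[X in X <= _]/(\sum_(0 <= k < a) `|c k|).
    rewrite -[X in _ <= X]/(\sum_(0 <= k < b) `|c k|) (big_cat_nat (leq0n a) ab)/=.
    by rewrite lerDl sumr_ge0.
  exists B => _ [n _ <-]; rewrite -[X in X <= _]/(\sum_(0 <= k < n) `|c k|) big_mkord.
  by apply: le_trans (uB n); apply: ler_sum => k _.
have [h1 h2 h3 h4] := And4 (rc _ (fun k => qre_le (u k))) (rc _ (fun k => qi_le (u k)))
  (rc _ (fun k => qj_le (u k))) (rc _ (fun k => qk_le (u k))).
exists (Quat (limn (fun n => \sum_(k < n) qre (u k))) (limn (fun n => \sum_(k < n) qi (u k)))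
  (limn (fun n => \sum_(k < n) qj (u k))) (limn (fun n => \sum_(k < n) qk (u k)))).
apply: cvg_quat => /=.
- by under eq_fun do rewrite (let: And4 e _ _ _ := q_sum_comp _ u in e).
- by under eq_fun do rewrite (let: And4 _ e _ _ := q_sum_comp _ u in e).
- by under eq_fun do rewrite (let: And4 _ _ e _ := q_sum_comp _ u in e).
- by under eq_fun do rewrite (let: And4 _ _ _ e := q_sum_comp _ u in e).
Qed.

End quat_limits.

(** * Power series of a quaternionic variable *)

Section power_series.
Context {R : realType}.
Implicit Types (a : nat -> quat R) (f : quat R -> quat R) (p q h : quat R) (r rho : R).

Definition psum a q (N : nat) : quat R := \sum_(n < N) q ^+ n * a n.

Definition ps_on f a r := forall q, `|q| < r -> psum a q @ \oo --> f q.

(** A growth condition on the coefficients that is equivalent to convergence on the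
    ball of radius r, but does not mention the sum; it passes to the derived series. *)
Definition ps_dom a r := forall rho, 0 < rho < r -> exists M, forall n, `|a n| * rho ^+ n <= M.

Lemma qnorm_real (x : R) : `|x%:A : quat R| = `|x|.
Proof. by rewrite normrZ qnorm1 mulr1. Qed.

(** Convergence at the real points of the ball is enough: the terms of a convergent
    series are bounded, and the bound depends only on |q|. *)
Lemma ps_dom_real a r : (forall x : R, `|x%:A : quat R| < r -> exists s : quat R, psum a x%:A @ \oo --> s) ->
  ps_dom a r.
Proof.
move=> fa rho /andP[rho0 rhor].
have [|s S] := fa rho; first by rewrite qnorm_real gtr0_norm.
have [M [_ /(_ (M + 1))]] := cvg_seq_bounded (cvgP _ S).
rewrite ltrDl => /(_ ltr01) HM; exists (2 * (M + 1)) => n.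
have -> : `|a n| * rho ^+ n = `|psum a rho%:A n.+1 - psum a rho%:A n|.
  rewrite /psum big_ord_recr/= addrAC subrr add0r qnormM qnormX qnorm_real gtr0_norm//.
  exact: mulrC.
apply: (le_trans (ler_normB _ _)); rewrite mulrDl mul1r.
by rewrite lerD// HM.
Qed.

Lemma ps_on_dom f a r : ps_on f a r -> ps_dom a r.
Proof. by move=> fa; apply: ps_dom_real => x xr; exists (f x%:A); exact: fa. Qed.

Lemma nat_geo (x y : R) n : 0 < x < y -> n%:R * x ^+ n <= x / (y - x) * y ^+ n.
Proof.
move=> /andP[x0 xy]; have yx : 0 < y - x by rewrite subr_gt0.
have y0 : 0 < y by exact: lt_trans xy.
rewrite mulrAC ler_pdivlMr//; elim: n => [|n ih].
  by rewrite !mul0r mulr_ge0// ?ltW// exprn_ge0// ltW.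
have xyn : x ^+ n <= y ^+ n by rewrite lerXn2r// ?nnegrE ltW.
have -> : n.+1%:R * x ^+ n.+1 * (y - x) = x * (n%:R * x ^+ n * (y - x)) + x * (x ^+ n * (y - x)).
  by rewrite -natr1 exprS; ring.
have -> : x * y ^+ n.+1 = x * (x * y ^+ n) + x * (y ^+ n * (y - x)) by rewrite exprS; ring.
by apply: lerD; rewrite ler_wpM2l ?(ltW x0)// ler_wpM2r// ltW.
Qed.

Lemma ps_dom_mulr a r : ps_dom a r -> ps_dom (fun n => n%:R *: a n) r.
Proof.
move=> da rho /andP[rho0 rhor]; pose sigma := (rho + r) / 2.
have rs : 0 < rho < sigma by rewrite rho0/= /sigma; lra.
have [|M HM] := da sigma; first by rewrite /sigma; lra.
have K0 : 0 <= rho / (sigma - rho).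
  by move: rs => /andP[_ rs]; rewrite divr_ge0 ?subr_ge0// ltW.
exists (rho / (sigma - rho) * M) => n; rewrite normrZ normr_nat.
rewrite mulrAC mulrC; apply: (@le_trans _ _ (`|a n| * (rho / (sigma - rho) * sigma ^+ n))).
  by rewrite ler_wpM2l// nat_geo.
by rewrite mulrCA ler_wpM2l.
Qed.

Lemma ps_dom_shift a r : ps_dom a r -> ps_dom (fun n => a n.+1) r.
Proof.
move=> da rho rr; have [M HM] := da rho rr; have /andP[rho0 _] := rr.
exists (M / rho) => n; rewrite ler_pdivlMr// -mulrA -exprSr; exact: HM.
Qed.

Lemma geo_sum_le (t : R) N : 0 <= t < 1 -> \sum_(n < N) t ^+ n <= (1 - t)^-1.
Proof.
move=> /andP[t0 t1]; have h : 0 < 1 - t by rewrite subr_gt0.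
rewrite -[leRHS]mul1r ler_pdivlMr//.
have -> : (\sum_(n < N) t ^+ n) * (1 - t) = 1 - t ^+ N.
  elim: N => [|N ih]; first by rewrite big_ord0 mul0r expr0 subrr.
  by rewrite big_ord_recr/= mulrDl ih exprS; ring.
by rewrite gerBl exprn_ge0.
Qed.

Lemma ps_dom_sum a r rho : ps_dom a r -> 0 < rho < r ->
  exists2 B, 0 <= B & forall N, \sum_(n < N) `|a n| * rho ^+ n <= B.
Proof.
move=> da /andP[rho0 rhor]; pose sigma := (rho + r) / 2.
have s0 : 0 < sigma by rewrite /sigma; lra.
have rs : rho < sigma by rewrite /sigma; lra.
have [|M HM] := da sigma; first by rewrite /sigma; lra.
have M0 : 0 <= M by apply: le_trans (HM 0%N); rewrite expr0 mulr1.
have t01 : 0 <= rho / sigma < 1.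
  by rewrite divr_ge0 ?ltW//= ltr_pdivrMr// mul1r.
exists (M * (1 - rho / sigma)^-1) => [|N].
  by move: t01 => /andP[_ t1]; rewrite mulr_ge0// invr_ge0 subr_ge0 ltW.
apply: (@le_trans _ _ (\sum_(n < N) M * (rho / sigma) ^+ n)).
  apply: ler_sum => n _; rewrite exprMn exprVn mulrA ler_pdivlMr ?exprn_gt0//.
  by rewrite mulrAC ler_wpM2r ?exprn_ge0 ?(ltW rho0).
by rewrite -mulr_sumr ler_wpM2l// geo_sum_le.
Qed.

Lemma ps_dom_cvg a r q : ps_dom a r -> `|q| < r -> exists s : quat R, psum a q @ \oo --> s.
Proof.
move=> da qr; pose rho := (`|q| + r) / 2.
have q0 := normr_ge0 q.
have [|B B0 HB] := @ps_dom_sum a r rho da; first by rewrite /rho; lra.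
apply: (@qsum_exists R (fun n => q ^+ n * a n) B) => N; apply: le_trans (HB N).
apply: ler_sum => n _; rewrite qnormM qnormX mulrC ler_wpM2l// lerXn2r ?nnegrE//.
  by rewrite /rho; lra.
by rewrite /rho; lra.
Qed.

Definition psval a q : quat R := lim (psum a q @ \oo).

Lemma ps_on_psval a r : ps_dom a r -> ps_on (psval a) a r.
Proof.
move=> da q qr; have [s cs] := ps_dom_cvg da qr.
by rewrite /psval; apply: cvgP cs.
Qed.

(** The differential of q^n at q in the direction h. As h and q need not commute, it
    is the sum of the products q^i h q^(n-1-i), generated by the product rule. *)
Fixpoint dpow n q h : quat R :=
  if n is m.+1 then q * dpow m q h + h * q ^+ m else 0.

Lemma dpow_lin n q h : dpow n q h = qre h *: dpow n q 1 + qi h *: dpow n q (Quat 0 1 0 0)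
  + qj h *: dpow n q (Quat 0 0 1 0) + qk h *: dpow n q (Quat 0 0 0 1).
Proof.
elim: n => [|n ih] /=; first by rewrite !scaler0 !addr0.
rewrite ih !mulrDr -!scalerAr !scalerDr.
have -> : h * q ^+ n = qre h *: (1 * q ^+ n) + qi h *: (Quat 0 1 0 0 * q ^+ n)
  + qj h *: (Quat 0 0 1 0 * q ^+ n) + qk h *: (Quat 0 0 0 1 * q ^+ n).
  by move: (q ^+ n) => p; apply: quatP => /=; ring.
move: (q * dpow n q 1) (q * dpow n q (Quat 0 1 0 0))
  (q * dpow n q (Quat 0 0 1 0)) (q * dpow n q (Quat 0 0 0 1)) => A B C D.
move: (1 * q ^+ n) (Quat 0 1 0 0 * q ^+ n) (Quat 0 0 1 0 * q ^+ n) (Quat 0 0 0 1 * q ^+ n) => A' B' C' D'.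
by apply: quatP => /=; ring.
Qed.

Lemma dpow_le n q h rho : 0 < rho -> `|q| <= rho -> `|dpow n q h| * rho <= n%:R * rho ^+ n * `|h|.
Proof.
move=> rho0 qr; elim: n => [|n ih] /=; first by rewrite normr0 !mul0r.
apply: (@le_trans _ _ ((`|q| * `|dpow n q h| + `|h| * `|q| ^+ n) * rho)).
  by rewrite ler_wpM2r ?(ltW rho0)// (le_trans (ler_normD _ _))// !qnormM qnormX.
rewrite mulrDl -natr1 !mulrDl mul1r; apply: lerD.
  rewrite -mulrA exprS; have -> : n%:R * (rho * rho ^+ n) * `|h| = rho * (n%:R * rho ^+ n * `|h|) by ring.
  by apply: ler_pM => //; rewrite mulr_ge0// ltW.
rewrite exprSr -mulrA mulrC ler_wpM2r// ler_wpM2r ?(ltW rho0)//.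
by rewrite lerXn2r ?nnegrE ?(ltW rho0).
Qed.

Lemma powB_le n q h rho : 0 < rho -> `|q| <= rho -> `|q + h| <= rho ->
  `|(q + h) ^+ n - q ^+ n| * rho <= n%:R * rho ^+ n * `|h|.
Proof.
move=> rho0 qr qhr; elim: n => [|n ih]; first by rewrite !expr0 subrr normr0 !mul0r.
have -> : (q + h) ^+ n.+1 - q ^+ n.+1 = (q + h) * ((q + h) ^+ n - q ^+ n) + h * q ^+ n.
  by rewrite !exprS mulrBr (mulrDl q h (q ^+ n)) opprD addrA subrK.
apply: (@le_trans _ _ ((`|q + h| * `|(q + h) ^+ n - q ^+ n| + `|h| * `|q| ^+ n) * rho)).
  by rewrite ler_wpM2r ?(ltW rho0)// (le_trans (ler_normD _ _))// !qnormM qnormX.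
rewrite mulrDl -natr1 !mulrDl mul1r; apply: lerD.
  rewrite -mulrA exprS; have -> : n%:R * (rho * rho ^+ n) * `|h| = rho * (n%:R * rho ^+ n * `|h|) by ring.
  by apply: ler_pM => //; rewrite mulr_ge0// ltW.
rewrite exprSr -mulrA mulrC ler_wpM2r// ler_wpM2r ?(ltW rho0)//.
by rewrite lerXn2r ?nnegrE ?(ltW rho0).
Qed.

(** Quadratic remainder, by induction on n with constants that make the sum over n
    converge on every smaller ball. *)
Lemma pow_taylor n q h rho : 0 < rho -> `|q| <= rho -> `|q + h| <= rho ->
  `|(q + h) ^+ n - q ^+ n - dpow n q h| * rho ^+ 2 <= n%:R ^+ 2 * rho ^+ n * `|h| ^+ 2.
Proof.
move=> rho0 qr qhr; elim: n => [|n ih].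
  by rewrite !expr0 subrr /= subrr normr0 expr0n/= !mul0r.
have -> : (q + h) ^+ n.+1 - q ^+ n.+1 - dpow n.+1 q h =
   q * ((q + h) ^+ n - q ^+ n - dpow n q h) + h * ((q + h) ^+ n - q ^+ n).
  rewrite /= !exprS !mulrDl !mulrBr.
  move: (q * (q + h) ^+ n) (h * (q + h) ^+ n) (q * q ^+ n) (q * dpow n q h) (h * q ^+ n) => A B C D E.
  by apply: quatP => /=; ring.
apply: (@le_trans _ _ (`|q| * (`|(q + h) ^+ n - q ^+ n - dpow n q h| * rho ^+ 2) +
    `|h| * (`|(q + h) ^+ n - q ^+ n| * rho) * rho)).
  apply: (@le_trans _ _ ((`|q| * `|(q + h) ^+ n - q ^+ n - dpow n q h| +
      `|h| * `|(q + h) ^+ n - q ^+ n|) * rho ^+ 2)); last by rewrite le_eqVlt; apply/orP; left; apply/eqP; ring.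
  by rewrite ler_wpM2r ?exprn_ge0 ?(ltW rho0)// -!qnormM ler_normD.
apply: (@le_trans _ _ (rho * (n%:R ^+ 2 * rho ^+ n * `|h| ^+ 2) +
   `|h| * (n%:R * rho ^+ n * `|h|) * rho)).
  apply: lerD; first by apply: ler_pM => //; rewrite mulr_ge0// exprn_ge0// ltW.
  by rewrite ler_wpM2r ?(ltW rho0)// ler_wpM2l// powB_le.
have -> : rho * (n%:R ^+ 2 * rho ^+ n * `|h| ^+ 2) + `|h| * (n%:R * rho ^+ n * `|h|) * rho
  = (n%:R ^+ 2 + n%:R) * (rho ^+ n.+1 * `|h| ^+ 2) by rewrite [rho ^+ n.+1]exprS; ring.
rewrite -mulrA ler_wpM2r ?mulr_ge0 ?exprn_ge0 ?(ltW rho0)//.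
rewrite -natr1 sqrrD mulr1 expr1n -addrA lerD2l.
by have := ler0n R n; lra.
Qed.

(** An explicit real linear map, given by the images of the four basis quaternions,
    for which linearity and continuity are elementary. *)
Definition qlin (A B C D : quat R) (h : quat R) : quat R :=
  qre h *: A + qi h *: B + qj h *: C + qk h *: D.

Lemma qlin_linear A B C D : linear (qlin A B C D).
Proof.
move=> k x y; rewrite /qlin /= !scalerDl -!scalerA !scalerDr.
by rewrite !addrA; apply: quatP => /=; ring.
Qed.
HB.instance Definition _ A B C D := GRing.isLinear.Build R (quat R) (quat R) _ _ (@qlin_linear A B C D).

Lemma qlin_continuous A B C D : continuous (qlin A B C D).
Proof.
move=> x; have FF : Filter (nbhs x) by exact: nbhs_filter.
apply/(@cvgrPdist_le _ _ _ _ FF) => e e0.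
pose K := `|A| + `|B| + `|C| + `|D| + 1.
have K0 : 0 < K by rewrite ltr_wpDl// !addr_ge0.
near=> y.
have -> : qlin A B C D x - qlin A B C D y = qlin A B C D (x - y) by rewrite -linearB.
apply: (@le_trans _ _ (K * `|x - y|)).
  rewrite /qlin /K !mulrDl mul1r.
  apply: (le_trans (ler_normD _ _)); rewrite -[leLHS]addr0; apply: lerD => //.
  apply: (le_trans (lerD (ler_normD _ _) (lexx _))).
  apply: (le_trans (lerD (lerD (ler_normD _ _) (lexx _)) (lexx _))).
  rewrite !normrZ ![_ * `|x - y|]mulrC.
  by do 3! [apply: lerD; last by rewrite ler_wpM2r// ?qre_le ?qi_le ?qj_le ?qk_le]; rewrite ler_wpM2r// qre_le.
rewrite mulrC -ler_pdivlMr//; near: y.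
by apply: cvgr_dist_le; rewrite ?divr_gt0//; exact: cvg_id.
Unshelve. all: by end_near. Qed.

Section at_point.
Variables (f : quat R -> quat R) (a : nat -> quat R) (r : R) (q : quat R).
Hypotheses (fa : ps_on f a r) (qr : `|q| < r).
Let rho := (`|q| + r) / 2.
Let q0 := normr_ge0 q.
Let rho0 : 0 < rho. Proof. by rewrite /rho; move: qr q0; lra. Qed.
Let qrho : `|q| < rho. Proof. by rewrite /rho; move: qr; lra. Qed.
Let rhor : rho < r. Proof. by rewrite /rho; move: qr; lra. Qed.
Let rr : 0 < rho < r. Proof. by rewrite rho0. Qed.

Lemma dps_cvg h : exists s : quat R, (fun N => \sum_(n < N) dpow n q h * a n) @ \oo --> s.
Proof.
have [B B0 HB] := ps_dom_sum (ps_dom_mulr (ps_on_dom fa)) rr.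
apply: (@qsum_exists R (fun n => dpow n q h * a n) (B * `|h| / rho)) => N.
rewrite ler_pdivlMr//; apply: le_trans (ler_wpM2r (normr_ge0 h) (HB N)).
rewrite !mulr_suml; apply: ler_sum => n _; rewrite qnormM normrZ normr_nat.
have := dpow_le n h rho0 (ltW qrho) => H.
have -> : `|dpow n q h| * `|a n| * rho = `|a n| * (`|dpow n q h| * rho) by ring.
have -> : n%:R * `|a n| * rho ^+ n * `|h| = `|a n| * (n%:R * rho ^+ n * `|h|) by ring.
by rewrite ler_wpM2l.
Qed.

Let dval h : quat R := lim ((fun N => \sum_(n < N) dpow n q h * a n) @ \oo).
Let dvalP h : (fun N => \sum_(n < N) dpow n q h * a n) @ \oo --> dval h.
Proof. by have [s cs] := dps_cvg h; apply: cvgP cs. Qed.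

Let Lin := qlin (dval 1) (dval (Quat 0 1 0 0)) (dval (Quat 0 0 1 0)) (dval (Quat 0 0 0 1)).

Let dvalE h : dval h = Lin h.
Proof.
apply: (@qcvg_unique R _ _ _ (@dvalP h)).
have -> : (fun N => \sum_(n < N) dpow n q h * a n) = (fun N =>
   qre h *: (\sum_(n < N) dpow n q 1 * a n) + qi h *: (\sum_(n < N) dpow n q (Quat 0 1 0 0) * a n) +
   qj h *: (\sum_(n < N) dpow n q (Quat 0 0 1 0) * a n) + qk h *: (\sum_(n < N) dpow n q (Quat 0 0 0 1) * a n)).
  apply/funext => N; rewrite !scaler_sumr -!big_split/=; apply: eq_bigr => n _.
  by rewrite dpow_lin !mulrDl -!scalerAl.
rewrite /Lin /qlin.
by apply: cvgD; [apply: cvgD; [apply: cvgD|]|]; apply: cvgZl_tmp || apply: cvgZr; exact: dvalP.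
Qed.

(** Summing pow_taylor over n. *)
Let taylor : exists2 K, 0 <= K & forall h, `|q + h| <= rho -> `|f (q + h) - f q - Lin h| <= K * `|h| ^+ 2.
Proof.
have [B B0 HB] := ps_dom_sum (ps_dom_mulr (ps_dom_mulr (ps_on_dom fa))) rr.
exists (B / rho ^+ 2); first by rewrite divr_ge0// exprn_ge0// ltW.
move=> h qh; rewrite -dvalE.
have c1 := fa (le_lt_trans qh rhor); have c2 := fa qr.
have c3 : (psum a (q + h) N - psum a q N - \sum_(n < N) dpow n q h * a n) @[N --> \oo] -->
    f (q + h) - f q - dval h by apply: cvgB; [exact: cvgB|exact: dvalP].
apply: (cvg_norm_bound c3) => N.
rewrite /psum -!sumrB.
apply: (le_trans (ler_norm_sum _ _ _)).
rewrite mulrAC ler_pdivlMr ?exprn_gt0//.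
apply: le_trans (ler_wpM2r _ (HB N)); last exact: exprn_ge0.
rewrite !mulr_suml; apply: ler_sum => n _; rewrite !normrZ normr_nat.
rewrite -!mulrBl qnormM.
have := pow_taylor n rho0 (ltW qrho) qh => H.
have -> : `|(q + h) ^+ n - q ^+ n - dpow n q h| * `|a n| * rho ^+ 2 =
  `|a n| * (`|(q + h) ^+ n - q ^+ n - dpow n q h| * rho ^+ 2) by ring.
have -> : n%:R * (n%:R * `|a n|) * rho ^+ n * `|h| ^+ 2 =
  `|a n| * (n%:R ^+ 2 * rho ^+ n * `|h| ^+ 2) by ring.
by rewrite ler_wpM2l.
Qed.

Let expansion : f \o shift q = cst (f q) + Lin +o_ 0 id.
Proof.
apply/eqaddoP => e e0; have [K K0 HK] := taylor.
near=> h.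
have -> : (f \o shift q - (cst (f q) + Lin)) h = f (q + h) - f q - Lin h.
  by rewrite -[LHS]/(f (h + q) - (f q + Lin h)) opprD addrA (addrC h).
have hr : `|q + h| <= rho.
  apply: (le_trans (ler_normD _ _)); rewrite -lerBrDl; near: h.
  apply: (@nbhs0_le _ (quat R)); by rewrite subr_gt0.
apply: (le_trans (HK h hr)).
rewrite expr2 mulrA ler_wpM2r//.
have he : `|h| <= e / (K + 1).
  near: h; apply: (@nbhs0_le _ (quat R)); rewrite divr_gt0// ltr_wpDl//.
have K1 : 0 < K + 1 by rewrite ltr_wpDl.
move: he; rewrite ler_pdivlMr// => he.
apply: le_trans he; rewrite mulrC ler_wpM2l// lerDl//.
Unshelve. all: by end_near. Qed.

Let diffE : 'd f q = Lin :> (quat R -> quat R).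
Proof. by apply: diff_unique expansion; exact: qlin_continuous. Qed.

Lemma ps_differentiable : differentiable f q.
Proof.
apply/diff_locallyP; rewrite diffE; split; last exact: expansion.
exact: qlin_continuous.
Qed.

Lemma dpow_comm n h : h * q = q * h -> dpow n.+1 q h = n.+1%:R *: (h * q ^+ n).
Proof.
move=> hq; elim: n => [|n ih]; first by rewrite /= !expr0 mulr0 add0r scale1r.
rewrite /= in ih *; rewrite ih -scalerAr mulrA -hq -mulrA -exprS.
by rewrite -[in RHS]natr1 scalerDl scale1r.
Qed.

(** When the direction commutes with q, the terms of dpow collapse to n h q^(n-1)
    and the termwise derivative appears. Within a slice this covers the directions 1
    and J. *)
Lemma ps_derive h (f1 : quat R -> quat R) :
  ps_on f1 (fun n => n.+1%:R *: a n.+1) r -> h * q = q * h -> 'd f q h = h * f1 q.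
Proof.
move=> f1a hq; rewrite diffE -dvalE.
have c1 := @cvg_qmull R _ _ h (f1a _ qr).
have c2 : (fun N => \sum_(n < N.+1) dpow n q h * a n) @ \oo --> dval h.
  by have := @dvalP h; rewrite -(cvg_shiftS (fun N => \sum_(n < N) dpow n q h * a n)).
apply: (@qcvg_unique R _ _ _ c2); move: c1.
suff -> : (fun N => h * psum (fun n => n.+1%:R *: a n.+1) q N) =
  (fun N => \sum_(n < N.+1) dpow n q h * a n) by [].
apply/funext => N.
rewrite big_ord_recl/= mul0r add0r /psum mulr_sumr; apply: eq_bigr => n _.
rewrite /bump/= add1n -[q * _ + _]/(dpow n.+1 q h) dpow_comm//.
by rewrite -scalerAr -scalerAr -scalerAl mulrA.
Qed.

End at_point.

(** This makes the partial derivatives in a slice accessible through the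
    differential of f. *)
Lemma dslice_xE f (J : quat R) z : dslice_x f J z = 'D_1 f (slice_pt J z).
Proof.
rewrite /dslice_x /derive1 /derive.
suff -> : (fun h : R => h^-1 *: (f (slice_pt J (h + z.1, z.2)) - f (slice_pt J (z.1, z.2)))) =
  (fun h : R => h^-1 *: ((f \o shift (slice_pt J z)) (h *: 1) - f (slice_pt J z))) by [].
by case: z => x y; apply/funext => h /=; rewrite /slice_pt/= scalerDl addrA.
Qed.

Lemma dslice_yE f (J : quat R) z : dslice_y f J z = 'D_J f (slice_pt J z).
Proof.
rewrite /dslice_y /derive1 /derive.
suff -> : (fun h : R => h^-1 *: (f (slice_pt J (z.1, h + z.2)) - f (slice_pt J (z.1, z.2)))) =
  (fun h : R => h^-1 *: ((f \o shift (slice_pt J z)) (h *: J) - f (slice_pt J z))) by [].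
by case: z => x y; apply/funext => h /=; rewrite /slice_pt/= scalerDl addrCA.
Qed.

Lemma derivable_slice_x f (J : quat R) z : derivable f (slice_pt J z) 1 ->
  derivable (fun x : R => f (slice_pt J (x, z.2))) z.1 1.
Proof.
rewrite /derivable.
suff -> : (fun h : R => h^-1 *: (((fun x : R => f (slice_pt J (x, z.2))) \o shift z.1) (h *: 1) - f (slice_pt J (z.1, z.2)))) =
  (fun h : R => h^-1 *: ((f \o shift (slice_pt J z)) (h *: 1) - f (slice_pt J z))) by [].
case: z => x y; apply/funext => h /=; rewrite /slice_pt/= scalerDl addrA.
by rewrite /GRing.scale/= mulr1.
Qed.

Lemma derivable_slice_y f (J : quat R) z : derivable f (slice_pt J z) J ->
  derivable (fun y : R => f (slice_pt J (z.1, y))) z.2 1.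
Proof.
rewrite /derivable.
suff -> : (fun h : R => h^-1 *: (((fun y : R => f (slice_pt J (z.1, y))) \o shift z.2) (h *: 1) - f (slice_pt J (z.1, z.2)))) =
  (fun h : R => h^-1 *: ((f \o shift (slice_pt J z)) (h *: J) - f (slice_pt J z))) by [].
case: z => x y; apply/funext => h /=; rewrite /slice_pt/= scalerDl addrCA.
by rewrite /GRing.scale/= mulr1.
Qed.

Lemma slice_pt_continuous (J : quat R) : continuous (slice_pt J : R * R -> quat R).
Proof.
move=> z; apply: (@cvgD _ (quat R) _ _ _ (fun z : R * R => z.1%:A) (fun z : R * R => z.2 *: J)).
  apply: cvgZr_tmp; exact: cvg_fst.
apply: cvgZr_tmp; exact: cvg_snd.
Qed.

Lemma qmull_continuous q : continuous (fun p => q * p).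
Proof.
have -> : (fun p => q * p) = qlin q (q * Quat 0 1 0 0) (q * Quat 0 0 1 0) (q * Quat 0 0 0 1).
  by apply/funext => p; apply: quatP => /=; ring.
exact: qlin_continuous.
Qed.

Lemma slice_ball_near r (J : quat R) z : `|slice_pt J z| < r ->
  \forall z' \near (z : R * R), `|slice_pt J z'| < r.
Proof. move=> zr; have H : `|slice_pt J z'| @[z' --> z] --> `|slice_pt J z|.
  by apply: cvg_norm; exact: slice_pt_continuous.
by apply: cvgr_lt H _ zr. Qed.

(** The derivative along J is J times the derivative along 1, and both are
    continuous because the derived series is again a power series on the ball. *)
Lemma ps_slice_regular f a r : ps_on f a r -> slice_regular r f.
Proof.
move=> fa; split; first by move=> q qr; exact: ps_differentiable fa qr.
move=> J SJ z zr; have df := ps_differentiable fa zr.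
pose f1 := psval (fun n => n.+1%:R *: a n.+1).
have f1a : ps_on f1 (fun n => n.+1%:R *: a n.+1) r.
  exact/ps_on_psval/(ps_dom_shift (ps_dom_mulr (ps_on_dom fa))).
have Ex z' : `|slice_pt J z'| < r -> dslice_x f J z' = f1 (slice_pt J z').
  move=> h; rewrite dslice_xE deriveE; last exact: ps_differentiable fa h.
  by rewrite (ps_derive fa h f1a) ?mul1r ?mulr1.
have Ey z' : `|slice_pt J z'| < r -> dslice_y f J z' = J * f1 (slice_pt J z').
  move=> h; rewrite dslice_yE deriveE; last exact: ps_differentiable fa h.
  by rewrite (ps_derive fa h f1a)// slice_pt_comm.
have f1c : (f1 (slice_pt J z')) @[z' --> z] --> f1 (slice_pt J z).
  apply: (@continuous_comp _ _ _ (slice_pt J) f1); first exact: slice_pt_continuous.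
  exact: differentiable_continuous (ps_differentiable f1a zr).
split.
- exact/derivable_slice_x/diff_derivable.
- exact/derivable_slice_y/diff_derivable.
- rewrite /prop_for/continuous_at Ex//.
  apply: cvg_trans f1c; apply: near_eq_cvg; near=> z'; rewrite Ex//.
  by near: z'; exact: slice_ball_near.
- rewrite /prop_for/continuous_at Ey//.
  have : (J * f1 (slice_pt J z')) @[z' --> z] --> J * f1 (slice_pt J z).
    by apply: cvg_comp f1c _; exact: qmull_continuous.
  apply: cvg_trans; apply: near_eq_cvg; near=> z'; rewrite Ey//.
  by near: z'; exact: slice_ball_near.
- by rewrite Ex// Ey// mulrA usphere_sqr// mulN1r subrr.
Unshelve. all: by end_near. Qed.

Lemma ps_onB f g a b r : ps_on f a r -> ps_on g b r ->
  ps_on (fun q => f q - g q) (fun n => a n - b n) r.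
Proof.
move=> fa gb q qr.
have : (psum a q \- psum b q) @ \oo --> f q - g q by exact: cvgB (fa q qr) (gb q qr).
suff -> : psum (fun n => a n - b n) q = psum a q \- psum b q by [].
apply/funext => N; rewrite /psum/= -sumrB; apply: eq_bigr => n _; exact: mulrBr.
Qed.

(** The first nonzero coefficient would dominate the rest of the series at small
    positive reals. *)
Lemma ps_zero f c r : 0 < r -> ps_on f c r -> (forall x, 0 < x < r -> f x%:A = 0) ->
  forall n, c n = 0.
Proof.
move=> r0 fc f0; elim/ltn_ind => n ih; apply/eqP; rewrite -normr_eq0 eq_le normr_ge0 andbT.
have rr : 0 < r / 2 < r by lra.
have [B B0 HB] := ps_dom_sum (ps_on_dom fc) rr.
set rho := r / 2 in rr HB; have /andP[rho0 rhor] := rr.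
have key x : 0 < x -> x < rho -> `|c n| <= x * (B / rho ^+ n.+1).
  move=> x0 xrho; have xr : `|x%:A : quat R| < r by rewrite qnorm_real gtr0_norm//; lra.
  have := fc _ xr; rewrite f0; last by lra.
  rewrite -(cvg_shiftn n.+1) => S.
  have S1 : (psum c x%:A (N + n.+1)%N - x%:A ^+ n * c n) @[N --> \oo] --> 0 - x%:A ^+ n * c n.
    by apply: cvgB S _; exact: cvg_cst.
  have := @cvg_norm_bound R _ _ ((x / rho) ^+ n.+1 * B) S1.
  rewrite sub0r normrN qnormM qnormX qnorm_real (gtr0_norm x0) => H.
  rewrite -(@ler_pM2l _ (x ^+ n)) ?exprn_gt0//.
  have -> : x ^+ n * (x * (B / rho ^+ n.+1)) = (x / rho) ^+ n.+1 * B.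
    by rewrite [(x / rho) ^+ _]exprMn exprVn (exprS x n); ring.
  apply: H => N; have hn : (n < N + n.+1)%N by rewrite addnS ltnS leq_addl.
  rewrite /psum (bigD1 (Ordinal hn))//= addrAC subrr add0r.
  apply: le_trans (ler_wpM2l _ (HB (N + n.+1)%N)); last by rewrite exprn_ge0// divr_ge0// ltW.
  rewrite mulr_sumr; apply: le_trans (ler_norm_sum _ _ _) _.
  rewrite [leRHS](bigD1 (Ordinal hn))//= -[leLHS]add0r; apply: lerD.
    by rewrite mulr_ge0// ?exprn_ge0// ?divr_ge0 ?mulr_ge0 ?exprn_ge0// ltW.
  apply: ler_sum => k kn; rewrite qnormM qnormX qnorm_real (gtr0_norm x0).
  have [/ih ->|] := ltnP k n; first by rewrite normr0 mulr0 mul0r mulr0.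
  rewrite leq_eqVlt => /orP[nk|nk]; first by move: kn; rewrite -val_eqE/= eq_sym nk.
  have -> : x ^+ k * `|c k| = (x / rho) ^+ k * (`|c k| * rho ^+ k).
    by rewrite exprMn exprVn mulrCA -!mulrA mulVf ?mulr1 1?mulrC// expf_neq0// gt_eqF.
  rewrite ler_wpM2r ?mulr_ge0 ?exprn_ge0 ?(ltW rho0)//.
  apply: ler_wiXn2l => //; rewrite ?divr_ge0 ?ltW//.
  by rewrite ltr_pdivrMr// mul1r.
rewrite leNgt; apply/negP => cn; pose K := B / rho ^+ n.+1.
have K0 : 0 <= K by rewrite divr_ge0// exprn_ge0// ltW.
have K1 : 0 < K + 1 by rewrite ltr_wpDl.
pose x := Num.min (rho / 2) (`|c n| / 2 / (K + 1)).
have x0 : 0 < x by rewrite lt_min !divr_gt0.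
have xr : x < rho by rewrite gt_min; apply/orP; left; lra.
have := key x x0 xr; rewrite -/K => H.
have : x * (K + 1) <= `|c n| / 2 by rewrite -ler_pdivlMr// ge_min lexx orbT.
by rewrite mulrDr mulr1 => H2; have := x0; lra.
Qed.

Lemma ps_unique f g a b r : 0 < r -> ps_on f a r -> ps_on g b r ->
  (forall x, 0 < x < r -> f x%:A = g x%:A) -> forall n, a n = b n.
Proof.
move=> r0 fa gb fg n; apply/eqP; rewrite -subr_eq0; apply/eqP.
by apply: (ps_zero r0 (ps_onB fa gb)) => x /fg ->; rewrite subrr.
Qed.
End power_series.

(** * The Cauchy formula and the power series of a slice regular function *)

Section quat_continuity.
Context {R : realType}.
Implicit Types (p q c : quat R) (J : quat R).

Lemma lip_continuous (f : quat R -> R) : (forall x y, `|f x - f y| <= `|x - y|) -> continuous f.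
Proof.
move=> fl x; have FF : Filter (nbhs x) by exact: nbhs_filter.
apply/(@cvgrPdist_le _ _ _ _ FF) => e e0; near=> y.
apply: (le_trans (fl x y)); near: y.
by apply: cvgr_dist_le => //; exact: cvg_id.
Unshelve. all: by end_near. Qed.

Lemma qre_continuous : continuous (@qre R).
Proof. by apply: lip_continuous => x y; exact: (qre_le (x - y)). Qed.
Lemma qi_continuous : continuous (@qi R).
Proof. by apply: lip_continuous => x y; exact: (qi_le (x - y)). Qed.
Lemma qj_continuous : continuous (@qj R).
Proof. by apply: lip_continuous => x y; exact: (qj_le (x - y)). Qed.
Lemma qk_continuous : continuous (@qk R).
Proof. by apply: lip_continuous => x y; exact: (qk_le (x - y)). Qed.

Lemma qmul_cvg (T : Type) (F : set_system T) (FF : Filter F) (u v : T -> quat R) p q :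
  u @ F --> p -> v @ F --> q -> (fun t => u t * v t) @ F --> p * q.
Proof.
move=> cu cv.
have E (a b : quat R) : a * b = qre a *: b + qi a *: (Quat 0 1 0 0 * b)
  + qj a *: (Quat 0 0 1 0 * b) + qk a *: (Quat 0 0 0 1 * b) by apply: quatP => /=; ring.
rewrite E; under eq_fun do rewrite E.
have H (s : quat R -> R) c : continuous s -> (s (u t) *: (c * v t)) @[t --> F] --> s p *: (c * q).
  move=> cs; apply: cvgZ; first by apply: cvg_comp cu _; exact: cs.
  by apply: (@cvg_comp _ _ _ v (fun q => c * q) _ _ _ cv); exact: qmull_continuous.
apply: cvgD; [apply: cvgD; [apply: cvgD => //|]|].
- by apply: cvgZ => //; apply: cvg_comp cu _; exact: qre_continuous.
- by apply: H; exact: qi_continuous.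
- by apply: H; exact: qj_continuous.
- by apply: H; exact: qk_continuous.
Qed.

Lemma slice_cvg (T : Type) (F : set_system T) (FF : Filter F) J (a b : T -> R) x y :
  a @ F --> x -> b @ F --> y -> (fun t => slice_pt J (a t, b t)) @ F --> slice_pt J (x, y).
Proof.
move=> ca cb; apply: (@cvgD _ (quat R) _ _ _ (fun t => (a t)%:A) (fun t => b t *: J)).
  by apply: cvgZr_tmp.
by apply: cvgZr_tmp.
Qed.

Lemma pair_cvg (T : Type) (F : set_system T) (FF : Filter F) (a b : T -> R) (x y : R) :
  a @ F --> x -> b @ F --> y -> (fun t => (a t, b t) : R * R) @ F --> ((x, y) : R * R).
Proof.
move=> ca cb A [[P Q] [/= Px Qy] PQA].
have hP : F (a @^-1` P) := ca P Px.
have hQ : F (b @^-1` Q) := cb Q Qy.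
have hPQ := @filterI _ F FF _ _ hP hQ.
by apply: (@filterS _ F FF _ _ _ hPQ) => t [h1 h2]; apply: PQA.
Qed.

Lemma qre_cvg (T : Type) (F : set_system T) (u : T -> quat R) p :
  u @ F --> p -> (fun t => qre (u t)) @ F --> qre p.
Proof. by move=> cu; apply: cvg_comp cu _; exact: qre_continuous. Qed.

Lemma qreC p q : qre (p * q) = qre (q * p).
Proof. by move=> /=; ring. Qed.

Lemma qre_test p q : (forall c, qre (c * p) = qre (c * q)) -> p = q.
Proof.
move=> H; apply: quatP.
- by have := H 1; rewrite !mul1r.
- by have := H (Quat 0 (-1) 0 0) => /=; lra.
- by have := H (Quat 0 0 (-1) 0) => /=; lra.
- by have := H (Quat 0 0 0 (-1)) => /=; lra.
Qed.

Lemma cvg_test (u : nat -> quat R) (s : quat R) :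
  (forall c, qre (c * u n) @[n --> \oo] --> qre (c * s)) -> u @ \oo --> s.
Proof.
move=> H.
have E c (l : quat R -> R) : (forall q, qre (c * q) = l q) -> l (u n) @[n --> \oo] --> l s.
  by move=> e; rewrite -e; under eq_fun do rewrite -e; exact: H.
apply: cvg_quat.
- by apply: (E 1) => q; rewrite mul1r.
- by apply: (E (Quat 0 (-1) 0 0)) => q /=; ring.
- by apply: (E (Quat 0 0 (-1) 0)) => q /=; ring.
- by apply: (E (Quat 0 0 0 (-1))) => q /=; ring.
Qed.

(** The exponential of J t. *)
Definition cisq J (t : R) : quat R := slice_pt J (cos t, sin t).

Lemma cisqD J s t : usphere J -> cisq J (s + t) = cisq J s * cisq J t.
Proof.
move=> SJ; rewrite /cisq slice_ptM//= cosD sinD; congr (slice_pt J (_, _)); ring.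
Qed.

Lemma cisq0 J : cisq J 0 = 1.
Proof. by rewrite /cisq cos0 sin0 slice_pt1. Qed.

Lemma cisqX J n t : usphere J -> cisq J t ^+ n = cisq J (n%:R * t).
Proof.
move=> SJ; elim: n => [|n ih]; first by rewrite expr0 mul0r cisq0.
by rewrite exprS ih -cisqD// -natr1 mulrDl mul1r addrC.
Qed.

Lemma cisq_norm J t : usphere J -> `|cisq J t| = 1.
Proof. by move=> SJ; rewrite /cisq norm_slice//= cos2Dsin2 sqrtr1. Qed.

Lemma cisq_cts J : continuous (cisq J).
Proof. by move=> t; apply: slice_cvg; [exact: continuous_cos|exact: continuous_sin]. Qed.

End quat_continuity.

Section circle_integral.
Context {R : realType}.
Implicit Types (f : R -> R) (F : R -> quat R).
Notation mu := (@lebesgue_measure R).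
Notation C := (`[0, 2 * pi]%classic : set (measurableTypeR R)).

Let pi2 : 0 < 2 * pi :> R. Proof. by rewrite mulr_gt0// pi_gt0. Qed.
Let mC : measurable C. Proof. exact: measurable_itv. Qed.

Lemma circ_integrable f : continuous f -> mu.-integrable C (EFin \o f).
Proof.
move=> cf; apply: continuous_compact_integrable; first exact: segment_compact.
exact: continuous_subspaceT.
Qed.

Lemma circ_FTC (f F : R -> R) : (forall x : R, is_derive x 1 F (f x)) -> continuous f ->
  \int[mu]_(x in C) f x = F (2 * pi) - F 0.
Proof.
move=> dF cf; apply: (@FTC_open R (fun=> 0) (fun=> 2 * pi) C f F) => //.
- by move=> _; exact: subset_refl.
- by move=> x Cx; exact: nearW.
- by move=> x _; exact: cf.
- exact: circ_integrable.
- exact: cvg_cst.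
- exact: cvg_cst.
Qed.

Lemma circ_cst (k : R) : \int[mu]_(x in C) k = 2 * pi * k.
Proof.
have H : \int[mu]_(x in C) k = 2 * pi * k - 0 * k; last by rewrite H mul0r subr0.
apply: (@circ_FTC (fun=> k) (fun x => x * k)) => x; first exact: der_scale.
exact: cvg_cst.
Qed.

Lemma circ_bound f (M : R) : continuous f -> (forall x, C x -> `|f x| <= M) ->
  `|\int[mu]_(x in C) f x| <= 2 * pi * M.
Proof.
move=> cf fM; rewrite -circ_cst.
have i1 := circ_integrable cf.
apply: (le_trans (le_normr_Rintegral mC i1)).
apply: le_Rintegral => //.
- by apply: circ_integrable => x; apply: continuous_comp; [exact: cf|exact: norm_continuous].
- by apply: circ_integrable => x; exact: cvg_cst.
Qed.

Lemma circ_bounded f : continuous f -> exists M, forall x, C x -> `|f x| <= M.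
Proof.
move=> cf; have [|c _ Hc] := @EVT_max R (fun x => `|f x|) 0 (2 * pi) (ltW pi2).
  by apply: continuous_subspaceT => x; apply: continuous_comp; [exact: cf|exact: norm_continuous].
by exists `|f c| => x Cx; apply: Hc; rewrite inE in Cx *.
Qed.

Lemma qre_qint (c : quat R) F : continuous F ->
  qre (c * qintegral mu C F) = \int[mu]_(x in C) qre (c * F x).
Proof.
move=> cF; apply: qre_qintegral => //; apply: functional_qintegrable => p.
by apply: circ_integrable => x; apply: qre_cvg; apply: qmul_cvg; [exact: cvg_cst|exact: cF].
Qed.

End circle_integral.

Section slice_derivative.
Context {R : realType}.

Lemma is_derive_of_cvg (V : normedModType R) (f : R -> V) (s : R) (l : V) :
  (h^-1 *: (f (h + s) - f s)) @[h --> 0^'] --> l -> is_derive s 1 f l.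
Proof.
move=> H.
have {}H : (h^-1 *: ((f \o shift s) (h *: 1) - f s)) @[h --> 0^'] --> l.
  suff -> : (fun h : R => h^-1 *: ((f \o shift s) (h *: 1) - f s)) = (fun h => h^-1 *: (f (h + s) - f s)) by [].
  by apply/funext => h /=; rewrite /GRing.scale/= mulr1.
by split; [exact: cvgP H|exact: cvg_lim H].
Qed.

Lemma cvg_of_is_derive (V : normedModType R) (f : R -> V) (s : R) (l : V) :
  is_derive s 1 f l -> (h^-1 *: (f (h + s) - f s)) @[h --> 0^'] --> l.
Proof.
move=> [df <-]; move: df; rewrite /derivable /derive.
suff -> : (fun h : R => h^-1 *: ((f \o shift s) (h *: 1) - f s)) = (fun h => h^-1 *: (f (h + s) - f s)) by [].
by apply/funext => h /=; rewrite /GRing.scale/= mulr1.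
Qed.

(** The chain rule along a curve contained in a slice, tested against a real
    functional. *)
Lemma der_slice (g : quat R -> quat R) J (x y : R -> R) (x' y' s : R) p :
  differentiable g (slice_pt J (x s, y s)) -> is_derive s 1 x x' -> is_derive s 1 y y' ->
  is_derive s 1 (fun s => qre (p * g (slice_pt J (x s, y s))))
    (qre (p * 'd g (slice_pt J (x s, y s)) (slice_pt J (x', y')))).
Proof.
move=> dg dx dy; pose h s := slice_pt J (x s, y s).
have dh : is_derive s 1 h (slice_pt J (x', y')).
  apply: is_derive_of_cvg.
  have H : slice_pt J (h^-1 *: (x (h + s) - x s), h^-1 *: (y (h + s) - y s)) @[h --> 0^'] --> slice_pt J (x', y').
    by apply: slice_cvg; exact: cvg_of_is_derive.
  apply: cvg_trans H.
  apply: near_eq_cvg; near=> k; rewrite /h slice_ptB slice_ptZ//.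
have dfh : differentiable h s by case: dh => H _; apply/derivable1_diffP.
have dgh : is_derive s 1 (g \o h) ('d g (h s) (slice_pt J (x', y'))).
  have D : differentiable (g \o h) s by exact: differentiable_comp.
  split; first exact/derivable1_diffP.
  rewrite deriveE// diff_comp//=; congr ('d g _ _); rewrite -deriveE//; by case: dh.
apply: is_derive_of_cvg.
have := cvg_of_is_derive dgh => H.
have {}H : qre (p * (k^-1 *: ((g \o h) (k + s) - (g \o h) s))) @[k --> 0^'] --> qre (p * 'd g (h s) (slice_pt J (x', y'))).
  by apply: qre_cvg; apply: qmul_cvg => //; exact: cvg_cst.
apply: cvg_trans H; apply: near_eq_cvg; near=> k.
have E (a : R) (A B : quat R) : qre (p * (a *: (A - B))) = a * (qre (p * A) - qre (p * B)).
  by move=> /=; ring.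
exact: E.
Unshelve. all: by end_near. Qed.

End slice_derivative.

Section cauchy.
Context {R : realType}.
Variables (J : quat R) (z0 : R * R) (rho : R).
Hypotheses (SJ : usphere J) (rho0 : 0 < rho) (z0rho : `|slice_pt J z0| < rho).
Notation mu := (@lebesgue_measure R).
Notation C := (`[0, 2 * pi]%classic : set (measurableTypeR R)).
Notation zeta := (slice_pt J z0).
Implicit Types (F : R -> quat R) (t : R).

Let e t := cisq J t.
(* u t is zeta e^(-J t) / rho, and ker t is the inverse of 1 - u t, that is the
   Cauchy kernel zeta' / (zeta' - zeta) at zeta' = rho e^(J t). *)
Let ux t := (z0.1 * cos t + z0.2 * sin t) / rho.
Let uy t := (z0.2 * cos t - z0.1 * sin t) / rho.
Let u t := slice_pt J (ux t, uy t).
Let den t := (1 - ux t) ^+ 2 + uy t ^+ 2.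
Let ker t := slice_pt J ((1 - ux t) / den t, uy t / den t).
Let s := `|zeta| / rho.

Let s01 : 0 <= s < 1.
Proof. by rewrite /s divr_ge0 ?(ltW rho0)//= ltr_pdivrMr// mul1r. Qed.

Let uE t : u t = rho^-1 *: (zeta * e (- t)).
Proof.
rewrite /u /e /cisq slice_ptM//= slice_ptZ/= cosN sinN /ux /uy.
by congr (slice_pt J (_, _)); ring.
Qed.

Let u_norm t : `|u t| = s.
Proof.
by rewrite uE normrZ qnormM cisq_norm// mulr1 gtr0_norm ?invr_gt0// mulrC.
Qed.

Let uX n t : u t ^+ n = zeta ^+ n * (rho^-1 ^+ n *: e (- t) ^+ n).
Proof.
have c : zeta * e (- t) = e (- t) * zeta by exact: slice_ptC.
rewrite uE exprZn exprMn_comm; last exact: c.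
by rewrite scalerAr.
Qed.

Let mC : measurable C. Proof. exact: measurable_itv. Qed.

Let den_gt0 t : 0 < den t.
Proof.
rewrite /den lt_neqAle eq_sym addr_ge0 ?sqr_ge0// andbT.
rewrite paddr_eq0 ?sqr_ge0// !sqrf_eq0; apply/negP => /andP[/eqP h1 /eqP h2].
have := u_norm t; have e1 : ux t = 1 by move: h1; lra.
rewrite /u e1 h2 slice_pt1 qnorm1 => h; move: s01; rewrite -h ltxx andbF.
by [].
Qed.

Let ker_mul t : ker t * (1 - u t) = 1.
Proof.
have d := lt0r_neq0 (den_gt0 t).
rewrite -(slice_pt1 J) /u slice_ptB/= /ker slice_ptM//=.
by rewrite /den in d; congr (slice_pt J (_, _)); rewrite /den; field.
Qed.

Let ux_cts : continuous ux.
Proof.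
move=> t; apply: (der_continuous (der_mul (der_add (der_mul (der_cst z0.1 t) (der_cos (der_id t)))
  (der_mul (der_cst z0.2 t) (der_sin (der_id t)))) (der_cst rho^-1 t))).
Qed.
Let uy_cts : continuous uy.
Proof.
move=> t; apply: (der_continuous (der_mul (der_sub (der_mul (der_cst z0.2 t) (der_cos (der_id t)))
  (der_mul (der_cst z0.1 t) (der_sin (der_id t)))) (der_cst rho^-1 t))).
Qed.
Let den_cts : continuous den.
Proof.
move=> t; apply: cvgD.
  by apply: cvgM; apply: cvgB; do ?[exact: cvg_cst]; exact: ux_cts.
by apply: cvgM; exact: uy_cts.
Qed.
Let deni_cts : continuous (fun t => (den t)^-1).
Proof. by move=> t; apply: cvgV; [exact: lt0r_neq0|exact: den_cts]. Qed.
Let ker_cts : continuous ker.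
Proof.
move=> t; apply: slice_cvg; apply: cvgM; do ?[exact: deni_cts]; last exact: uy_cts.
by apply: cvgB; [exact: cvg_cst|exact: ux_cts].
Qed.
Let eN_cts n : continuous (fun t => e (- t) ^+ n).
Proof.
have -> : (fun t => e (- t) ^+ n) = (fun t => slice_pt J (cos (n%:R * - t), sin (n%:R * - t))).
  by apply/funext => t; rewrite cisqX.
have d t : is_derive t 1 (fun t => n%:R * - t : R) (- n%:R).
  by apply: (der_eq (der_mul (der_cst n%:R t) (der_opp (der_id t)))); ring.
move=> t; apply: slice_cvg.
  exact: (der_continuous (der_cos (d t))).
exact: (der_continuous (der_sin (d t))).
Qed.

(** When F is the restriction of g to the circle of radius rho, this is 2 pi times
    the n-th Taylor coefficient of g at 0. *)
Definition circ_coef F n : quat R := qintegral mu C (fun t => (rho^-1 ^+ n *: e (- t) ^+ n) * F t).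

Let geo N t : ker t - \sum_(n < N) u t ^+ n = u t ^+ N * ker t.
Proof.
have kc : ker t * u t = u t * ker t by exact: slice_ptC.
have kx n : ker t * u t ^+ n = u t ^+ n * ker t.
  elim: n => [|n ih]; first by rewrite expr0 mul1r mulr1.
  by rewrite exprS mulrA kc -mulrA ih mulrA.
elim: N => [|N ih]; first by rewrite big_ord0 subr0 expr0 mul1r.
rewrite big_ord_recr/= opprD addrA ih exprS -kx.
rewrite -[X in _ - X]mul1r -(ker_mul t) -mulrA mulrBl mul1r mulrBr opprB.
by rewrite addrCA subrr addr0 -exprS kx exprS.
Qed.

Let term_cts n F : continuous F -> continuous (fun t => (rho^-1 ^+ n *: e (- t) ^+ n) * F t).
Proof.
move=> cF t; apply: qmul_cvg; last exact: cF.
by apply: cvgZl_tmp; exact: eN_cts.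
Qed.

(** The geometric series of the Cauchy kernel converges uniformly on the circle,
    with remainder u^N ker. *)
Lemma kernel_expand F : continuous F ->
  psum (circ_coef F) zeta @ \oo --> qintegral mu C (fun t => ker t * F t).
Proof.
move=> cF; apply: cvg_test => c.
have kF : continuous (fun t => ker t * F t) by move=> t; apply: qmul_cvg; [exact: ker_cts|exact: cF].
have cc : continuous (fun _ : R => c) by move=> t; exact: cvg_cst.
have ckF : continuous (fun t => qre (c * (ker t * F t))).
  by move=> t; apply: qre_cvg; apply: qmul_cvg; [exact: cc|exact: kF].
have tc n : continuous (fun t => qre (c * (u t ^+ n * F t))).
  have -> : (fun t => qre (c * (u t ^+ n * F t))) =
     (fun t => qre ((c * zeta ^+ n) * ((rho^-1 ^+ n *: e (- t) ^+ n) * F t))).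
    by apply/funext => t; rewrite uX !mulrA.
  by move=> t; apply: qre_cvg; apply: qmul_cvg; [exact: cvg_cst|exact: term_cts].
rewrite qre_qint//.
have [M HM] : exists M, forall t, C t -> `|ker t * F t| <= M.
  have [M HM] := @circ_bounded _ (fun t => `|ker t * F t|)
    (fun t => continuous_comp (kF t) (@norm_continuous _ (quat R) _)).
  by exists M => t /HM; rewrite normr_id.
have PE N : qre (c * psum (circ_coef F) zeta N) =
    \int[mu]_(t in C) (\sum_(n < N) qre (c * (u t ^+ n * F t))).
  rewrite (@Rintegral_sum _ _ _ _ _ mC N (fun n t => qre (c * (u t ^+ n * F t)))); last by move=> n; exact: circ_integrable.
  rewrite /psum mulr_sumr; case: (q_sum_comp N (fun n => c * (zeta ^+ n * circ_coef F n))) => -> _ _ _.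
  apply: eq_bigr => n _; rewrite mulrA qre_qint; last exact: term_cts.
  by apply: eq_Rintegral => t _; rewrite uX !mulrA.
have sc N : continuous (fun t => \sum_(n < N) qre (c * (u t ^+ n * F t))).
  elim: N => [|N ih]; first by under eq_fun do rewrite big_ord0; move=> t; exact: cvg_cst.
  under eq_fun do rewrite big_ord_recr/=.
  by move=> t; apply: cvgD; [exact: ih|exact: tc].
apply: (@cvg_dist0 R R^o _ (fun N => s ^+ N * (2 * pi * (`|c| * M)))) => [N|].
  rewrite PE -RintegralB//; try exact: circ_integrable.
  rewrite mulrCA; apply: circ_bound.
    by move=> t; apply: cvgB; [exact: ckF|exact: sc].
  move=> t Ct.
  have -> : qre (c * (ker t * F t)) - \sum_(n < N) qre (c * (u t ^+ n * F t)) =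
     qre (c * (u t ^+ N * (ker t * F t))).
    have [<- _ _ _] := q_sum_comp N (fun n => c * (u t ^+ n * F t)).
    rewrite -[LHS]/(qre (_ - _)) -mulr_sumr -mulr_suml -mulrBr -mulrBl geo.
    by rewrite !mulrA.
  apply: (le_trans (qre_le _)); rewrite qnormM qnormM qnormX u_norm.
  rewrite mulrCA ler_wpM2l//; first by move: s01 => /andP[s0 _]; rewrite exprn_ge0.
  by rewrite ler_wpM2l// HM.
rewrite -(mul0r (2 * pi * (`|c| * M))); apply: cvgMr_tmp; apply: cvg_expr.
by move: s01 => /andP[s0 s1]; rewrite ger0_norm.
Qed.

(** The expansion above for the constant function 1: only the coefficient of order 0
    is nonzero. *)
Lemma ker_int : qintegral mu C ker = (2 * pi)%:A.
Proof.
have c1 : continuous (fun _ : R => 1 : quat R) by move=> t; exact: cvg_cst.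
have H := kernel_expand c1.
have E0 : circ_coef (fun=> 1) 0 = (2 * pi)%:A.
  apply: qre_test => c; rewrite qre_qint; last exact: term_cts.
  under eq_Rintegral do rewrite !expr0 scale1r !mulr1.
  by rewrite circ_cst -scalerAr mulr1.
have E1 n : circ_coef (fun=> 1) n.+1 = 0.
  apply: qre_test => c; rewrite qre_qint; last exact: term_cts.
  rewrite mulr0 [RHS]/=.
  pose k : R := n.+1%:R; have k0 : k != 0 by rewrite pnatr_eq0.
  pose A := rho^-1 ^+ n.+1.
  pose P (t : R) := A * (qre c * (- sin (k * - t) / k) + qre (c * J) * (cos (k * - t) / k)).
  have EE t : qre (c * (A *: e (- t) ^+ n.+1 * 1)) =
      A * (qre c * cos (k * - t) + qre (c * J) * sin (k * - t)).
    by rewrite mulr1 cisqX// /cisq /slice_pt /=; ring.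
  have dk t : is_derive t 1 (fun t => k * - t : R) (- k).
    by apply: (der_eq (der_mul (der_cst k t) (der_opp (der_id t)))); ring.
  have : \int[mu]_(t in C) (A * (qre c * cos (k * - t) + qre (c * J) * sin (k * - t))) = P (2 * pi) - P 0.
    apply: circ_FTC => t; last exact: (der_continuous (der_mul (der_cst A t)
      (der_add (der_mul (der_cst (qre c) t) (der_cos (dk t))) (der_mul (der_cst (qre (c * J)) t) (der_sin (dk t)))))).
    apply: (der_eq (der_mul (der_cst A t) (der_add
     (der_mul (der_cst (qre c) t) (der_mul (der_opp (der_sin (dk t))) (der_cst k^-1 t)))
     (der_mul (der_cst (qre (c * J)) t) (der_mul (der_cos (dk t)) (der_cst k^-1 t)))))).
    by field.
  have EI : \int[mu]_(x in C) qre (c * (rho^-1 ^+ n.+1 *: e (- x) ^+ n.+1 * 1)) =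
      \int[mu]_(t in C) (A * (qre c * cos (k * - t) + qre (c * J) * sin (k * - t))).
    by apply: eq_Rintegral => t _; exact: EE.
  move=> HP; rewrite EI HP /P oppr0 mulr0 sin0 cos0 mulrN sinN cosN.
  have -> : k * (2 * pi) = pi *+ 2 *+ n.+1 by rewrite -[RHS]mulr_natl -(mulr_natl pi).
  have sp : sin (pi *+ 2 *+ n.+1) = 0 :> R.
    by rewrite -[_ *+ n.+1]add0r (periodicn (@sinD2pi R)) sin0.
  have cp : cos (pi *+ 2 *+ n.+1) = 1 :> R.
    by rewrite -[_ *+ n.+1]add0r (periodicn (@cosD2pi R)) cos0.
  by rewrite sp cp; ring.
apply: (@qcvg_unique R (psum (circ_coef (fun=> 1)) zeta)).
  suff -> : ker = (fun t => ker t * 1) by exact: H.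
  by apply/funext => t; rewrite mulr1.
rewrite -(cvg_shiftS (psum (circ_coef (fun=> 1)) zeta)).
suff -> : (fun N => psum (circ_coef (fun=> 1)) zeta N.+1) = (fun=> (2 * pi)%:A) by exact: cvg_cst.
apply/funext => N; rewrite /psum big_ord_recl/= E0 expr0 mul1r big1 ?addr0//.
by move=> n _; rewrite /bump/= add1n E1 mulr0.
Qed.

Variables (r : R) (g : quat R -> quat R).
Hypotheses (rhor : rho < r) (gr : slice_regular r g).

(* A margin that keeps the curves gam v inside the ball for v slightly outside the
   unit interval, so that v = 0 and v = 1 are interior points. *)
Let dlt := (r - rho) / (4 * rho).
Let dlt0 : 0 < dlt.
Proof. by rewrite /dlt divr_gt0// ?mulr_gt0// subr_gt0. Qed.
Let dlt_rho : (1 + 2 * dlt) * rho < r.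
Proof.
have -> : (1 + 2 * dlt) * rho = rho + (r - rho) / 2 by rewrite /dlt; field; exact: lt0r_neq0.
by move: rhor; lra.
Qed.

Implicit Types (v : R) (w : R * R).
(* gam v is the circle of centre (1 - v) zeta and radius v rho: it shrinks from the
   circle of radius rho to the point zeta. *)
Let X (v t : R) := z0.1 * (1 - v) + v * (rho * cos t).
Let Y (v t : R) := z0.2 * (1 - v) + v * (rho * sin t).
Let gam v t := slice_pt J (X v t, Y v t).

Let gamE v t : gam v t = (1 - v) *: zeta + (v * rho) *: e t.
Proof.
rewrite /gam /e /cisq !slice_ptZ slice_ptD/= /X /Y; congr (slice_pt J (_, _)); ring.
Qed.

Let gam_in v t : - dlt <= v <= 1 + dlt -> `|gam v t| < r.
Proof.
move=> /andP[v1 v2]; apply: le_lt_trans dlt_rho.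
have zr := ltW z0rho; have zp := normr_ge0 zeta; have d0 := ltW dlt0.
rewrite gamE; apply: (le_trans (ler_normD _ _)); rewrite !normrZ cisq_norm// mulr1.
rewrite (gtr0_norm rho0).
apply: (@le_trans _ _ (`|1 - v| * rho + `|v| * rho)); first by rewrite lerD2r ler_wpM2l.
rewrite -mulrDl ler_wpM2r ?(ltW rho0)//.
by case: (ger0P (1 - v)) => h1; case: (ger0P v) => h2; lra.
Qed.

Let dg (q : quat R) : `|q| < r -> differentiable g q.
Proof. by case: gr => H _; exact: H. Qed.

Let W v t := dslice_x g J (X v t, Y v t).

(** In a slice, the Cauchy-Riemann equation turns the differential into the
    multiplication of the derivative, on its left, by the direction. *)
Let dgE v t w : - dlt <= v <= 1 + dlt -> 'd g (gam v t) (slice_pt J w) = slice_pt J w * W v t.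
Proof.
move=> vd; have zr := gam_in t vd.
case: gr => _ /(_ J SJ (X v t, Y v t) zr) [_ _ _ _].
rewrite dslice_yE /W dslice_xE !deriveE; try exact: dg.
rewrite -/(gam v t) => CR.
have JE : 'd g (gam v t) J = J * 'd g (gam v t) 1.
  have := congr1 (fun q => J * q) CR; rewrite mulrDr mulr0 mulrA usphere_sqr// mulN1r => /eqP.
  by rewrite subr_eq0 => /eqP ->.
rewrite /slice_pt linearD !linearZ/= JE mulrDl -!scalerAl mul1r.
by [].
Qed.

Let W_cts v t : - dlt <= v <= 1 + dlt -> {for (v, t), continuous (fun p : R * R => W p.1 p.2)}.
Proof.
move=> vd; have zr := gam_in t vd.
case: gr => _ /(_ J SJ (X v t, Y v t) zr) [_ _ H _ _].
have c1 : (X p.1 p.2) @[p --> (v, t)] --> X v t.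
  apply: cvgD; apply: cvgM.
  - exact: cvg_cst.
  - by apply: cvgB; [exact: cvg_cst|exact: cvg_fst].
  - exact: cvg_fst.
  - apply: cvgM; first exact: cvg_cst.
    apply: (@cvg_comp _ _ _ snd (@cos R) _ (nbhs t)); [exact: cvg_snd|exact: continuous_cos].
have c2 : (Y p.1 p.2) @[p --> (v, t)] --> Y v t.
  apply: cvgD; apply: cvgM.
  - exact: cvg_cst.
  - by apply: cvgB; [exact: cvg_cst|exact: cvg_fst].
  - exact: cvg_fst.
  - apply: cvgM; first exact: cvg_cst.
    apply: (@cvg_comp _ _ _ snd (@sin R) _ (nbhs t)); [exact: cvg_snd|exact: continuous_sin].
apply: (@cvg_comp _ _ _ (fun p : R * R => (X p.1 p.2, Y p.1 p.2)) (dslice_x g J) _ _ _ _ H).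
exact: pair_cvg.
Qed.

Let sec_cts v : continuous (fun t : R => (v, t) : R * R).
Proof. by move=> t; apply: pair_cvg; [exact: cvg_cst|exact: cvg_id]. Qed.

Let Wt_cts v : - dlt <= v <= 1 + dlt -> continuous (W v).
Proof.
move=> vd t.
exact: (@continuous_comp _ _ _ (fun t : R => (v, t)) (fun p : R * R => W p.1 p.2) t (@sec_cts v t) (W_cts vd)).
Qed.

Let dX v t : is_derive v 1 (fun v : R => X v t) (rho * cos t - z0.1).
Proof.
apply: (der_eq (der_add (der_mul (der_cst z0.1 v) (der_sub (der_cst 1 v) (der_id v)))
  (der_mul (der_id v) (der_cst (rho * cos t) v)))); ring.
Qed.
Let dY v t : is_derive v 1 (fun v : R => Y v t) (rho * sin t - z0.2).
Proof.
apply: (der_eq (der_add (der_mul (der_cst z0.2 v) (der_sub (der_cst 1 v) (der_id v)))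
  (der_mul (der_id v) (der_cst (rho * sin t) v)))); ring.
Qed.
Let dXt v t : is_derive t 1 (X v) (- (v * rho) * sin t).
Proof.
apply: (der_eq (der_add (der_cst (z0.1 * (1 - v)) t)
  (der_mul (der_cst v t) (der_mul (der_cst rho t) (der_cos (der_id t)))))); ring.
Qed.
Let dYt v t : is_derive t 1 (Y v) ((v * rho) * cos t).
Proof.
apply: (der_eq (der_add (der_cst (z0.2 * (1 - v)) t)
  (der_mul (der_cst v t) (der_mul (der_cst rho t) (der_sin (der_id t)))))); ring.
Qed.

(** The velocity of gam in v is rho e^(J t) - zeta, and it cancels the denominator
    of the kernel. *)
Let ker_circ t : ker t * (rho *: e t - zeta) = rho *: e t.
Proof.
have -> : rho *: e t - zeta = (1 - u t) * (rho *: e t).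
  rewrite mulrBl mul1r uE -scalerAl -scalerAr scalerA mulVf ?gt_eqF// scale1r -mulrA.
  by rewrite /e -cisqD// addNr cisq0 mulr1.
by rewrite mulrA ker_mul mul1r.
Qed.

Let dint (c : quat R) v t : - dlt <= v <= 1 + dlt ->
  is_derive v 1 (fun v => qre (c * ker t * g (gam v t))) (qre (c * (rho *: e t) * W v t)).
Proof.
move=> vd; apply: (der_eq (@der_slice R g J (fun v => X v t) (fun v => Y v t) _ _ v (c * ker t) (dg (gam_in t vd)) (dX v t) (dY v t))).
have E : slice_pt J (rho * cos t - z0.1, rho * sin t - z0.2) = rho *: e t - zeta.
  by rewrite /e /cisq slice_ptZ slice_ptB.
have := dgE t (rho * cos t - z0.1, rho * sin t - z0.2) vd; rewrite -/(gam v t) => ->.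
by rewrite E -[in RHS](ker_circ t) !mulrA.
Qed.

Let dcirc (c : quat R) v t : - dlt <= v <= 1 + dlt ->
  is_derive t 1 (fun t => qre (- (c * J) * g (gam v t))) (v * qre (c * (rho *: e t) * W v t)).
Proof.
move=> vd; apply: (der_eq (der_slice (- (c * J)) (dg (gam_in t vd)) (dXt v t) (dYt v t))).
rewrite dgE//.
have -> : slice_pt J (- (v * rho) * sin t, v * rho * cos t) = J * ((v * rho) *: e t).
  rewrite /e /cisq /slice_pt/= scalerDr mulrDr -!scalerAr mulr1 usphere_sqr// !scalerA scalerN mulNr scaleNr.
  by rewrite addrC.
rewrite mulrA mulNr -!mulrA (mulrA J J) usphere_sqr// !mulN1r !mulrN opprK.
have E (k : R) (p q w : quat R) : qre (p * (k *: q) * w) = k * qre (p * (q * w)).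
  by move=> /=; ring.
by rewrite -scalerA E.
Qed.

Let gamc v : - dlt <= v <= 1 + dlt -> continuous (fun t => g (gam v t)).
Proof.
move=> vd t; apply: (@cvg_comp _ _ _ (gam v) g _ (nbhs (gam v t)) _ _).
  by apply: slice_cvg; [exact: (der_continuous (dXt v t))|exact: (der_continuous (dYt v t))].
exact: differentiable_continuous (dg (gam_in t vd)).
Qed.

Let deri_cts (c : quat R) v : - dlt <= v <= 1 + dlt -> continuous (fun t => qre (c * (rho *: e t) * W v t)).
Proof.
move=> vd t; apply: qre_cvg; apply: qmul_cvg; last exact: Wt_cts.
apply: qmul_cvg; first exact: cvg_cst.
by apply: cvgZl_tmp; exact: cisq_cts.
Qed.

(** Up to a factor v, the derivative in v of the integrand ker t * g (gam v t) is a
    derivative in t of a periodic function, so its integral over the circle is 0.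
    The factor J between the two velocities is absorbed in the functional. *)
Let deri_zero (c : quat R) v : - dlt <= v <= 1 + dlt ->
  v * \int[mu]_(t in C) qre (c * (rho *: e t) * W v t) = 0.
Proof.
move=> vd; rewrite -RintegralZl//; last by apply: circ_integrable; exact: deri_cts.
have H : \int[mu]_(t in C) (v * qre (c * (rho *: e t) * W v t)) =
   qre (- (c * J) * g (gam v (2 * pi))) - qre (- (c * J) * g (gam v 0)).
  apply: (@circ_FTC R (fun t => v * qre (c * (rho *: e t) * W v t)) (fun t => qre (- (c * J) * g (gam v t)))) => t.
    exact: (dcirc c t vd).
  by apply: cvgM; [exact: cvg_cst|exact: deri_cts].
rewrite H /gam /X /Y.
have -> : 2 * pi = pi *+ 2 :> R by rewrite mulr_natl.
by rewrite cos2pi sin2pi cos0 sin0 subrr.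
Qed.

Let bounded_deri (c : quat R) : exists M, forall v t, - dlt <= v <= 1 + dlt -> C t ->
  `|qre (c * (rho *: e t) * W v t)| <= M.
Proof.
pose A : set (R * R) := `[- dlt, 1 + dlt]%classic `*` `[0, 2 * pi]%classic.
have cA : compact A by apply: compact_setX; exact: segment_compact.
pose h (p : R * R) : R := qre (c * (rho *: e p.2) * W p.1 p.2).
have ch : {within A, continuous h}.
  apply: continuous_in_subspaceT => -[v t]; rewrite inE => -[/= vd _].
  rewrite in_itv/= in vd.
  apply: qre_cvg; apply: qmul_cvg; last exact: W_cts.
  apply: qmul_cvg; first exact: cvg_cst.
  apply: cvgZl_tmp; apply: (@continuous_comp _ _ _ snd e); [exact: cvg_snd|exact: cisq_cts].
have /compact_bounded [M [_ HM]] := continuous_compact ch cA.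
exists (M + 1) => v t vd Ct; apply: (HM (M + 1)); first by rewrite ltrDl.
by exists (v, t) => //; split => //=; rewrite in_itv.
Qed.

(** The integral over the curve gam v does not depend on v: its derivative vanishes
    for v in ]0, 1[ by deri_zero. At v = 0 it is the integral of the kernel times g
    zeta. *)
Lemma cauchy_circle : qintegral mu C (fun t => ker t * g (rho *: e t)) = (2 * pi) *: g zeta.
Proof.
apply: qre_test => c.
have g1 t : gam 1 t = rho *: e t by rewrite gamE subrr scale0r add0r mul1r.
have g0 t : gam 0 t = zeta by rewrite gamE subr0 scale1r mul0r scale0r addr0.
have d0 := ltW dlt0.
have in0 : - dlt <= 0 <= 1 + dlt by lra.
have in1 : - dlt <= 1 <= 1 + dlt by lra.
have kc v : - dlt <= v <= 1 + dlt -> continuous (fun t => ker t * g (gam v t)).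
  by move=> vd t; apply: qmul_cvg; [exact: ker_cts|exact: gamc].
have ckc v : - dlt <= v <= 1 + dlt -> continuous (fun t => qre (c * ker t * g (gam v t))).
  move=> vd t; apply: qre_cvg; apply: qmul_cvg; last exact: gamc.
  by apply: qmul_cvg; [exact: cvg_cst|exact: ker_cts].
pose G v := \int[mu]_(t in C) qre (c * ker t * g (gam v t)).
have -> : qre (c * qintegral mu C (fun t => ker t * g (rho *: e t))) = G 1.
  have -> : (fun t => ker t * g (rho *: e t)) = (fun t => ker t * g (gam 1 t)).
    by apply/funext => t; rewrite g1.
  rewrite qre_qint; last exact: kc.
  by apply: eq_Rintegral => t _; rewrite mulrA.
have -> : qre (c * ((2 * pi) *: g zeta)) = G 0.
  have -> : (2 * pi) *: g zeta = (2 * pi)%:A * g zeta by rewrite -scalerAl mul1r.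
  rewrite -ker_int mulrA qreC mulrA qre_qint; last exact: ker_cts.
  by apply: eq_Rintegral => t _; rewrite g0 -mulrA [RHS]qreC !mulrA.
have [M HM] := bounded_deri c.
have dG v : - dlt < v < 1 + dlt -> is_derive v 1 G (\int[mu]_(t in C) qre (c * (rho *: e t) * W v t)).
  move=> vd.
  apply: (@der_integral _ _ _ mu C mC (fun v t => qre (c * ker t * g (gam v t)))
    (fun v t => qre (c * (rho *: e t) * W v t)) (fun=> M) v (- dlt) (1 + dlt) vd).
  - move=> z /andP[z1 z2]; apply: circ_integrable; apply: ckc; by rewrite !ltW.
  - move=> z t /andP[z1 z2] Ct; apply: dint; by rewrite !ltW.
  - move=> z t /andP[z1 z2] Ct; apply: HM => //; by rewrite !ltW.
  - by apply: circ_integrable => t; exact: cvg_cst.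
have [||w] := @MVT R G (fun v => \int[mu]_(t in C) qre (c * (rho *: e t) * W v t)) 0 1 ltr01.
- by move=> v; rewrite in_itv/= => /andP[v0 v1]; apply: dG; lra.
- apply: continuous_in_subspaceT => v; rewrite inE/= in_itv/= => /andP[v0 v1].
  apply: der_continuous (dG v _); apply/andP; split.
    by apply: lt_le_trans v0; rewrite oppr_lt0.
  by apply: le_lt_trans v1 _; rewrite ltrDl.
rewrite in_itv/= => /andP[w0 w1].
have wd : - dlt <= w <= 1 + dlt by lra.
have /eqP := deri_zero c wd; rewrite mulf_eq0 (gt_eqF w0)/= => /eqP -> /eqP.
by rewrite mul0r subr_eq0 => /eqP.
Qed.

Lemma cauchy_expand :
  psum (fun n => (2 * pi)^-1 *: circ_coef (fun t => g (rho *: e t)) n) zeta @ \oo --> g zeta.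
Proof.
have gc : continuous (fun t => g (rho *: e t)).
  have in1 : - dlt <= 1 <= 1 + dlt by have d0 := ltW dlt0; lra.
  have -> : (fun t => g (rho *: e t)) = (fun t => g (gam 1 t)).
    by apply/funext => t; rewrite gamE subrr scale0r add0r mul1r.
  exact: gamc.
have H := kernel_expand gc.
rewrite cauchy_circle in H.
have p0 : (2 * pi : R) != 0 by rewrite mulf_neq0// ?pnatr_eq0// gt_eqF// pi_gt0.
have {}H : (2 * pi)^-1 *: psum (circ_coef (fun t => g (rho *: e t))) zeta N @[N --> \oo] -->
   (2 * pi)^-1 *: ((2 * pi) *: g zeta) by exact: cvgZl_tmp.
rewrite scalerA mulVf// scale1r in H.
suff -> : psum (fun n => (2 * pi)^-1 *: circ_coef (fun t => g (rho *: e t)) n) zeta =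
  (fun N => (2 * pi)^-1 *: psum (circ_coef (fun t => g (rho *: e t))) zeta N) by exact: H.
by apply/funext => N; rewrite /psum scaler_sumr; apply: eq_bigr => n _; rewrite scalerAr.
Qed.

End cauchy.

Section slice_regular_power_series.
Context {R : realType}.
Variables (r : R) (g : quat R -> quat R).
Hypothesis (r0 : 0 < r) (gr : slice_regular r g).

Let A (J : quat R) (rho : R) n : quat R :=
  (2 * pi)^-1 *: circ_coef J rho (fun t => g (rho *: cisq J t)) n.

Let A_cvg J rho z : usphere J -> 0 < rho < r -> `|slice_pt J z| < rho ->
  psum (A J rho) (slice_pt J z) @ \oo --> g (slice_pt J z).
Proof. move=> SJ /andP[h1 h2] zr; exact: (@cauchy_expand R J z rho SJ h1 zr r g h2 gr). Qed.

Let A_dom J rho : usphere J -> 0 < rho < r -> ps_dom (A J rho) rho.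
Proof.
move=> SJ rr; apply: ps_dom_real => x x0; rewrite -(slice_ptr J) in x0 *.
by exists (g (slice_pt J (x, 0))); exact: A_cvg.
Qed.

(** Any two of these series agree with g at small positive reals, so their
    coefficients agree: the expansion depends neither on the slice nor on the
    radius. *)
Let A_indep J J' rho rho' n : usphere J -> usphere J' -> 0 < rho < r -> 0 < rho' < r ->
  A J rho n = A J' rho' n.
Proof.
move=> SJ SJ' rr rr'.
have m0 : 0 < Num.min rho rho' by rewrite lt_min; move: rr rr' => /andP[-> _] /andP[-> _].
have h1 : ps_on (psval (A J rho)) (A J rho) (Num.min rho rho').
  by move=> q; rewrite lt_min => /andP[h _]; apply: ps_on_psval h; exact: A_dom.
have h2 : ps_on (psval (A J' rho')) (A J' rho') (Num.min rho rho').
  by move=> q; rewrite lt_min => /andP[_ h]; apply: ps_on_psval h; exact: A_dom.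
apply: (ps_unique m0 h1 h2) => x /andP[x0]; rewrite lt_min => /andP[xr xr'].
have e1 : psval (A J rho) x%:A = g x%:A.
  apply: (@qcvg_unique R (psum (A J rho) x%:A)).
    by apply: (ps_on_psval (A_dom SJ rr)); rewrite qnorm_real gtr0_norm.
  by rewrite -(slice_ptr J); apply: A_cvg => //; rewrite slice_ptr qnorm_real gtr0_norm.
have e2 : psval (A J' rho') x%:A = g x%:A.
  apply: (@qcvg_unique R (psum (A J' rho') x%:A)).
    by apply: (ps_on_psval (A_dom SJ' rr')); rewrite qnorm_real gtr0_norm.
  by rewrite -(slice_ptr J'); apply: A_cvg => //; rewrite slice_ptr qnorm_real gtr0_norm.
by rewrite e1 e2.
Qed.

Lemma slice_regular_ps : exists a, ps_on g a r.
Proof.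
pose I0 : quat R := Quat 0 1 0 0.
have SI0 : usphere I0 by rewrite /usphere/= expr2; apply: quatP => /=; ring.
have r2 : 0 < r / 2 < r by move: r0; lra.
exists (A I0 (r / 2)) => q qr.
have [J [z [SJ qE]]] := slice_exists q.
have q0 := normr_ge0 q; pose rho := (`|q| + r) / 2.
have rr : 0 < rho < r by rewrite /rho; lra.
have -> : A I0 (r / 2) = A J rho by apply/funext => n; exact: A_indep.
rewrite qE; apply: A_cvg => //; rewrite -qE /rho; lra.
Qed.

End slice_regular_power_series.

(** * Linear changes of variables and radial integrals in the plane *)

Section affine_line.
Context {R : realType}.
Notation mu := (@lebesgue_measure R).
Notation L := (measurableTypeR R).

Lemma measurable_affine (a b : R) : measurable_fun [set: L] (fun x : L => a * x + b : L).
Proof. by apply: measurable_funD => //; exact: measurable_funM. Qed.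

(** The image of Lebesgue measure under an affine map, rescaled, has the values of
    Lebesgue measure on intervals, hence equals it. *)
Lemma leb_affine (a b : R) (f : L -> \bar R) : 0 < a -> measurable_fun [set: L] f ->
  (forall x, (0 <= f x)%E) ->
  (\int[mu]_x f (a * x + b)%R = (a^-1)%:E * \int[mu]_x f x)%E.
Proof.
move=> a0 mf f0; have mphi := measurable_affine a b.
set phi := (fun x : L => a * x + b : L) in mphi.
have an0 : 0 <= a by exact: ltW.
have K (m : {measure set L -> \bar R}) : (forall A, measurable A -> m A = mu (phi @^-1` A)) ->
    (\int[m]_x f x = (a^-1)%:E * \int[mu]_x f x)%E.
  move=> Hm.
  have E A : measurable A -> mu A = mscale (NngNum an0) m A.
    move=> mA; apply: lebesgue_measure_unique => // _ [[u v]] _ <-.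
    rewrite /= /mscale/= Hm; last exact: measurable_itv.
    have -> : phi @^-1` `]u, v] = `](u - b) / a, (v - b) / a]%classic.
      by apply/seteqP; split => x /=; rewrite !in_itv/= /phi ltr_pdivrMr// ler_pdivlMr// (mulrC x) ltrBlDr lerBrDr.
    rewrite !lebesgue_measure_itv/= !lte_fin.
    have -> : ((u - b) / a < (v - b) / a) = (u < v) by rewrite ltr_pM2r ?invr_gt0// ltrD2r.
    case: ifP => _; last by rewrite mule0.
    by rewrite -!EFinD -EFinM; congr (_%:E); field; exact: lt0r_neq0.
  have -> : (\int[mu]_x f x = \int[mscale (NngNum an0) m]_x f x)%E.
    by apply: eq_measure_integral => A mA _; exact: E.
  rewrite ge0_integral_mscale//=.
  by rewrite muleA -EFinM mulVf ?gt_eqF// mul1e.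
have f0' : {in [set: L], forall y, (0 <= f y)%E} by move=> y _.
have := ge0_integral_pushforward mphi mu measurableT mf f0'.
rewrite preimage_setT => <-.
exact: K.
Qed.

End affine_line.

Section plane.
Context {R : realType}.
Notation mu := (@lebesgue_measure R).
Notation L := (measurableTypeR R).
Notation P := (L * L)%type.
Notation nu := (plane_measure R).
Implicit Types (F : P -> \bar R).

Lemma measurable_lin (a b : R) : measurable_fun [set: P] (fun z : P => a * z.1 + b * z.2 : L).
Proof.
by apply: measurable_funD; apply: measurable_funM.
Qed.

Definition lin2 (a b c d : R) (z : P) : P := (a * z.1 + b * z.2, c * z.1 + d * z.2).

Lemma measurable_lin2 a b c d : measurable_fun [set: P] (lin2 a b c d).
Proof. by apply: measurable_fun_pair; exact: measurable_lin. Qed.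

Lemma plane_shear1 (t : R) F : measurable_fun [set: P] F -> (forall z, (0 <= F z)%E) ->
  (\int[nu]_z F (lin2 1 t 0 1 z) = \int[nu]_z F z)%E.
Proof.
move=> mF F0; rewrite /plane_measure.
have mF' : measurable_fun [set: P] (fun z => F (lin2 1 t 0 1 z)).
  by apply: measurableT_comp mF _; exact: measurable_lin2.
rewrite (fubini_tonelli2 _ mF' (fun z => F0 _)) (fubini_tonelli2 _ mF F0).
apply: eq_integral => y _; rewrite /fubini_G.
have my : measurable_fun [set: L] (fun x : L => F (x, y)).
  by apply: measurableT_comp mF _; exact: measurable_fun_pair.
have := @leb_affine R 1 (t * y) (fun x => F (x, y)) ltr01 my (fun x => F0 _).
rewrite invr1 mul1e => <-; apply: eq_integral => x _.
by rewrite /lin2/= mul0r add0r !mul1r.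
Qed.

Lemma plane_shear2 (t : R) F : measurable_fun [set: P] F -> (forall z, (0 <= F z)%E) ->
  (\int[nu]_z F (lin2 1 0 t 1 z) = \int[nu]_z F z)%E.
Proof.
move=> mF F0; rewrite /plane_measure.
have mF' : measurable_fun [set: P] (fun z => F (lin2 1 0 t 1 z)).
  by apply: measurableT_comp mF _; exact: measurable_lin2.
rewrite (fubini_tonelli1 _ mF' (fun z => F0 _)) (fubini_tonelli1 _ mF F0).
apply: eq_integral => x _; rewrite /fubini_F.
have mx : measurable_fun [set: L] (fun y : L => F (x, y)).
  by apply: measurableT_comp mF _; exact: measurable_fun_pair.
have := @leb_affine R 1 (t * x) (fun y => F (x, y)) ltr01 mx (fun x => F0 _).
rewrite invr1 mul1e => <-; apply: eq_integral => y _.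
by rewrite /lin2/= mul0r addr0 !mul1r addrC.
Qed.

Lemma plane_scale (t : R) F : 0 < t -> measurable_fun [set: P] F -> (forall z, (0 <= F z)%E) ->
  (\int[nu]_z F (lin2 t 0 0 t z) = ((t ^+ 2)^-1)%:E * \int[nu]_z F z)%E.
Proof.
move=> t0 mF F0; rewrite /plane_measure.
have mF' : measurable_fun [set: P] (fun z => F (lin2 t 0 0 t z)).
  by apply: measurableT_comp mF _; exact: measurable_lin2.
rewrite (fubini_tonelli1 _ mF' (fun z => F0 _)) (fubini_tonelli1 _ mF F0).
have mx x : measurable_fun [set: L] (fun y : L => F (x, y)).
  by apply: measurableT_comp mF _; exact: measurable_fun_pair.
have ti : 0 <= t^-1 by rewrite invr_ge0 ltW.
transitivity (\int[mu]_x ((t^-1)%:E * fubini_F mu F (t * x + 0)%R))%E.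
  apply: eq_integral => x _; rewrite /fubini_F.
  rewrite -(@leb_affine R t 0 (fun y => F (t * x + 0, y)) t0 (mx _) (fun x => F0 _)).
  by apply: eq_integral => y _; rewrite /lin2/= !mul0r add0r !addr0.
have mfF : measurable_fun [set: L] (fubini_F mu F) by exact: measurable_fun_fubini_tonelli_F.
have fF0 x : (0 <= fubini_F mu F x)%E by exact: integral_ge0.
have mc : measurable_fun [set: L] (fun x => fubini_F mu F (t * x + 0)%R).
  by apply: measurableT_comp mfF _; exact: measurable_affine.
rewrite (@ge0_integralZl _ _ _ mu setT measurableT _ mc (t^-1)%:E (fun x _ => fF0 _)); last by rewrite lee_fin.
by rewrite (@leb_affine R t 0 (fubini_F mu F) t0 mfF fF0) muleA -EFinM -expr2 exprVn.
Qed.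

(** A rotation is the product of three shears, and a shear is a translation on each
    line, so it preserves integrals by Fubini's theorem. *)
Lemma plane_rot0 (c s : R) F : c ^+ 2 + s ^+ 2 = 1 -> 1 + c != 0 ->
  measurable_fun [set: P] F -> (forall z, (0 <= F z)%E) ->
  (\int[nu]_z F (lin2 c (- s) s c z) = \int[nu]_z F z)%E.
Proof.
move=> cs c1 mF F0; pose a := - (s / (1 + c)).
have E z : lin2 c (- s) s c z = lin2 1 a 0 1 (lin2 1 0 s 1 (lin2 1 a 0 1 z)).
  have s1 : s ^+ 2 = 1 - c ^+ 2 by rewrite -cs; ring.
  have s2 : s ^+ 2 = (1 - c) * (1 + c) by rewrite s1; ring.
  have ab : 1 + a * s = c.
    by rewrite /a mulNr mulrAC -expr2 s2 mulfK//; ring.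
  have a2 : a * (1 + c) = - s by rewrite /a mulNr mulfVK.
  case: z => x y; rewrite /lin2/=; congr (_, _).
    by transitivity ((1 + a * s) * x + a * (1 + (1 + a * s)) * y); [rewrite ab a2|ring].
  by transitivity (s * x + (1 + a * s) * y); [rewrite ab|ring].
under eq_integral do rewrite E.
have m1 : measurable_fun [set: P] (F \o lin2 1 a 0 1) by apply: measurableT_comp mF _; exact: measurable_lin2.
have m2 : measurable_fun [set: P] ((F \o lin2 1 a 0 1) \o lin2 1 0 s 1).
  by apply: measurableT_comp m1 _; exact: measurable_lin2.
have e1 := @plane_shear1 a ((F \o lin2 1 a 0 1) \o lin2 1 0 s 1) m2 (fun z => F0 _).
have e2 := @plane_shear2 s (F \o lin2 1 a 0 1) m1 (fun z => F0 _).
exact: (etrans e1 (etrans e2 (plane_shear1 a mF F0))).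
Qed.

Definition rot (th : R) : P -> P := lin2 (cos th) (- sin th) (sin th) (cos th).

Lemma measurable_rot th : measurable_fun [set: P] (rot th).
Proof. exact: measurable_lin2. Qed.

(** Halving the angle excludes the rotation by pi, for which the factorization into
    shears breaks down. *)
Lemma plane_rot (th : R) F : `|th| <= pi ->
  measurable_fun [set: P] F -> (forall z, (0 <= F z)%E) ->
  (\int[nu]_z F (rot th z) = \int[nu]_z F z)%E.
Proof.
move=> thp mF F0; pose h := th / 2.
have ch : 0 <= cos h.
  apply: cos_ge0_pihalf; move: thp; rewrite ler_norml /h => /andP[h1 h2].
  by rewrite -mulNr !ler_pM2r ?invr_gt0// h1.
have c1 : 1 + cos h != 0 by rewrite gt_eqF// ltr_pwDl.
have E z : rot th z = rot h (rot h z).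
  have -> : th = h + h by rewrite /h -splitr.
  case: z => x y; rewrite /rot /lin2/= cosD sinD; congr (_, _); ring.
under eq_integral do rewrite E.
have m1 : measurable_fun [set: P] (F \o rot h) by apply: measurableT_comp mF _; exact: measurable_rot.
have cs : cos h ^+ 2 + sin h ^+ 2 = 1 by exact: cos2Dsin2.
have e1 := @plane_rot0 (cos h) (sin h) (F \o rot h) cs c1 m1 (fun z => F0 _).
exact: (etrans e1 (plane_rot0 cs c1 mF F0)).
Qed.

Lemma plane_odd (th : R) (G : P -> R) : `|th| <= pi -> measurable_fun [set: P] G ->
  (forall z, G (rot th z) = - G z) -> \int[nu]_z G z = 0.
Proof.
move=> thp mG GN; rewrite /Rintegral integralE.
have mE : measurable_fun [set: P] (EFin \o G) by exact/measurable_EFinP.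
have H : (\int[nu]_z (fun x => (G x)%:E)^\- z = \int[nu]_z (fun x => (G x)%:E)^\+ z)%E.
  rewrite -(@plane_rot th ((fun x => (G x)%:E)^\+)%E)//; last exact: measurable_funepos.
  by apply: eq_integral => z _; rewrite funenegE funeposE GN EFinN.
rewrite H; case: (\int[nu]_z _)%E => [x||] //.
by rewrite -EFinB subrr.
Qed.

Lemma plane_odd_in (th : R) (D : set P) (G : P -> R) : `|th| <= pi -> measurable D ->
  measurable_fun [set: P] G ->
  (forall z, D (rot th z) <-> D z) ->
  (forall z, G (rot th z) = - G z) -> \int[nu]_(z in D) G z = 0.
Proof.
move=> thp mD mG DR GN; rewrite Rintegral_mkcond; apply: (plane_odd thp).
  by apply/(measurable_restrictT _ mD); exact: measurable_funTS.
move=> z; rewrite /patch.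
have -> : (rot th z \in D) = (z \in D) by apply/idP/idP; rewrite !inE => /DR.
by case: ifP; rewrite ?oppr0.
Qed.

End plane.

Lemma int_scale d (T : measurableType d) (R : realType) (m : {measure set T -> \bar R})
    (f : T -> \bar R) (c : R) : measurable_fun [set: T] f -> (forall x, (0 <= f x)%E) -> 0 <= c ->
  (\int[m]_x (c%:E * f x) = c%:E * \int[m]_x f x)%E.
Proof. by move=> mf f0 c0; apply: ge0_integralZl. Qed.

Section plane_sigma_finite.
Context {R : realType}.
Notation mu := (@lebesgue_measure R).
Notation L := (measurableTypeR R).
Lemma plane_sigma_finite : sigma_finite [set: L * L] (mu \x mu)%E.
Proof.
have /sigma_finiteP[F [TF ndF Foo]] := sigma_finiteT mu.
exists (fun n => F n `*` F n).
 rewrite -setXTT TF predeqE => -[x y]; split.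
    move=> [/= [n _ Fnx] [k _ Gky]]; exists (maxn n k) => //; split.
    - by move: x Fnx; exact/subsetPset/ndF/leq_maxl.
    - by move: y Gky; exact/subsetPset/ndF/leq_maxr.
  by move=> [n _ []/= ? ?]; split; exists n.
move=> k; have [? ?] := Foo k.
split; first exact: measurableX.
by rewrite product_measure1E// lte_mul_pinfty// ge0_fin_numE.
Qed.
(** A copy of the plane measure that carries a sigma-finite structure, so that
    Fubini's theorem applies to the product of the plane with a line. *)
Definition planem : set (L * L) -> \bar R := (mu \x mu)%E.
HB.instance Definition _ := Measure.on planem.
HB.instance Definition _ := @Measure_isSigmaFinite.Build _ _ _ planem plane_sigma_finite.
End plane_sigma_finite.

Section radial.
Context {R : realType}.
Notation mu := (@lebesgue_measure R).
Notation L := (measurableTypeR R).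
Notation P := (L * L)%type.
Notation nu := (plane_measure R).
Notation pm := (@planem R).
Notation Rp := (`]0, +oo[%classic : set L).

Definition sqm (z : P) : L := z.1 ^+ 2 + z.2 ^+ 2.

Lemma sqm_ge0 z : 0 <= sqm z.
Proof. by rewrite addr_ge0 ?sqr_ge0. Qed.

Lemma measurable_sqm : measurable_fun [set: P] sqm.
Proof. by apply: measurable_funD; apply: measurable_funX. Qed.

Let k : L -> R := \1_(`[1, 2]%classic : set L).
Let ind : L -> R := \1_Rp.
(** For s > 0, the function t -> wt s t is the density 1/t on the interval [s/2, s],
    so its integral ln 2 does not depend on s. Averaging a radial integral with it
    and dilating the plane by sqrt t separates the two integrals; this avoids a
    polar change of variables. *)
Let wt (s t : L) : R := ind t * (t `^ (-1) * k (s * t `^ (-1))).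

Let mk : measurable_fun [set: L] k. Proof. by apply: measurable_indic; exact: measurable_itv. Qed.
Let mind : measurable_fun [set: L] ind. Proof. by apply: measurable_indic; exact: measurable_itv. Qed.
Let k0 s : 0 <= k s. Proof. by []. Qed.
Let ind0 s : 0 <= ind s. Proof. by []. Qed.
Let wt0 s t : 0 <= wt s t. Proof. by rewrite /wt !mulr_ge0 ?powR_ge0. Qed.
Let ind1 (t : R) : 0 < t -> ind t = 1.
Proof. by move=> t0; rewrite /ind indicE mem_set//= in_itv/= t0. Qed.
Let ind2 (t : R) : t <= 0 -> ind t = 0.
Proof. by move=> t0; rewrite /ind indicE memNset//= in_itv/= andbT; apply/negP; rewrite -leNgt. Qed.

Let wt_int (s : R) : 0 < s -> (\int[mu]_t (wt s t)%:E = (ln 2)%:E)%E.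
Proof.
move=> s0; have s2 : 0 < s / 2 by rewrite divr_gt0.
have -> : (ln 2 : R) = ln s - ln (s / 2).
  by rewrite lnM ?posrE ?invr_gt0// lnV ?posrE//; ring.
pose iv (x : R) : R := x^-1.
transitivity (\int[mu]_(t in `[(s / 2)%R, s]) (iv t)%:E)%E.
  rewrite [RHS]integral_mkcond; apply: eq_integral => t _; rewrite /patch.
  have [t0|t0] := leP t 0.
    rewrite /wt ind2// mul0r memNset//= in_itv/=; apply/negP; rewrite negb_and -!ltNge.
    by rewrite (le_lt_trans t0 s2).
  rewrite /iv /wt ind1// mul1r powR_inv1 ?ltW// /k indicE.
  have -> : (s * t^-1 \in `[1, 2]%classic) = (t \in `[s / 2, s]%classic).
    apply/idP/idP; rewrite !inE /= !in_itv/= ler_pdivlMr// ler_pdivrMr// ler_pdivrMr// mul1r => /andP[h1 h2];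
     by apply/andP; split => //; rewrite mulrC.
  by case: ifP => _; rewrite ?mulr1 ?mulr0.
have dl (x : R) : 0 < x -> is_derive x 1 (@ln R) x^-1 by move=> x0; exact: is_derive1_ln.
apply: (@FTC_closed R iv (@ln R)).
- by rewrite ltr_pdivrMr// ltr_pMr// ltr1n.
- by move=> x /andP[h _]; exact: dl (lt_le_trans s2 h).
- by move=> x /andP[h _]; apply: cvgV; [rewrite gt_eqF// (lt_le_trans s2)|exact: cvg_id].
Qed.

Section one_function.
Variable f : L -> R.
Hypotheses (mf : measurable_fun [set: L] f) (f0 : forall s, 0 <= f s).
Let fp s := f s * ind s.
Let mfp : measurable_fun [set: L] fp. Proof. exact: measurable_funM. Qed.
Let fp0 s : 0 <= fp s. Proof. by rewrite mulr_ge0. Qed.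
Let A (p : P * L) : R := fp (sqm p.1) * wt (sqm p.1) p.2.
Let B (p : P * L) : R := fp (sqm p.1 * p.2) * k (sqm p.1).
Let c (z : P) : R := k (sqm z) * sqm z `^ (-1).

Let ms1 : measurable_fun [set: P * L] (fun p : P * L => sqm p.1).
Proof. by apply: measurableT_comp measurable_sqm _. Qed.
Let mp : measurable_fun [set: P * L] (fun p : P * L => p.2 `^ (-1) : L).
Proof. by apply: measurableT_comp (measurable_powR _) _. Qed.
Let mA : measurable_fun [set: P * L] (fun p => (A p)%:E).
Proof.
apply/measurable_EFinP; apply: measurable_funM; first exact: measurableT_comp mfp ms1.
apply: measurable_funM; first by apply: measurableT_comp mind _.
apply: measurable_funM; first exact: mp.
apply: measurableT_comp mk _; exact: measurable_funM.
Qed.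
Let mB : measurable_fun [set: P * L] (fun p => (B p)%:E).
Proof.
apply/measurable_EFinP; apply: measurable_funM; last exact: measurableT_comp mk ms1.
by apply: measurableT_comp mfp _; exact: measurable_funM.
Qed.
Let mc : measurable_fun [set: P] (fun z => (c z)%:E).
Proof.
apply/measurable_EFinP; apply: measurable_funM; first exact: measurableT_comp mk measurable_sqm.
exact: measurableT_comp (measurable_powR _) measurable_sqm.
Qed.
Let mI : measurable_fun [set: P] (fun z => (fp (sqm z))%:E).
Proof. by apply/measurable_EFinP; exact: measurableT_comp mfp measurable_sqm. Qed.

Let A_t z : (\int[mu]_t (A (z, t))%:E = (ln 2)%:E * (fp (sqm z))%:E)%E.
Proof.
rewrite /A /=; under eq_integral do rewrite EFinM.
rewrite (@int_scale _ _ _ mu (fun t => (wt (sqm z) t)%:E) (fp (sqm z)))//; last first.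
- by move=> t; rewrite lee_fin.
- apply/measurable_EFinP; apply: measurable_funM; first exact: mind.
  apply: measurable_funM; first exact: measurable_powR.
  by apply: measurableT_comp mk _; apply: measurable_funM => //; exact: measurable_powR.
have [s0|s0] := leP (sqm z) 0; first by rewrite /fp ind2// mulr0 mul0e mule0.
by rewrite wt_int// muleC.
Qed.

Let B_t z : (\int[mu]_t (B (z, t))%:E = (c z)%:E * \int[mu]_s (fp s)%:E)%E.
Proof.
rewrite /B /c /=; under eq_integral do rewrite EFinM muleC.
have [s0|s0] := leP (sqm z) 0.
  have -> : k (sqm z) = 0.
    by rewrite /k indicE memNset//= in_itv/=; apply/negP; rewrite negb_and -ltNge (le_lt_trans s0).
  by rewrite mul0r mul0e; under eq_integral do rewrite mul0e; rewrite integral0.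
rewrite (@int_scale _ _ _ mu (fun t => (fp (sqm z * t))%:E) (k (sqm z)))//; last first.
- by move=> t; rewrite lee_fin.
- by apply/measurable_EFinP; apply: measurableT_comp mfp _; exact: measurable_funM.
rewrite EFinM -muleA; congr (_ * _)%E; rewrite powR_inv1 ?sqm_ge0//.
rewrite -(@leb_affine R (sqm z) 0 (fun s => (fp s)%:E))//; last exact/measurable_EFinP.
by apply: eq_integral => t _; rewrite addr0.
Qed.

Let AB t : (\int[pm]_z (A (z, t))%:E = \int[pm]_z (B (z, t))%:E)%E.
Proof.
have [t0|t0] := leP t 0.
  transitivity (0%E : \bar R); last symmetry.
    rewrite (_ : (fun z => (A (z, t))%:E) = cst 0%E) ?integral0//.
    by apply/funext => z; rewrite /A /wt /= ind2// mul0r mulr0.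
  rewrite (_ : (fun z => (B (z, t))%:E) = cst 0%E) ?integral0//.
  apply/funext => z; rewrite /B /fp /= ind2 ?mulr0 ?mul0r//.
  by rewrite mulr_ge0_le0// sqm_ge0.
pose F z := (fp (sqm z) * k (sqm z * t `^ (-1)))%:E.
have mF : measurable_fun [set: P] F.
  apply/measurable_EFinP; apply: measurable_funM; first exact: measurableT_comp mfp measurable_sqm.
  by apply: measurableT_comp mk _; apply: measurable_funM; first exact: measurable_sqm.
have F0 z : (0 <= F z)%E by rewrite lee_fin mulr_ge0.
have st : 0 < Num.sqrt t by rewrite sqrtr_gt0.
have := plane_scale st mF F0; rewrite sqr_sqrtr ?ltW// => H.
transitivity ((t^-1)%:E * \int[pm]_z F z)%E.
  rewrite -(@int_scale _ _ _ pm F t^-1)//; last by rewrite invr_ge0 ltW.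
  by apply: eq_integral => z _; rewrite /A /wt /F/= ind1// powR_inv1 ?ltW// mul1r -EFinM mulrCA.
rewrite -H; apply: eq_integral => z _; rewrite /F /B /=.
have -> : sqm (lin2 (Num.sqrt t) 0 0 (Num.sqrt t) z) = sqm z * t.
  by rewrite /sqm /lin2/= !mul0r addr0 add0r !exprMn sqr_sqrtr ?ltW//; ring.
by rewrite powR_inv1 ?ltW// mulfK// gt_eqF.
Qed.

(** Integrating A first in t gives the left-hand side. By Fubini and the dilation of
    the plane, A and B have the same integral, and integrating B first in t gives
    the right-hand side. Only the integral of c, which does not involve f, is left
    to be determined. *)
Lemma radial_prop : ((ln 2)%:E * \int[pm]_z (fp (sqm z))%:E =
  (\int[pm]_z (c z)%:E) * \int[mu]_s (fp s)%:E)%E.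
Proof.
have A0 p : (0 <= (A p)%:E)%E by rewrite lee_fin mulr_ge0.
have B0 p : (0 <= (B p)%:E)%E by rewrite lee_fin mulr_ge0.
rewrite -(@int_scale _ _ _ pm (fun z => (fp (sqm z))%:E) (ln 2))//; last first.
- by rewrite ln_ge0// ler1n.
- by move=> z; rewrite lee_fin.
under eq_integral do rewrite -A_t.
rewrite (@fubini_tonelli _ _ _ _ _ pm mu (fun p => (A p)%:E) mA A0).
under eq_integral do rewrite AB.
rewrite -(@fubini_tonelli _ _ _ _ _ pm mu (fun p => (B p)%:E) mB B0).
under eq_integral do rewrite B_t.
rewrite (@ge0_integralZr _ _ _ pm setT measurableT (fun z => (c z)%:E))//.
- by move=> z _; rewrite lee_fin mulr_ge0 ?powR_ge0.
- by apply: integral_ge0 => s _; rewrite lee_fin.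
Qed.

Let m0 : measurable ([set 0] : set L).
Proof. by rewrite -[X in measurable X]set_itv1; exact: measurable_itv. Qed.

Lemma origin_null : pm [set z : P | sqm z = 0] = 0%E.
Proof.
have -> : [set z : P | sqm z = 0] = [set 0] `*` [set 0].
  apply/seteqP; split => -[x y] /=; rewrite /sqm/=.
    by move/eqP; rewrite paddr_eq0 ?sqr_ge0// !sqrf_eq0 => /andP[/eqP -> /eqP ->].
  by move=> [-> ->]; rewrite expr0n addr0.
apply: (etrans (product_measure1E mu mu m0 m0)).
have H (x y : \bar R) : x = 0%E -> (x * y = 0)%E by move=> ->; rewrite mul0e.
by apply: H; exact: lebesgue_measure_set1.
Qed.

Lemma radial_pos : (\int[pm]_z (f (sqm z))%:E = \int[pm]_z (fp (sqm z))%:E)%E.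
Proof.
have mz : measurable [set z : P | sqm z = 0].
  by have := measurable_sqm measurableT m0; rewrite setTI.
apply: ge0_ae_eq_integral => //.
- by apply/measurable_EFinP; exact: measurableT_comp mf measurable_sqm.
- by move=> z _; rewrite lee_fin.
- by move=> z _; rewrite lee_fin.
exists [set z : P | sqm z = 0]; split => //; first exact: origin_null.
move=> z /= Hz; apply: contrapT => sz; apply: Hz => _.
have : 0 < sqm z by rewrite lt_neqAle sqm_ge0 andbT eq_sym; apply/eqP.
by move=> h; rewrite /fp ind1// mulr1.
Qed.

Lemma radial_line : (\int[mu]_s (fp s)%:E = \int[mu]_(s in Rp) (f s)%:E)%E.
Proof.
rewrite [RHS]integral_mkcond; apply: eq_integral => s _; rewrite /patch /fp /ind indicE.
by case: ifP => _; rewrite ?mulr1 ?mulr0.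
Qed.

End one_function.

(** This integral determines the constant in radial_prop. *)
Lemma gauss_plane : (\int[pm]_z (expR (- sqm z))%:E = pi%:E)%E.
Proof.
have mE : measurable_fun [set: P] (fun z => (expR (- sqm z))%:E).
  apply/measurable_EFinP; apply: measurableT_comp => //; apply: measurableT_comp => //.
  exact: measurable_sqm.
have mg : measurable_fun [set: L] (fun x => (gauss_fun x)%:E).
  by apply/measurable_EFinP; exact: measurable_gauss_fun.
have g0 x : (0 <= (gauss_fun (x : R))%:E)%E by rewrite lee_fin gauss_fun_ge0.
rewrite (fubini_tonelli1 _ mE) => [|z]; last by rewrite lee_fin expR_ge0.
transitivity (\int[mu]_x ((Num.sqrt pi)%:E * (gauss_fun x)%:E))%E.
  apply: eq_integral => x _; rewrite /fubini_F.
  rewrite -integralT_gauss -ge0_integralZr//.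
  by apply: eq_integral => y _; rewrite /sqm/= opprD expRD EFinM muleC.
rewrite int_scale ?sqrtr_ge0//.
by rewrite integralT_gauss -EFinM -expr2 sqr_sqrtr// pi_ge0.
Qed.

Lemma exp_line : (\int[mu]_(s in Rp) (expR (- s))%:E = 1)%E.
Proof.
have H : mu.-integrable Rp (EFin \o (fun t : R => t `^ 0 * expR (- (1 * t)))).
  exact: integrable_pow_expR.
have := @Gamma1 R; rewrite /Gamma /Rintegral => G.
have -> : (\int[mu]_(s in Rp) (expR (- s))%:E = \int[mu]_(s in Rp) (s `^ (1 - 1) * expR (- s))%:E)%E.
  by apply: eq_integral => s _; rewrite subrr powRr0 mul1r.
rewrite -[LHS]fineK ?G//.
have := integrable_fin_num _ H; rewrite subrr.
under [X in _ -> X \is a fin_num]eq_integral do rewrite -[X in expR (- X)]mul1r.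
by apply; exact: measurable_itv.
Qed.

Lemma radial_integral (f : L -> R) : measurable_fun [set: L] f -> (forall s, 0 <= f s) ->
  (\int[nu]_z (f (sqm z))%:E = pi%:E * \int[mu]_(s in Rp) (f s)%:E)%E.
Proof.
move=> mf f0; rewrite -[LHS]/(\int[pm]_z (f (sqm z))%:E)%E.
have me : measurable_fun [set: L] (fun s : L => expR (- s)).
  by apply: measurableT_comp => //; exact: measurableT_comp.
have e0 (s : L) : 0 <= expR (- s) by exact: expR_ge0.
have := radial_prop me e0; rewrite -(radial_pos me e0) radial_line gauss_plane exp_line mule1 => C.
have := radial_prop mf f0; rewrite -(radial_pos mf f0) radial_line -C -muleA => H.
have l2 : (ln 2 : R) != 0 by rewrite gt_eqF// ln_gt0// ltr1n.
have := congr1 (fun x => ((ln 2)^-1)%:E * x)%E H.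
by rewrite !(muleA (ln 2)^-1%:E) -EFinM mulVf// !mul1e.
Qed.

End radial.

(** * Beta integrals *)

Section beta_moments.
Context {R : realType}.
Variable alpha : R.
Hypothesis alpha0 : 0 < alpha.
Notation mu := (@lebesgue_measure R).
Notation L := (measurableTypeR R).
Notation U := (`]0, 1[%classic : set L).

Definition beta_fun (n : nat) (u : R) : R := u ^+ n * (1 - u) `^ (alpha - 1).

Let mU : measurable U. Proof. exact: measurable_itv. Qed.
(* The intervals [a_ k, 1 - a_ k] exhaust ]0, 1[; three is the least shift that
   makes them nondegenerate from the start. *)
Let a_ (k : nat) : R := k.+3%:R^-1.
Let a_gt0 k : 0 < a_ k. Proof. by rewrite invr_gt0 ltr0n. Qed.
Let a_lt k : a_ k < 2^-1. Proof. by rewrite ltf_pV2 ?posrE ?ltr0n// ltr_nat. Qed.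
Let a_lt1 k : a_ k < 1 - a_ k. Proof. by have := a_lt k; lra. Qed.
Let a_cvg : a_ k @[k --> \oo] --> (0 : R).
Proof.
have := @cvg_harmonic R; rewrite -(cvg_shiftn 2) => H.
suff -> : a_ = (fun k => harmonic (k + 2)%N) by exact: H.
by apply/funext => k; rewrite /harmonic/= addn2.
Qed.
Let U_ex (x : R) : 0 < x < 1 -> \forall k \near \oo, a_ k <= x <= 1 - a_ k.
Proof.
move=> /andP[x0 x1]; have m0 : 0 < Num.min x (1 - x) by rewrite lt_min x0 subr_gt0.
near=> k; have : a_ k < Num.min x (1 - x) by near: k; exact: (cvgr_lt _ a_cvg).
by rewrite lt_min => /andP[h1 h2]; apply/andP; split; lra.
Unshelve. all: by end_near. Qed.

Let d1 (x : R) : is_derive x 1 (fun u : R => 1 - u) (- 1).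
Proof. by apply: (der_eq (der_sub (der_cst 1 x) (der_id x))); ring. Qed.

Let der_pow1B (p x : R) : x < 1 -> is_derive x 1 (fun u => (1 - u) `^ p) (- (p * (1 - x) `^ (p - 1))).
Proof.
move=> x1; have x1' : 0 < 1 - x by rewrite subr_gt0.
by apply: (der_eq (@der_pow R p (fun u => 1 - u) x _ x1' (d1 x))); ring.
Qed.

Let dexp (n : nat) (x : R) : is_derive x 1 (fun u : R => u ^+ n.+1) (n.+1%:R * x ^+ n).
Proof.
elim: n => [|n ih].
  by under eq_fun do rewrite expr1; apply: (der_eq (der_id x)); rewrite expr0 mulr1.
under eq_fun do rewrite exprS.
by apply: (der_eq (der_mul (der_id x) ih)); rewrite -[n.+2%:R]natr1 exprS; ring.
Qed.

Lemma beta_continuous n (x : R) : x < 1 -> {for x, continuous (beta_fun n)}.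
Proof.
move=> x1; apply: cvgM; last exact: (der_continuous (der_pow1B _ x1)).
by case: n => [|n]; [under eq_fun do rewrite expr0; exact: cvg_cst|exact: (der_continuous (dexp n x))].
Qed.

Lemma measurable_beta n : measurable_fun [set: L] (beta_fun n : L -> L).
Proof.
apply: measurable_funM; first exact: measurable_funX.
by apply: measurableT_comp (measurable_powR _) _; exact: measurable_funB.
Qed.

Lemma beta_ge0 n u : 0 <= u -> 0 <= beta_fun n u.
Proof. by move=> u0; rewrite mulr_ge0 ?exprn_ge0 ?powR_ge0. Qed.

Let pow_le1 (p x : R) : 0 <= p -> 0 <= x <= 1 -> x `^ p <= 1.
Proof. by move=> p0 /andP[x0 x1]; have := @ge0_ler_powR R p p0 x 1; rewrite powR1; apply; rewrite ?nnegrE. Qed.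

(** For alpha < 1 the integrand is unbounded at 1; its integrals over the exhausting
    intervals are bounded by the primitive. *)
Lemma integrable_beta0 : mu.-integrable U (EFin \o beta_fun 0).
Proof.
have m0 : measurable_fun U (beta_fun 0 : L -> L) by exact: measurable_funTS (measurable_beta 0).
have b0 u : U u -> 0 <= beta_fun 0 u by rewrite /= in_itv/= => /andP[h _]; exact/beta_ge0/ltW.
apply/integrableP; split; first exact/measurable_EFinP.
rewrite (eq_integral (fun x : L => (beta_fun 0 x)%:E)); last first.
  by move=> x; rewrite inE => Ux /=; rewrite ger0_norm// b0.
apply: (@le_lt_trans _ _ (alpha^-1)%:E); last exact: ltry.
pose E k : set L := `[a_ k, 1 - a_ k]%classic.
have mE k : measurable (E k) by exact: measurable_itv.
apply: (@fatou_le _ _ _ mu U mU (fun k u => ((beta_fun 0 \_ (E k)) u)%:E)).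
- move=> k; apply/measurable_EFinP; apply: measurable_funTS.
  by apply/(measurable_restrictT _ (mE k)); exact: measurable_funTS (measurable_beta 0).
- by move=> k x Ux; rewrite lee_fin /patch; case: ifP => // _; exact: b0.
- exact/measurable_EFinP.
- by move=> x Ux; rewrite lee_fin b0.
- apply: aeW => x Ux; apply: cvg_near_cst.
  move: Ux; rewrite /= in_itv/= => /U_ex; apply: filterS => k xk.
  by rewrite /patch mem_set// /E/= in_itv.
move=> k; rewrite (_ : (\int[mu]_(x in U) _ = \int[mu]_(x in E k) (beta_fun 0 x)%:E)%E); last first.
  have EU : E k `<=` U.
    move=> x; rewrite /E /= !in_itv/= => /andP[h1 h2].
    by have := a_gt0 k => h3; apply/andP; split; lra.
  rewrite -[E k in RHS](setIidr EU) integral_mkcondr; apply: eq_integral => x _.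
  by rewrite !patchE; case: ifP.
have kk := a_gt0 k.
have -> : (\int[mu]_(x in E k) (beta_fun 0 x)%:E =
    (- ((1 - (1 - a_ k)) `^ alpha) / alpha - (- ((1 - a_ k) `^ alpha) / alpha))%:E)%E.
  apply: (@FTC_closed R (beta_fun 0) (fun u => - ((1 - u) `^ alpha) / alpha)) => //.
    move=> x /andP[h1 h2]; have x1 : x < 1 by lra.
    apply: (der_eq (der_mul (der_opp (der_pow1B alpha x1)) (der_cst alpha^-1 x))).
    by rewrite /beta_fun expr0; field; exact: lt0r_neq0.
  by move=> x /andP[h1 h2]; apply: beta_continuous; lra.
rewrite lee_fin !mulNr opprK addrC lerBlDr; apply: (@le_trans _ _ alpha^-1).
  rewrite ler_pdivrMr// mulVf ?gt_eqF//; apply: pow_le1; first exact: ltW.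
  by have := a_lt k; lra.
by rewrite lerDl divr_ge0 ?powR_ge0// ltW.
Qed.

Lemma integrable_beta n : mu.-integrable U (EFin \o beta_fun n).
Proof.
apply: (int_le mU _ _ integrable_beta0); first exact: measurable_funTS (measurable_beta n).
move=> u /=; rewrite in_itv/= => /andP[u0 u1]; rewrite ger0_norm; last exact/beta_ge0/ltW.
by rewrite /beta_fun expr0 ler_wpM2r ?powR_ge0// exprn_ile1 ?ltW.
Qed.

Let a_pow_cvg : a_ k `^ alpha @[k --> \oo] --> (0 : R).
Proof.
have H := powR_cvg0 alpha0; apply: cvg_comp _ H.
move=> A; rewrite /at_right /within/= => -[e e0 He].
near=> k; apply: He => //=; rewrite sub0r normrN gtr0_norm//.
by near: k; exact: (cvgr_lt _ a_cvg).
Unshelve. all: by end_near. Qed.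

Let beta_FTC (f F : R -> R) (l0 l1 : R) : (forall x : R, 0 < x < 1 -> is_derive x 1 F (f x)) ->
  (forall x : R, 0 < x < 1 -> {for x, continuous f}) -> mu.-integrable U (EFin \o f) ->
  F (a_ n) @[n --> \oo] --> l0 -> F (1 - a_ n) @[n --> \oo] --> l1 ->
  \int[mu]_(x in U) f x = l1 - l0.
Proof.
move=> dF cf fi F0 F1; apply: (@FTC_open R a_ (fun n => 1 - a_ n) U f F) => //.
- move=> n x /=; rewrite !in_itv/= => /andP[h1 h2].
  by have := a_gt0 n => h3; apply/andP; split; lra.
Qed.

(** Integrating the derivative of u^(n+1) (1 - u)^alpha over ]0, 1[ gives a
    recursion in n, which is the one satisfied by lnorm2. *)
Lemma beta_moment n : \int[mu]_(u in U) beta_fun n u = (alpha * lnorm2 alpha n)^-1.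
Proof.
have c1 (p : R) : {for 0 : R, continuous (fun u : R => (1 - u) `^ p)}.
  by apply: (der_continuous (der_pow1B p _)); exact: ltr01.
have c2 : (1 - a_ k) @[k --> \oo] --> (1 : R).
  by rewrite -[X in _ --> X]subr0; apply: cvgB => //; exact: cvg_cst.
elim: n => [|n ih].
  have H : \int[mu]_(u in U) beta_fun 0 u = (- 0 / alpha) - (- (1 `^ alpha) / alpha).
    apply: (@beta_FTC _ (fun u => - ((1 - u) `^ alpha) / alpha)).
    - move=> x /andP[h1 x1].
      apply: (der_eq (der_mul (der_opp (der_pow1B alpha x1)) (der_cst alpha^-1 x))).
      by rewrite /beta_fun expr0; field; exact: lt0r_neq0.
    - by move=> x /andP[_]; exact: beta_continuous.
    - exact: integrable_beta.
    - apply: cvgM; last exact: cvg_cst.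
      apply: cvgN; have := cvg_comp _ _ a_cvg (c1 alpha); rewrite subr0; exact.
    - apply: cvgM; last exact: cvg_cst.
      by apply: cvgN; under eq_fun do rewrite subKr; exact: a_pow_cvg.
  have G0 : Gamma (alpha + 1) != 0 by rewrite gt_eqF// Gamma_alpha1_gt0.
  rewrite H /lnorm2 powR1 addr0 fact0 mul1r; field.
  by rewrite G0 lt0r_neq0.
have H : \int[mu]_(u in U) (n.+1%:R * beta_fun n u - (n.+1%:R + alpha) * beta_fun n.+1 u) = 0 - 0.
  apply: (@beta_FTC _ (fun u => u ^+ n.+1 * (1 - u) `^ alpha)).
  - move=> x /andP[x0 x1]; apply: (der_eq (der_mul (dexp n x) (der_pow1B alpha x1))).
    have -> : (1 - x) `^ alpha = (1 - x) * (1 - x) `^ (alpha - 1).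
      rewrite -[X in X * _]powRr1 ?subr_ge0 ?ltW// -powRD; last by rewrite subr_eq0 [_ == x]gt_eqF ?implybT.
      by congr (_ `^ _); ring.
    by rewrite /beta_fun exprS; ring.
  - move=> x /andP[_ x1]; apply: cvgB; apply: cvgM; do ?[exact: cvg_cst]; exact: beta_continuous.
  - by apply: intB => //; apply: intZ => //; exact: integrable_beta.
  - rewrite -(mul0r (1 `^ alpha)); apply: cvgM.
      have := cvg_comp _ _ a_cvg (der_continuous (dexp n 0)); rewrite expr0n/=; exact.
    by have := cvg_comp _ _ a_cvg (c1 alpha); rewrite subr0; exact.
  - rewrite -(mulr0 (1 ^+ n.+1)); apply: cvgM; last by under eq_fun do rewrite subKr; exact: a_pow_cvg.
    exact: (cvg_comp _ _ c2 (der_continuous (dexp n 1))).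
rewrite subr0 RintegralB// in H; [|by apply: intZ => //; exact: integrable_beta..].
rewrite !RintegralZl// ?ih in H; [|exact: integrable_beta..].
have n0 : (n.+1%:R + alpha : R) != 0 by rewrite gt_eqF// addr_gt0// ltr0n.
apply: (mulfI n0); move/eqP: H; rewrite subr_eq0 => /eqP <-.
rewrite /lnorm2.
have -> : alpha + n.+1%:R + 1 = (alpha + n%:R) + 1 + 1 by rewrite -natr1; ring.
rewrite GammaS; last by rewrite addr_ge0// ltW.
have G0 : Gamma (alpha + 1) != 0 by rewrite gt_eqF// Gamma_alpha1_gt0.
have G1 : Gamma (alpha + n%:R + 1) != 0 by rewrite gt_eqF// Gamma_gt0// addr_ge0// ltW.
have f0 : n`!%:R != 0 :> R by rewrite pnatr_eq0 -lt0n fact_gt0.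
rewrite factS natrM -natr1; rewrite -natr1 in n0; field.
have E : alpha + n%:R + 1 = n%:R + 1 + alpha by ring.
by rewrite G0 G1 f0 (lt0r_neq0 alpha0) E n0 natr1 pnatr_eq0.
Qed.

End beta_moments.

(** * The Bergman norm of a power series *)

Section bergman.
Context {R : realType}.
Variables (r alpha : R) (I : quat R).
Hypotheses (r0 : 0 < r) (alpha0 : 0 < alpha) (SI : usphere I).
Notation mu := (@lebesgue_measure R).
Notation L := (measurableTypeR R).
Notation P := (L * L)%type.
Notation nu := (plane_measure R).
Notation pt := (slice_pt I).
Notation W := (slice_weight r alpha I).
Notation ball rho := (slice_ball rho I).
Implicit Types (z : P) (a b c : quat R) (rho : R).

Lemma norm_slice_sqm z : `|pt z| ^+ 2 = sqm z.
Proof. exact: norm_slice_sq. Qed.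

Lemma slice_ballE rho z : 0 < rho -> ball rho z <-> sqm z < rho ^+ 2.
Proof.
move=> rho0; rewrite /slice_ball /qball/= -norm_slice_sqm.
by rewrite ltr_pXn2r// nnegrE// ltW.
Qed.

Lemma measurable_ball rho : 0 < rho -> measurable (ball rho : set P).
Proof.
move=> rho0; have H := measurable_sqm measurableT (measurable_itv `]-oo, rho ^+ 2[ : measurable (_ : set L)).
suff -> : ball rho = [set: P] `&` @sqm R @^-1` `]-oo, rho ^+ 2[%classic by exact: H.
by apply/seteqP; split => z; rewrite /= in_itv/=; [move/(slice_ballE _ rho0)|move=> [_ /(slice_ballE _ rho0)]].
Qed.

Lemma weightE z : W z = alpha / (pi * r ^+ 2) * (1 - sqm z / r ^+ 2) `^ (alpha - 1).
Proof. by rewrite /slice_weight norm_slice_sqm. Qed.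

Lemma weight_ge0 z : 0 <= W z.
Proof.
rewrite /slice_weight mulr_ge0 ?powR_ge0// divr_ge0 ?(ltW alpha0)// mulr_ge0 ?pi_ge0//.
by rewrite exprn_ge0// ltW.
Qed.

Lemma measurable_weight : measurable_fun [set: P] W.
Proof.
have -> : W = (fun z => alpha / (pi * r ^+ 2) * (1 - sqm z / r ^+ 2) `^ (alpha - 1)).
  by apply/funext => z; exact: weightE.
apply: measurable_funM => //; apply: measurableT_comp (measurable_powR _) _.
by apply: measurable_funB => //; apply: measurable_funM => //; exact: measurable_sqm.
Qed.

Lemma bergman_moment n :
  (\int[nu]_(z in ball r) (sqm z ^+ n * W z)%:E = (r ^+ (2 * n) / lnorm2 alpha n)%:E)%E.
Proof.
have r2 : 0 < r ^+ 2 by rewrite exprn_gt0.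
pose K := alpha / (pi * r ^+ 2).
have K0 : 0 <= K by rewrite divr_ge0 ?(ltW alpha0)// mulr_ge0 ?pi_ge0// ltW.
pose g (s : L) : R := s ^+ n * (K * (1 - s / r ^+ 2) `^ (alpha - 1)).
pose S : set L := `[0, r ^+ 2[%classic.
have mS : measurable S by exact: measurable_itv.
have mg : measurable_fun [set: L] g.
  apply: measurable_funM; first exact: measurable_funX.
  apply: measurable_funM => //; apply: measurableT_comp (measurable_powR _) _.
  by apply: measurable_funB => //; exact: measurable_funM.
pose f := g \_ S.
have mf : measurable_fun [set: L] f by apply/(measurable_restrictT _ mS); exact: measurable_funTS.
have f0 s : 0 <= f s.
  rewrite /f /patch; case: ifP => //; rewrite inE /S/= in_itv/= => /andP[s0 _].
  by rewrite /g mulr_ge0 ?exprn_ge0// mulr_ge0// powR_ge0.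
transitivity (\int[nu]_z (f (sqm z))%:E)%E.
  rewrite integral_mkcond; apply: eq_integral => z _; rewrite /f /patch.
  have -> : (sqm z \in S) = (z \in ball r).
    apply/idP/idP; rewrite !inE.
      by rewrite /S /= in_itv/= => /andP[_ h]; apply/(slice_ballE _ r0).
    by move/(slice_ballE _ r0) => h; rewrite /S /= in_itv/= sqm_ge0.
  by case: ifP => // _; rewrite weightE.
rewrite radial_integral//.
pose h := f \_ (`]0, +oo[%classic : set L).
have mh : measurable_fun [set: L] (EFin \o h).
  apply/measurable_EFinP; apply/(measurable_restrictT _ (measurable_itv _)); exact: measurable_funTS.
have h0 (s : L) : (0 <= (h s)%:E)%E by rewrite lee_fin /h /patch; case: ifP.
have -> : (\int[mu]_(s in `]0%R, +oo[) (f s)%:E = \int[mu]_s (h s)%:E)%E.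
  by rewrite integral_mkcond; apply: eq_integral => s _; rewrite /h /patch; case: ifP.
have := leb_affine 0 r2 mh h0 => A.
have {}A : (\int[mu]_s (h s)%:E = (r ^+ 2)%:E * \int[mu]_x (h (r ^+ 2 * x + 0)%R)%:E)%E.
  by rewrite A muleA -EFinM mulfV ?mul1e// gt_eqF.
rewrite A.
have -> : (\int[mu]_x (h (r ^+ 2 * x + 0)%R)%:E =
    \int[mu]_(x in `]0%R, 1%R[) ((r ^+ (2 * n) * K)%:E * (beta_fun alpha n x)%:E))%E.
  rewrite [RHS]integral_mkcond; apply: eq_integral => u _.
  rewrite addr0 /h /f /S !patchE.
  have -> : (r ^+ 2 * u \in `]0, +oo[%classic) = (0 < u).
    by rewrite mem_setE in_itv/= andbT pmulr_rgt0.
  have -> : (r ^+ 2 * u \in `[0, r ^+ 2[%classic) = (0 <= u < 1).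
    by rewrite mem_setE in_itv/= pmulr_rge0// -[X in _ < X]mulr1 ltr_pM2l.
  have -> : (u \in `]0, 1[%classic) = (0 < u < 1) by rewrite mem_setE in_itv.
  case: ifPn => [u0|]; last by move=> _; rewrite andFb.
  rewrite (ltW u0)/=; case: ifPn => // u1.
  rewrite /g /beta_fun -EFinM; congr (_%:E).
  have -> : r ^+ 2 * u / r ^+ 2 = u by rewrite mulrAC mulfV ?mul1r// gt_eqF.
  by rewrite exprMn -exprM; ring.
have bi := integrable_beta alpha0 n.
rewrite (integralZl _ bi)//.
have -> : (\int[mu]_(x in `]0%R, 1%R[) (EFin \o beta_fun alpha n) x = ((alpha * lnorm2 alpha n)^-1)%:E)%E.
  by rewrite -beta_moment// /Rintegral fineK//; exact: integrable_fin_num.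
rewrite -!EFinM; congr (_%:E); rewrite /K.
move: (@pi R) (@pi_gt0 R) => p p0; field.
by rewrite !gt_eqF ?lnorm2_gt0.
Qed.

Lemma measurable_sqmX n : measurable_fun [set: P] (fun z => sqm z ^+ n).
Proof. by apply: measurable_funX; exact: measurable_sqm. Qed.

Let mball : measurable (ball r : set P). Proof. exact: measurable_ball. Qed.

Lemma integrable_moment n : nu.-integrable (ball r) (EFin \o (fun z => sqm z ^+ n * W z)).
Proof.
apply/integrableP; split.
  apply/measurable_EFinP; apply: measurable_funTS; apply: measurable_funM.
    exact: measurable_sqmX.
  exact: measurable_weight.
rewrite (eq_integral (fun z : P => (sqm z ^+ n * W z)%:E)); last first.
  by move=> z _ /=; rewrite ger0_norm// mulr_ge0 ?exprn_ge0 ?sqm_ge0 ?weight_ge0.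
by rewrite bergman_moment ltry.
Qed.

Lemma integrable_bounded (F : P -> R) (K : R) : measurable_fun [set: P] F ->
  (forall z, ball r z -> `|F z| <= K) -> nu.-integrable (ball r) (EFin \o (fun z => F z * W z)).
Proof.
move=> mF FK; have Wi : nu.-integrable (ball r) (EFin \o W).
  have := integrable_moment 0; congr integrable; apply/funext => z /=.
  by rewrite expr0 mul1r.
apply: (int_le mball _ _ (intZ mball K Wi)).
  by apply: measurable_funTS; apply: measurable_funM => //; exact: measurable_weight.
by move=> z Dz; rewrite normrM (ger0_norm (weight_ge0 z)) ler_wpM2r ?weight_ge0 ?FK.
Qed.

Lemma subball rho : rho <= r -> ball rho `<=` ball r.
Proof. by move=> h z; rewrite /slice_ball/qball/= => /lt_le_trans; apply. Qed.

Lemma measurable_monomial n b c : measurable_fun [set: P] (fun z => qre (c * (pt z ^+ n * b))).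
Proof.
elim: n c => [|n ih] c; first by under eq_fun do rewrite expr0; exact: measurable_cst.
have -> : (fun z => qre (c * (pt z ^+ n.+1 * b))) =
  (fun z => z.1 * qre (c * (pt z ^+ n * b)) + z.2 * qre (c * I * (pt z ^+ n * b))).
  apply/funext => z; rewrite exprS -[pt z * _ * b]mulrA; move: (pt z ^+ n * b) => q.
  by rewrite /slice_pt/= ; ring.
by apply: measurable_funD; apply: measurable_funM.
Qed.

Lemma measurable_psum (a : nat -> quat R) N c :
  measurable_fun [set: P] (fun z => qre (c * psum a (pt z) N)).
Proof.
have -> : (fun z => qre (c * psum a (pt z) N)) =
    (fun z => \sum_(n < N) qre (c * (pt z ^+ n * a n))).
  apply/funext => z; rewrite /psum mulr_sumr.
  by have [-> _ _ _] := q_sum_comp N (fun n => c * (pt z ^+ n * a n)).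
elim: N => [|N ih]; first by under eq_fun do rewrite big_ord0; exact: measurable_cst.
under eq_fun do rewrite big_ord_recr/=.
by apply: measurable_funD => //; exact: measurable_monomial.
Qed.

Lemma qmeasurable_pair (D : set P) (f g : P -> quat R) : qmeasurable D f -> qmeasurable D g ->
  measurable_fun D (fun z => qre (qconj (f z) * g z)).
Proof.
move=> [f1 f2 f3 f4] [g1 g2 g3 g4].
have -> : (fun z => qre (qconj (f z) * g z)) = (fun z => qre (f z) * qre (g z) + qi (f z) * qi (g z)
   + qj (f z) * qj (g z) + qk (f z) * qk (g z)) by apply/funext => z /=; ring.
by apply: measurable_funD; [apply: measurable_funD; [apply: measurable_funD|]|]; apply: measurable_funM.
Qed.

Lemma qre_conj_norm (q : quat R) : qre (qconj q * q) = `|q| ^+ 2.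
Proof. by rewrite qnormsq /=; ring. Qed.

Lemma qmeasurable_norm (D : set P) (f : P -> quat R) : qmeasurable D f ->
  measurable_fun D (fun z => `|f z| ^+ 2).
Proof. by move=> mf; under eq_fun do rewrite -qre_conj_norm; exact: qmeasurable_pair. Qed.

Lemma pt_rot th z : pt (rot th z) = cisq I th * pt z.
Proof. by rewrite /cisq slice_ptM// /rot /lin2/=; congr (slice_pt I (_, _)); ring. Qed.

Lemma qconjM (p q : quat R) : qconj (p * q) = qconj q * qconj p.
Proof. by apply: quatP => /=; ring. Qed.

Lemma qconj_cisq th : qconj (cisq I th) = cisq I (- th).
Proof.
have h0 := usphere_re SI.
by rewrite /cisq /slice_pt cosN sinN; apply: quatP => /=; rewrite ?h0; ring.
Qed.

Lemma sqm_rot th z : sqm (rot th z) = sqm z.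
Proof. by rewrite -!norm_slice_sqm pt_rot qnormM cisq_norm// mul1r. Qed.

Lemma weight_rot th z : W (rot th z) = W z.
Proof. by rewrite !weightE sqm_rot. Qed.

Lemma pt_rotX th n z : pt (rot th z) ^+ n = cisq I (n%:R * th) * pt z ^+ n.
Proof. by rewrite pt_rot exprMn_comm ?cisqX//; exact: slice_ptC. Qed.

Lemma qconj_qreC (p q : quat R) : qre (qconj p * q) = qre (qconj q * p).
Proof. by move=> /=; ring. Qed.

(** The rotation by pi/(n - m) preserves the disc and the weight and multiplies the
    conjugate of q^m times q^n by -1. *)
Lemma cross_zero rho m n a b : 0 < rho -> m != n ->
  \int[nu]_(z in ball rho) (qre (qconj (pt z ^+ m * a) * (pt z ^+ n * b)) * W z) = 0.
Proof.
move=> rho0; wlog mn : m n a b / (m < n)%N.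
  move=> H; rewrite neq_ltn => /orP[mn|nm]; first by apply: H => //; rewrite ltn_eqF.
  by under eq_Rintegral do rewrite qconj_qreC; apply: H => //; rewrite ltn_eqF.
move=> _; pose k := (n - m)%N; have k0 : (0 < k)%N by rewrite subn_gt0.
have k1 : 1 <= k%:R :> R by rewrite ler1n.
pose th : R := pi / k%:R.
have kth : k%:R * th = pi by rewrite /th mulrCA mulfV ?mulr1// pnatr_eq0 -lt0n.
apply: (@plane_odd_in R th).
- rewrite /th ger0_norm ?divr_ge0 ?pi_ge0// ler_pdivrMr ?(lt_le_trans _ k1)//.
  by rewrite ler_peMr ?pi_ge0.
- exact: measurable_ball.
- apply: measurable_funM; last exact: measurable_weight.
  by apply: qmeasurable_pair; apply: functional_qmeasurable => c; exact: measurable_monomial.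
- by move=> z; rewrite !slice_ballE// sqm_rot.
move=> z; rewrite weight_rot -mulNr; congr (_ * _).
rewrite !pt_rotX -!mulrA qconjM -mulrA qconj_cisq (mulrA (cisq I _)) -cisqD//.
have -> : - (m%:R * th) + n%:R * th = pi.
  by rewrite -kth /k natrB 1?ltnW//; ring.
have -> : cisq I pi = -1.
  by rewrite /cisq cospi sinpi /slice_pt/= scale0r addr0 scaleN1r.
by rewrite mulN1r mulrN.
Qed.

(** The squared norm of the n-th power on the disc of radius rho, for the weight of
    the disc of radius r. *)
Definition mom rho n : R := \int[nu]_(z in ball rho) (sqm z ^+ n * W z).

Lemma mom_r n : mom r n = r ^+ (2 * n) / lnorm2 alpha n.
Proof. by rewrite /mom /Rintegral bergman_moment. Qed.

Lemma pt_bound z : ball r z -> `|pt z| <= r.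
Proof. by rewrite /slice_ball/qball/= => /ltW. Qed.

Lemma psum_bound (a : nat -> quat R) N z (s : R) : `|pt z| <= s ->
  `|psum a (pt z) N| <= \sum_(n < N) `|a n| * s ^+ n.
Proof.
move=> zs; rewrite /psum; apply: (le_trans (ler_norm_sum _ _ _)); apply: ler_sum => n _.
rewrite qnormM qnormX mulrC ler_wpM2l// lerXn2r ?nnegrE//.
exact: le_trans zs.
Qed.

Lemma qmeas_psum (a : nat -> quat R) N : qmeasurable [set: P] (fun z => psum a (pt z) N).
Proof. by apply: functional_qmeasurable => c; exact: measurable_psum. Qed.

Lemma integrable_psum (a : nat -> quat R) N :
  nu.-integrable (ball r) (EFin \o (fun z => `|psum a (pt z) N| ^+ 2 * W z)).
Proof.
apply: (@integrable_bounded _ ((\sum_(n < N) `|a n| * r ^+ n) ^+ 2)).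
  by apply: qmeasurable_norm; exact: qmeas_psum.
move=> z /pt_bound zr; rewrite ger0_norm ?exprn_ge0//.
by rewrite lerXn2r ?nnegrE ?sumr_ge0 ?psum_bound// => n _; rewrite mulr_ge0// exprn_ge0// ltW.
Qed.

Lemma poly_norm (a : nat -> quat R) N rho : 0 < rho -> rho <= r ->
  \int[nu]_(z in ball rho) (`|psum a (pt z) N| ^+ 2 * W z) = \sum_(n < N) `|a n| ^+ 2 * mom rho n.
Proof.
move=> rho0 rhor; have mb := measurable_ball rho0.
have sub := subball rhor.
have S (F : P -> R) : nu.-integrable (ball r) (EFin \o F) -> nu.-integrable (ball rho) (EFin \o F).
  by move=> Fi; exact: integrableS Fi.
have cross_i n N' : nu.-integrable (ball r)
    (EFin \o (fun z => qre (qconj (pt z ^+ n * a n) * (pt z ^+ N' * a N')) * W z)).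
  apply: (@integrable_bounded _ (r ^+ n * `|a n| * (r ^+ N' * `|a N'|))).
    by apply: qmeasurable_pair; apply: functional_qmeasurable => c; exact: measurable_monomial.
  move=> z /pt_bound zr; apply: (le_trans (qre_le _)); rewrite qnormM.
  have -> : `|qconj (pt z ^+ n * a n)| = `|pt z ^+ n * a n|.
    by rewrite !qnormE /=; congr Num.sqrt; ring.
  rewrite !qnormM !qnormX; apply: ler_pM; rewrite ?mulr_ge0 ?exprn_ge0// ler_wpM2r// lerXn2r ?nnegrE//; exact: ltW.
elim: N => [|N ih].
  rewrite big_ord0; under eq_Rintegral do rewrite /psum big_ord0 normr0 expr0n mul0r.
  by rewrite /Rintegral integral0.
have E z : `|psum a (pt z) N.+1| ^+ 2 * W z =
    `|psum a (pt z) N| ^+ 2 * W z + `|a N| ^+ 2 * (sqm z ^+ N * W z) +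
    2 * \sum_(n < N) (qre (qconj (pt z ^+ n * a n) * (pt z ^+ N * a N)) * W z).
  rewrite /psum big_ord_recr/=.
  have nD (p q : quat R) : `|p + q| ^+ 2 = `|p| ^+ 2 + `|q| ^+ 2 + 2 * qre (qconj p * q).
    by rewrite !qnormsq /=; ring.
  rewrite nD qnormM exprMn qnormX exprAC norm_slice_sqm -mulr_suml.
  have -> : qre (qconj (\sum_(n < N) pt z ^+ n * a n) * (pt z ^+ N * a N)) =
     \sum_(n < N) qre (qconj (pt z ^+ n * a n) * (pt z ^+ N * a N)).
    elim: N {ih} (pt z ^+ N * a N) => [|N ihN] q; first by rewrite !big_ord0 /=; ring.
    by rewrite !big_ord_recr -ihN /=; ring.
  by ring.
under eq_Rintegral do rewrite E.
have i1 := S _ (integrable_psum a N).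
have i2 := intZ mb (`|a N| ^+ 2) (S _ (integrable_moment N)).
have i3 : nu.-integrable (ball rho) (EFin \o (fun z => \sum_(n < N)
    (qre (qconj (pt z ^+ n * a n) * (pt z ^+ N * a N)) * W z))).
  by apply: (@int_sum _ _ _ nu _ mb N (fun n z => qre (qconj (pt z ^+ n * a n) * (pt z ^+ N * a N)) * W z)) => n; exact: S.
rewrite RintegralD//; [|exact: intD|exact: intZ].
rewrite RintegralD// ih big_ord_recr/= -[RHS]addr0; congr (_ + _ + _).
  by rewrite RintegralZl//; exact: S (integrable_moment N).
rewrite RintegralZl//.
rewrite (@Rintegral_sum _ _ _ nu _ mb N (fun n z => qre (qconj (pt z ^+ n * a n) * (pt z ^+ N * a N)) * W z)).
  rewrite big1 ?mulr0// => n _; apply: cross_zero => //.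
  by rewrite ltn_eqF.
by move=> n; exact: S.
Qed.

Section power_series_norm.
Variables (f : quat R -> quat R) (a : nat -> quat R).
Hypothesis fa : ps_on f a r.

Lemma qmeasurable_ps : qmeasurable (ball r) (fun z => f (pt z)).
Proof.
apply: functional_qmeasurable => c.
apply: (@measurable_fun_cvg _ _ _ _ (fun N z => qre (c * psum a (pt z) N))).
  by move=> N; apply: measurable_funTS; exact: measurable_psum.
by move=> z zr; apply: qre_cvg; apply: qmul_cvg; [exact: cvg_cst|exact: fa].
Qed.

Let mn : measurable_fun (ball r) (fun z => `|f (pt z)| ^+ 2 * W z).
Proof.
apply: measurable_funM; last by apply: measurable_funTS; exact: measurable_weight.
by apply: qmeasurable_norm; exact: qmeasurable_ps.
Qed.

Let norm_cvg z : ball r z -> `|psum a (pt z) N| ^+ 2 * W z @[N --> \oo] --> `|f (pt z)| ^+ 2 * W z.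
Proof.
move=> zr; apply: cvgM; last exact: cvg_cst.
have H : `|psum a (pt z) N| @[N --> \oo] --> `|f (pt z)| by apply: cvg_norm; exact: fa.
by apply: cvgM.
Qed.

(** Fatou's lemma applied to the partial sums. *)
Lemma bergman_le (M : R) : (forall N, \sum_(n < N) `|a n| ^+ 2 * mom r n <= M) ->
  (\int[nu]_(z in ball r) (`|f (pt z)| ^+ 2 * W z)%:E <= M%:E)%E.
Proof.
move=> HM; have g0 (q : quat R) z : 0 <= `|q| ^+ 2 * W z by rewrite mulr_ge0 ?exprn_ge0 ?weight_ge0.
apply: (@fatou_le _ _ _ nu _ mball (fun N z => (`|psum a (pt z) N| ^+ 2 * W z)%:E)).
- move=> N; apply/measurable_EFinP; apply: measurable_funTS; apply: measurable_funM.
    by apply: qmeasurable_norm; exact: qmeas_psum.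
  exact: measurable_weight.
- by move=> N z _; rewrite lee_fin g0.
- exact/measurable_EFinP.
- by move=> z _; rewrite lee_fin g0.
- by apply: aeW => z zr; apply: cvg_EFin; [exact: nearW|exact: norm_cvg].
move=> N; have i1 := integrable_psum a N.
rewrite -(fineK (integrable_fin_num mball i1)) lee_fin.
by have := poly_norm a N r0 (lexx r); rewrite /Rintegral => ->; exact: HM.
Qed.

(** On a smaller disc the partial sums are uniformly bounded, so their norms
    converge to the norm of the sum. *)
Let subdisc rho N : 0 < rho -> rho < r ->
  nu.-integrable (ball r) (EFin \o (fun z => `|f (pt z)| ^+ 2 * W z)) ->
  \sum_(n < N) `|a n| ^+ 2 * mom rho n <= \int[nu]_(z in ball r) (`|f (pt z)| ^+ 2 * W z).
Proof.
move=> rho0 rhor fi; have mb := measurable_ball rho0.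
have sub := subball (ltW rhor).
have rr : 0 < rho < r by rewrite rho0.
have [B B0 HB] := ps_dom_sum (ps_on_dom fa) rr.
have Wi : nu.-integrable (ball rho) (EFin \o (fun z => B ^+ 2 * W z)).
  apply: (integrableS mball mb sub); apply: (@integrable_bounded _ `|B ^+ 2|); first exact: measurable_cst.
  by move=> z _.
have [||||fi' H] := @dominated_Rintegral _ _ _ nu _ mb (fun N z => `|psum a (pt z) N| ^+ 2 * W z)
    (fun z => `|f (pt z)| ^+ 2 * W z) (fun z => B ^+ 2 * W z) _ _ _ _ Wi.
- move=> M; apply: measurable_funTS; apply: measurable_funM; last exact: measurable_weight.
  by apply: qmeasurable_norm; exact: qmeas_psum.
- exact: (measurable_funS mball sub mn).
- by apply: aeW => z zr; apply: norm_cvg; exact: sub.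
- move=> M z zr; have w0 := weight_ge0 z.
  rewrite ger0_norm; last by rewrite mulr_ge0// exprn_ge0.
  apply: ler_wpM2r; first exact: w0.
  rewrite lerXn2r ?nnegrE//; apply: le_trans (HB M); apply: psum_bound.
  by move: zr; rewrite /slice_ball/qball/= => /ltW.
have mom0 n : 0 <= mom rho n.
  by apply: Rintegral_ge0 => z _; rewrite mulr_ge0 ?exprn_ge0 ?sqm_ge0 ?weight_ge0.
apply: (@le_trans _ _ (\int[nu]_(z in ball rho) (`|f (pt z)| ^+ 2 * W z))).
  rewrite -(cvg_lim _ H)//; apply: limr_ge; first exact/cvgP/H.
  near=> M; rewrite (poly_norm a M rho0 (ltW rhor)).
  have NM : (N <= M)%N by near: M; exact: nbhs_infty_ge.
  rewrite -!(big_mkord xpredT (fun n => `|a n| ^+ 2 * mom rho n)) (big_cat_nat (leq0n N) NM)/=.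
  by rewrite lerDl sumr_ge0// => n _; rewrite mulr_ge0 ?exprn_ge0.
have iS := integrableS mball mb sub fi.
rewrite -lee_fin /Rintegral !fineK ?integrable_fin_num//.
apply: ge0_subset_integral => //; first exact/measurable_EFinP.
by move=> z _; rewrite lee_fin mulr_ge0 ?exprn_ge0 ?weight_ge0.
Unshelve. all: by end_near. Qed.

(** The radius rho in subdisc tends to r, for a fixed number of terms. *)
Lemma bergman_ge N : nu.-integrable (ball r) (EFin \o (fun z => `|f (pt z)| ^+ 2 * W z)) ->
  \sum_(n < N) `|a n| ^+ 2 * mom r n <= \int[nu]_(z in ball r) (`|f (pt z)| ^+ 2 * W z).
Proof.
move=> fi; pose rh (k : nat) : R := r * (1 - k.+2%:R^-1).
have kk (k : nat) : 0 < (k.+2%:R : R)^-1 < 1.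
  by rewrite invr_gt0 ltr0n/= invf_lt1 ?ltr0n// ltr1n.
have rh0 k : 0 < rh k by rewrite mulr_gt0// subr_gt0; case/andP: (kk k).
have rhr k : rh k < r by rewrite -[ltRHS]mulr1 ltr_pM2l// gtrBl; case/andP: (kk k).
have rhc : rh k @[k --> \oo] --> r.
  suff : rh k @[k --> \oo] --> r * (1 - 0) by rewrite subr0 mulr1.
  apply: cvgM; first exact: cvg_cst.
  apply: cvgB; first exact: cvg_cst.
  have := @cvg_harmonic R; rewrite -(cvg_shiftn 1) => H.
  suff -> : (fun k : nat => k.+2%:R^-1 : R) = (fun k => harmonic (k + 1)%N) by exact: H.
  by apply/funext => k; rewrite /harmonic/= addn1.
have H : (\sum_(n < N) `|a n| ^+ 2 * mom (rh k) n) @[k --> \oo] --> \sum_(n < N) `|a n| ^+ 2 * mom r n.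
  elim: (N) => [|m ih].
    by under eq_fun do rewrite big_ord0; rewrite big_ord0; exact: cvg_cst.
  under eq_fun do rewrite big_ord_recr/=; rewrite big_ord_recr/=.
  apply: cvgD; first exact: ih.
  apply: cvgM; first exact: cvg_cst.
  apply: (@cvg_Rintegral_exhaust _ _ _ nu _ mball (fun k => ball (rh k))).
  - by move=> k; exact: measurable_ball.
  - by move=> k; exact/subball/ltW.
  - by move=> z; rewrite /slice_ball/qball/= => zr; exact: (cvgr_gt _ rhc).
  - exact: integrable_moment.
rewrite -(cvg_lim _ H)//; apply: limr_le; first exact/cvgP/H.
by apply: nearW => k; exact: subdisc.
Qed.

End power_series_norm.

End bergman.

(** * Quaternion-valued L2 functions and their coefficients *)

Section quaternionic_L2.
Context d (T : measurableType d) {R : realType} (mu : {measure set T -> \bar R}).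
Context (D : set T) (mD : measurable D) (w : T -> R).
Context (mw : measurable_fun D w) (w0 : forall x, D x -> 0 <= w x).
Implicit Types (f g : T -> quat R) (c : quat R).
Notation S := (sqi mu D w).
Notation "<< u , v >>" := (ip mu D w u v).

(** Square integrability stated through all real functionals: this form is stable
    under multiplication by constants on both sides. *)
Definition qL2 f := forall c, S (fun x => qre (c * f x)).

Lemma qL2_comp f : qL2 f ->
  [/\ S (fun x => qre (f x)), S (fun x => qi (f x)), S (fun x => qj (f x)) & S (fun x => qk (f x))].
Proof.
exact: (functional_components (Pr := S)).
Qed.

Lemma qL2_of_comp f : S (fun x => qre (f x)) -> S (fun x => qi (f x)) -> S (fun x => qj (f x)) ->
  S (fun x => qk (f x)) -> qL2 f.
Proof.
move=> h1 h2 h3 h4 c.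
have -> : (fun x => qre (c * f x)) = (fun x => qre c * qre (f x) + (- qi c) * qi (f x)
   + (- qj c) * qj (f x) + (- qk c) * qk (f x)) by apply/funext => x /=; ring.
by do 3! [apply: (sqiD mD mw w0); last exact: sqiZ]; exact: sqiZ.
Qed.

Lemma qL2_norm f : qL2 f -> mu.-integrable D (EFin \o (fun x => `|f x| ^+ 2 * w x)) /\
  \int[mu]_(x in D) (`|f x| ^+ 2 * w x) =
  << (fun x => qre (f x)), (fun x => qre (f x)) >> + << (fun x => qi (f x)), (fun x => qi (f x)) >>
  + << (fun x => qj (f x)), (fun x => qj (f x)) >> + << (fun x => qk (f x)), (fun x => qk (f x)) >>.
Proof.
move=> /qL2_comp[[_ h1] [_ h2] [_ h3] [_ h4]].
have E x : `|f x| ^+ 2 * w x = qre (f x) ^+ 2 * w x + qi (f x) ^+ 2 * w x +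
   qj (f x) ^+ 2 * w x + qk (f x) ^+ 2 * w x by rewrite qnormsq; ring.
have i2 := intD mD h1 h2; have i3 := intD mD i2 h3; have i4 := intD mD i3 h4.
split; first by move: i4; congr integrable; apply/funext => x /=; rewrite E.
under eq_Rintegral do rewrite E.
by rewrite !RintegralD.
Qed.

Lemma L2_qL2 f : L2_mem mu D w f <-> qL2 f.
Proof.
split=> [[mf fi] c|H]; last first.
  have [h1 h2 h3 h4] := qL2_comp H; have [i _] := qL2_norm H.
  split; first by case: h1 => ? _; case: h2 => ? _; case: h3 => ? _; case: h4 => ? _.
  have /integrableP[_] := i; apply: le_lt_trans.
  apply: ge0_le_integral => //.
  - by move=> x Dx; rewrite lee_fin mulr_ge0 ?exprn_ge0 ?w0.
  - exact: measurable_int i.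
  - by apply/measurableT_comp => //; exact: measurable_int i.
  - by move=> x Dx /=; rewrite lee_fin ler_norm.
have mn : measurable_fun D (fun x => `|f x| ^+ 2 * w x).
  apply: measurable_funM => //; case: mf => h1 h2 h3 h4.
  under eq_fun do rewrite qnormsq.
  by do 3! [apply: measurable_funD; last exact: measurable_funX]; exact: measurable_funX.
have i : mu.-integrable D (EFin \o (fun x => `|f x| ^+ 2 * w x)).
  apply/integrableP; split; first exact/measurable_EFinP.
  apply: le_lt_trans fi; apply: ge0_le_integral => //.
  - by apply/measurableT_comp => //; exact/measurable_EFinP.
  - exact/measurable_EFinP.
  - by move=> x Dx /=; rewrite lee_fin ger0_norm// mulr_ge0 ?exprn_ge0 ?w0.
have mc : measurable_fun D (fun x => qre (c * f x)).
  case: mf => h1 h2 h3 h4.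
  have -> : (fun x => qre (c * f x)) = (fun x => qre c * qre (f x) + (- qi c) * qi (f x)
   + (- qj c) * qj (f x) + (- qk c) * qk (f x)) by apply/funext => x /=; ring.
  by do 3! [apply: measurable_funD; last exact: measurable_funM]; exact: measurable_funM.
split=> //; apply: (int_le mD _ _ (intZ mD (`|c| ^+ 2) i)).
  by apply: measurable_funM => //; exact: measurable_funX.
move=> x Dx; rewrite ger0_norm; last by rewrite mulr_ge0 ?sqr_ge0 ?w0.
rewrite mulrA; apply: ler_wpM2r; first exact: w0.
by rewrite -exprMn -qnormM -(real_normK (num_real (qre _))) lerXn2r ?nnegrE// qre_le.
Qed.

Lemma L2_norm_sqr f : L2_norm mu D w f ^+ 2 = \int[mu]_(x in D) (`|f x| ^+ 2 * w x).
Proof.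
by rewrite sqr_sqrtr//; apply: Rintegral_ge0 => x Dx; rewrite mulr_ge0 ?exprn_ge0 ?w0.
Qed.

Section coefficients.
Variable e : nat -> T -> R.
Hypotheses (se : forall n, S (e n)) (oe : forall m n, << e m, e n >> = (m == n)%:R).
Hypotheses (wi : mu.-integrable D (EFin \o w)) (ce : complete_system mu D w e).

(** The inner product of f with the real function e n, coordinate by coordinate. *)
Definition qcoef f n : quat R :=
  Quat << (fun x => qre (f x)), e n >> << (fun x => qi (f x)), e n >>
       << (fun x => qj (f x)), e n >> << (fun x => qk (f x)), e n >>.

Lemma qre_qcoef f c n : qL2 f -> qre (c * qcoef f n) = << (fun x => qre (c * f x)), e n >>.
Proof.
move=> /qL2_comp[h1 h2 h3 h4].
have -> : (fun x => qre (c * f x)) = (fun x => qre c * qre (f x) + (- qi c) * qi (f x)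
   + (- qj c) * qj (f x) + (- qk c) * qk (f x)) by apply/funext => x /=; ring.
have Z k u : S u -> S (fun x => k * u x) by exact: sqiZ.
have Dd u v : S u -> S v -> S (fun x => u x + v x) by exact: (sqiD mD mw w0).
rewrite (ipDl mD mw w0 (Dd _ _ (Dd _ _ (Z _ _ h1) (Z _ _ h2)) (Z _ _ h3)) (Z _ _ h4) (se n)).
rewrite (ipDl mD mw w0 (Dd _ _ (Z _ _ h1) (Z _ _ h2)) (Z _ _ h3) (se n)).
rewrite (ipDl mD mw w0 (Z _ _ h1) (Z _ _ h2) (se n)).
rewrite !(ipZl mD mw w0)//=; ring.
Qed.

Let qnormsq_coef f N : \sum_(n < N) `|qcoef f n| ^+ 2 =
  \sum_(n < N) << (fun x => qre (f x)), e n >> ^+ 2 + \sum_(n < N) << (fun x => qi (f x)), e n >> ^+ 2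
  + \sum_(n < N) << (fun x => qj (f x)), e n >> ^+ 2 + \sum_(n < N) << (fun x => qk (f x)), e n >> ^+ 2.
Proof. by rewrite -!big_split/=; apply: eq_bigr => n _; rewrite qnormsq. Qed.

Lemma qparseval f : qL2 f ->
  \sum_(n < N) `|qcoef f n| ^+ 2 @[N --> \oo] --> L2_norm mu D w f ^+ 2.
Proof.
move=> H; have [h1 h2 h3 h4] := qL2_comp H; have [_ E] := qL2_norm H.
rewrite L2_norm_sqr E; under eq_fun do rewrite qnormsq_coef.
by apply: cvgD; [apply: cvgD; [apply: cvgD|]|]; apply: (parseval_complete mD mw w0 se oe wi ce).
Qed.

Lemma qbessel f N : qL2 f -> \sum_(n < N) `|qcoef f n| ^+ 2 <= L2_norm mu D w f ^+ 2.
Proof.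
move=> H; have [h1 h2 h3 h4] := qL2_comp H; have [_ E] := qL2_norm H.
by rewrite L2_norm_sqr E qnormsq_coef; do !apply: lerD; apply: (bessel mD mw w0 se oe).
Qed.

(** Pythagoras for the orthogonal projection to the span of the first N elements of
    the family. *)
Lemma qdist f N : qL2 f ->
  L2_norm mu D w (fun x => f x - \sum_(k < N) (e k x)%:A * qcoef f k) ^+ 2 =
  L2_norm mu D w f ^+ 2 - \sum_(k < N) `|qcoef f k| ^+ 2.
Proof.
move=> H; have [h1 h2 h3 h4] := qL2_comp H; have [_ E] := qL2_norm H.
have sc (b : nat -> R) := @sqi_comb _ _ _ mu D mD w mw w0 e se b N.
pose g x := f x - \sum_(k < N) (e k x)%:A * qcoef f k.
have C (p : quat R -> R) : (forall x y, p (x - y) = p x - p y) ->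
   (forall F : nat -> quat R, p (\sum_(k < N) F k) = \sum_(k < N) p (F k)) -> (forall k x, p (k *: x) = k * p x) ->
   (fun x => p (g x)) = (fun x => p (f x) - comb e (fun k => p (qcoef f k)) N x).
  move=> pB pS pZ; apply/funext => x; rewrite /g pB (pS (fun k => (e k x)%:A * qcoef f k)) /comb; congr (_ - _).
  by apply: eq_bigr => k _; rewrite -scalerAl mul1r pZ mulrC.
have c1 := C (@qre R) (fun _ _ => erefl) (fun F => let: And4 e _ _ _ := q_sum_comp N F in e) (fun _ _ => erefl).
have c2 := C (@qi R) (fun _ _ => erefl) (fun F => let: And4 _ e _ _ := q_sum_comp N F in e) (fun _ _ => erefl).
have c3 := C (@qj R) (fun _ _ => erefl) (fun F => let: And4 _ _ e _ := q_sum_comp N F in e) (fun _ _ => erefl).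
have c4 := C (@qk R) (fun _ _ => erefl) (fun F => let: And4 _ _ _ e := q_sum_comp N F in e) (fun _ _ => erefl).
have B u (b : nat -> R) : S u -> S (fun x => u x - comb e b N x) by move=> su; exact: (sqiB mD mw w0 su (sc b)).
have gL : qL2 g by apply: qL2_of_comp; rewrite ?c1 ?c2 ?c3 ?c4; exact: B.
have [_ Eg] := qL2_norm gL.
rewrite !L2_norm_sqr Eg E c1 c2 c3 c4.
rewrite !(ip_sub_comb mD mw w0 se oe N _ _)// qnormsq_coef/=; ring.
Qed.

Lemma qriesz (b : nat -> quat R) (M : R) : (forall N, \sum_(n < N) `|b n| ^+ 2 <= M) ->
  exists f, qL2 f /\ forall n, qcoef f n = b n.
Proof.
move=> bM.
have K (p : quat R -> R) : (forall q, `|p q| <= `|q|) ->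
    exists psi, S psi /\ forall n, << psi, e n >> = p (b n).
  move=> pb; pose s N := \sum_(n < N) p (b n) ^+ 2.
  have sE : s = series (fun n => p (b n) ^+ 2).
    by apply/funext => N; rewrite /s /series/= big_mkord.
  have sc : cvgn s.
    apply: nondecreasing_is_cvgn; first by rewrite sE; apply: nondecreasing_series => n _ _; exact: sqr_ge0.
    exists M => _ [N _ <-]; apply: le_trans (bM N); apply: ler_sum => n _.
    by rewrite -(real_normK (num_real (p _))) lerXn2r ?nnegrE.
  have [psi [spsi Hpsi]] := @riesz_fischer _ _ _ mu D mD w mw w0 e se oe (fun n => p (b n)) (limn s) wi sc.
  exists psi; split=> // n.
  exact: (riesz_fischer_coef mD mw w0 se oe spsi sc Hpsi).
have [p1 [s1 e1]] := K _ (@qre_le R); have [p2 [s2 e2]] := K _ (@qi_le R).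
have [p3 [s3 e3]] := K _ (@qj_le R); have [p4 [s4 e4]] := K _ (@qk_le R).
exists (fun x => Quat (p1 x) (p2 x) (p3 x) (p4 x)); split; first exact: qL2_of_comp.
by move=> n; apply: quatP; rewrite /= ?e1 ?e2 ?e3 ?e4.
Qed.

End coefficients.
End quaternionic_L2.

(** * The operator as a power series *)

Lemma polar_right {R : realType} (X Y : R) : 0 < X ->
  exists m th : R, [/\ 0 < m, `|th| < pi / 2, m * cos th = X & m * sin th = Y].
Proof.
move=> X0; pose th := atan (Y / X).
have c0 : 0 < cos th by rewrite /th cos_atan invr_gt0 sqrtr_gt0 ltr_wpDr ?sqr_ge0.
exists (X / cos th), th; split.
- exact: divr_gt0.
- by rewrite ltr_norml /th atan_gtNpi2 atan_ltpi2.
- by rewrite mulfVK// gt_eqF.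
- have -> : X / cos th * sin th = X * tan th by rewrite /tan; ring.
  by rewrite /th atanK mulrCA mulfV ?mulr1// gt_eqF.
Qed.

Section slice_kernel.
Context {R : realType} (r alpha : R) (r0 : 0 < r) (alpha0 : 0 < alpha).
Variables (J : quat R) (z : R * R).
Hypotheses (SJ : usphere J) (zr : `|slice_pt J z| < r).
Notation q := (slice_pt J z).

(** As 1 - q/r has positive real part, its argument is less than pi/2 in absolute
    value; 1/2 < cos th / m is |q| < r rewritten as |1 - (1 - q/r)| < 1. *)
Lemma slice_polar : exists m th : R,
  [/\ 0 < m, `|th| < pi / 2, 1 / 2 < cos th / m, m * cos th = 1 - z.1 / r & m * sin th = - (z.2 / r)].
Proof using r0 SJ zr.
have z2 : z.1 ^+ 2 + z.2 ^+ 2 < r ^+ 2.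
  by rewrite -(norm_slice_sq z SJ) ltr_pXn2r ?nnegrE// ltW.
have zr1 : z.1 < r.
  rewrite ltNge; apply/negP => h; move: z2; rewrite ltNge => /negP; apply.
  apply: (@le_trans _ _ (z.1 ^+ 2)); last by rewrite lerDl sqr_ge0.
  by rewrite lerXn2r ?nnegrE//; [exact: ltW|exact: le_trans (ltW r0) h].
have X0 : 0 < 1 - z.1 / r by rewrite subr_gt0 ltr_pdivrMr// mul1r.
have [m [th [m0 thb mc ms]]] := polar_right (- (z.2 / r)) X0.
exists m, th; split=> //.
have m2 : m ^+ 2 = (1 - z.1 / r) ^+ 2 + (z.2 / r) ^+ 2.
  by rewrite -mc -[(z.2 / r) ^+ 2]sqrrN -ms !exprMn -mulrDr cos2Dsin2 mulr1.
have -> : cos th / m = (1 - z.1 / r) / m ^+ 2 by rewrite -mc; field; exact: lt0r_neq0.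
rewrite ltr_pdivlMr ?exprn_gt0// m2.
have : (z.1 / r) ^+ 2 + (z.2 / r) ^+ 2 < 1.
  by rewrite !exprMn -mulrDl exprVn ltr_pdivrMr ?exprn_gt0// mul1r.
by move: (z.1 / r) (z.2 / r) => x y; nra.
Qed.

Variables (m th : R).
Hypotheses (m0 : 0 < m) (thb : `|th| < pi / 2) (mth : 1 / 2 < cos th / m).
Hypotheses (mc : m * cos th = 1 - z.1 / r) (ms : m * sin th = - (z.2 / r)).

Let s := - alpha - 1.
Let rn : r != 0. Proof. exact: lt0r_neq0. Qed.
Let mn : m != 0. Proof. exact: lt0r_neq0. Qed.
Let z1 : z.1 = r - r * m * cos th.
Proof. by rewrite -mulrA mc; field. Qed.
Let z2 : z.2 = - (r * m * sin th).
Proof. by rewrite -mulrA ms; field. Qed.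

Lemma one_sub_slice : 1 - r^-1 *: q = m *: cisq J th.
Proof.
rewrite -(slice_pt1 J) /cisq !slice_ptZ slice_ptB/=; congr (slice_pt J (_, _)).
  by rewrite mc mulrC.
by rewrite ms sub0r mulrC.
Qed.

Lemma powq_slice n : (r^-1 *: q) ^+ n = slice_pt J (powC m th n, powS m th n).
Proof.
have -> : r^-1 *: q = slice_pt J (1 - m * cos th, - (m * sin th)).
  by rewrite slice_ptZ mc ms; congr (slice_pt J (_, _)); ring.
elim: n => [|n ih]; first by rewrite expr0 powC0 powS0 slice_pt1.
by rewrite exprS ih slice_ptM//= powCS powSS; congr (slice_pt J (_, _)); ring.
Qed.

Let th_pi : `|th| < pi.
Proof. by apply: lt_le_trans thb _; have := @pi_ge0 R; lra. Qed.

Lemma kernel_qpow : qpow (1 - r^-1 *: q) s = m `^ s *: cisq J (s * th).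
Proof. by rewrite one_sub_slice qpow_slice. Qed.

Let kernel_arg t : t *: q / (q - r%:A) = slice_pt J (t * (1 - cos th / m), t * (sin th / m)).
Proof.
have E : slice_pt J (t * (1 - cos th / m), t * (sin th / m)) * (q - r%:A) = t *: q.
  rewrite -(slice_ptr J) slice_ptB slice_ptM// slice_ptZ/=; congr (slice_pt J (_, _)); rewrite z1 z2.
    have -> : t * (r - r * m * cos th) = t * (r * (cos th ^+ 2 + sin th ^+ 2) - r * m * cos th).
      by rewrite cos2Dsin2 mulr1.
    by field.
  by field.
rewrite -E mulrK// -[_ \is a _]/(q - r%:A != 0) -normr_gt0.
rewrite -(slice_ptr J) slice_ptB norm_slice// sqrtr_gt0/= z1 z2.
have -> : (r - r * m * cos th - r) ^+ 2 + (- (r * m * sin th) - 0) ^+ 2 =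
  (r * m) ^+ 2 * (cos th ^+ 2 + sin th ^+ 2) by ring.
by rewrite cos2Dsin2 mulr1 exprn_gt0// mulr_gt0.
Qed.

Lemma kernel_slice t : qpow (1 - r^-1 *: q) s * qexp (t *: q / (q - r%:A)) =
  slice_pt J (kerC alpha m th t, kerS alpha m th t).
Proof.
rewrite kernel_qpow kernel_arg qexp_slice// -scalerAl -scalerAr scalerA.
rewrite -[slice_pt J (cos _, sin _)]/(cisq J _) -cisqD// /cisq slice_ptZ/= /kerC /kerS -/s.
have -> : s * th + t * (sin th / m) = t * (sin th / m) - (alpha + 1) * th by rewrite /s; ring.
by rewrite (mulrC (1 - _)) !mulrA.
Qed.

Notation mu := (@lebesgue_measure R).
Notation R0 := (`[0, +oo[%classic : set (measurableTypeR R)).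
Notation w := (gamma_weight alpha).
Notation "<< u , v >>" := (ip mu R0 w u v).
Notation gw0 := (gamma_weight_ge0 alpha0).

(* The inverse of the factor (1 - q/r)^(-alpha-1): the integrand is obtained from
   the kernel by removing this factor, which stands outside the integral. *)
Let kinv := m `^ (- s) *: cisq J (- (s * th)).
Let kinvP : kinv * (m `^ s *: cisq J (s * th)) = 1.
Proof.
rewrite /kinv -scalerAl -scalerAr scalerA -cisqD// addNr cisq0.
by rewrite -powRD ?addNr ?powRr0 ?scale1r//; apply/implyP => _; exact: mn.
Qed.

Let kphi (phi : measurableTypeR R -> quat R) c t :
  qre (c * (slice_pt J (kerC alpha m th t, kerS alpha m th t) * phi t)) * w t =
  kerC alpha m th t * qre (c * phi t) * w t + kerS alpha m th t * qre (c * J * phi t) * w t.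
Proof. by rewrite /slice_pt /=; ring. Qed.

Section one_function.
Variable phi : measurableTypeR R -> quat R.
Hypothesis Lphi : qL2 mu R0 w phi.

Let iC c : mu.-integrable R0 (EFin \o (fun t => kerC alpha m th t * qre (c * phi t) * w t)).
Proof. exact: (sqi_mul mR0 (@mw _ _) gw0 (sqi_kerC alpha0 mth) (Lphi c)). Qed.
Let iS c : mu.-integrable R0 (EFin \o (fun t => kerS alpha m th t * qre (c * phi t) * w t)).
Proof. exact: (sqi_mul mR0 (@mw _ _) gw0 (sqi_kerS alpha0 mth) (Lphi c)). Qed.

Let integrandE c t : qre (c * (m `^ s *: cisq J (s * th)) * Aslice_integrand r alpha phi q t) =
  kerC alpha m th t * qre (c * phi t) * w t + kerS alpha m th t * qre (c * J * phi t) * w t.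
Proof.
rewrite -kphi /Aslice_integrand -scalerAr -mulrA (mulrA _ (qexp _)) -kernel_qpow kernel_slice.
by move: (c * _) => Q /=; rewrite mulrC.
Qed.

Lemma Aslice_integrable : qintegrable mu R0 (Aslice_integrand r alpha phi q).
Proof.
apply: functional_qintegrable => c.
have -> : (fun t => qre (c * Aslice_integrand r alpha phi q t)) =
  (fun t => kerC alpha m th t * qre (c * kinv * phi t) * w t + kerS alpha m th t * qre (c * kinv * J * phi t) * w t).
  by apply/funext => t; rewrite -integrandE -(mulrA c) kinvP mulr1.
by apply: intD; [exact: mR0|exact: iC|exact: iS].
Qed.

Lemma qre_Aslice c : qre (c * Aslice r alpha phi q) =
  << kerC alpha m th, (fun t => qre (c * phi t)) >> + << kerS alpha m th, (fun t => qre (c * J * phi t)) >>.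
Proof.
rewrite /Aslice -/s kernel_qpow mulrA qre_qintegral; [|exact: mR0|exact: Aslice_integrable].
under eq_Rintegral do rewrite integrandE.
by rewrite RintegralD//; exact: mR0.
Qed.

Notation lag := (lag alpha).

(** Parseval's identity for the kernel, applied to kerC and kerS against the real
    functionals of phi. *)
Lemma Aslice_psum : psum (fun n => (r^-1 ^+ n * Num.sqrt (lnorm2 alpha n)) *: qcoef mu R0 w lag phi n) q
  @ \oo --> Aslice r alpha phi q.
Proof.
apply: cvg_test => c; rewrite qre_Aslice.
have [pC pS] := ker_parseval alpha0 m0 thb mth.
have HC := parseval_ip mR0 (@mw _ _) gw0 (sqi_lag alpha0) (ip_lag alpha0) (sqi_kerC alpha0 mth) (Lphi c) pC.
have HS := parseval_ip mR0 (@mw _ _) gw0 (sqi_lag alpha0) (ip_lag alpha0) (sqi_kerS alpha0 mth) (Lphi (c * J)) pS.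
suff -> : (fun N => qre (c * psum (fun n => (r^-1 ^+ n * Num.sqrt (lnorm2 alpha n)) *: qcoef mu R0 w lag phi n) q N)) =
  (fun N => \sum_(k < N) << kerC alpha m th, lag k >> * << (fun t => qre (c * phi t)), lag k >> +
            \sum_(k < N) << kerS alpha m th, lag k >> * << (fun t => qre (c * J * phi t)), lag k >>).
  exact: (cvgD HC HS).
apply/funext => N; rewrite /psum mulr_sumr.
have [-> _ _ _] := q_sum_comp N (fun n => c * (q ^+ n * ((r^-1 ^+ n * Num.sqrt (lnorm2 alpha n)) *: qcoef mu R0 w lag phi n))).
rewrite -big_split; apply: eq_bigr => n _; cbv beta.
have eC : << kerC alpha m th, lag n >> = Num.sqrt (lnorm2 alpha n) * powC m th n.
  by rewrite ipC (ip_lag_kerC alpha0 m0 thb mth).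
have eS : << kerS alpha m th, lag n >> = Num.sqrt (lnorm2 alpha n) * powS m th n.
  by rewrite ipC (ip_lag_kerS alpha0 m0 thb mth).
rewrite eC eS.
rewrite -!(qre_qcoef mR0 (@mw _ _) gw0 (sqi_lag alpha0) _ n Lphi).
have -> : q ^+ n * ((r^-1 ^+ n * Num.sqrt (lnorm2 alpha n)) *: qcoef mu R0 w lag phi n) =
  Num.sqrt (lnorm2 alpha n) *: (slice_pt J (powC m th n, powS m th n) * qcoef mu R0 w lag phi n).
  by rewrite -powq_slice exprZn -scalerAl -!scalerAr !scalerA mulrC.
move: (qcoef _ _ _ _ _ _) => b; rewrite /slice_pt/=; ring.
Qed.

End one_function.
End slice_kernel.

Section Aslice_map.
Context {R : realType} (r alpha : R) (r0 : 0 < r) (alpha0 : 0 < alpha).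
Notation mu := (@lebesgue_measure R).
Notation R0 := (`[0, +oo[%classic : set (measurableTypeR R)).
Notation w := (gamma_weight alpha).
Notation gw0 := (gamma_weight_ge0 alpha0).
Notation lag := (lag alpha).
Notation coef := (qcoef mu R0 w lag).
Notation qL2w := (qL2 mu R0 w).
Implicit Types (phi : measurableTypeR R -> quat R) (q : quat R).

(** The coefficients of the image in terms of the Laguerre coefficients; Acoef is
    also the isomorphism from square summable sequences to the coefficients of
    Bergman functions. *)
Definition Acoef (b : nat -> quat R) n : quat R := (r^-1 ^+ n * Num.sqrt (lnorm2 alpha n)) *: b n.

Lemma Aslice_ps phi : qL2w phi -> ps_on (Aslice r alpha phi) (Acoef (coef phi)) r.
Proof.
move=> L q; have [J [z [SJ ->]]] := slice_exists q => zr.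
have [m [th [m0 thb mth mc ms]]] := slice_polar r0 SJ zr.
have H := Aslice_psum r0 alpha0 SJ m0 thb mth mc ms L.
exact: H.
Qed.

Lemma Aslice_qintegrable phi q : qL2w phi -> `|q| < r ->
  qintegrable mu R0 (Aslice_integrand r alpha phi q).
Proof.
move=> L; have [J [z [SJ ->]]] := slice_exists q => zr.
have [m [th [m0 thb mth mc ms]]] := slice_polar r0 SJ zr.
exact: (Aslice_integrable r0 alpha0 SJ m0 thb mth mc ms L).
Qed.

Lemma Aslice_linear phi psi (a b : quat R) q : qL2w phi -> qL2w psi -> `|q| < r ->
  Aslice r alpha (fun t => phi t * a + psi t * b) q = Aslice r alpha phi q * a + Aslice r alpha psi q * b.
Proof.
move=> L1 L2; have [J [z [SJ ->]]] := slice_exists q => zr.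
have [m [th [m0 thb mth mc ms]]] := slice_polar r0 SJ zr.
have E c t : qre (c * (phi t * a + psi t * b)) = qre (a * c * phi t) + qre (b * c * psi t).
  by move=> /=; ring.
have L3 : qL2w (fun t => phi t * a + psi t * b).
  move=> c; under [X in sqi _ _ _ X]eq_fun do rewrite E.
  by apply: (sqiD mR0 (@mw _ _) gw0); [exact: L1|exact: L2].
apply: qre_test => c.
have F (x y : quat R) : qre (c * (x * a + y * b)) = qre (a * c * x) + qre (b * c * y) by move=> /=; ring.
have QA f c' (Lf : qL2w f) := qre_Aslice r0 alpha0 SJ m0 thb mth mc ms Lf c'.
rewrite F (QA _ c L3) (QA _ (a * c) L1) (QA _ (b * c) L2).
have D (k : R -> R) c' : sqi mu R0 w k -> ip mu R0 w k (fun t => qre (c' * (phi t * a + psi t * b))) =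
    ip mu R0 w k (fun t => qre (a * c' * phi t)) + ip mu R0 w k (fun t => qre (b * c' * psi t)).
  move=> sk; under [X in ip _ _ _ _ X = _]eq_fun do rewrite E.
  by rewrite ipC (ipDl mR0 (@mw _ _) gw0 (L1 _) (L2 _) sk); congr (_ + _); apply: ipC.
rewrite (D _ _ (sqi_kerC alpha0 mth)) (D _ _ (sqi_kerS alpha0 mth)) !mulrA.
by rewrite addrACA.
Qed.

Lemma Aslice_ae phi psi q : qL2w phi -> qL2w psi -> `|q| < r ->
  {ae mu, forall t : R, 0 <= t -> phi t = psi t} -> Aslice r alpha phi q = Aslice r alpha psi q.
Proof.
move=> L1 L2; have [J [z [SJ ->]]] := slice_exists q => zr ae.
have [m [th [m0 thb mth mc ms]]] := slice_polar r0 SJ zr.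
apply: qre_test => c.
rewrite (qre_Aslice r0 alpha0 SJ m0 thb mth mc ms L1) (qre_Aslice r0 alpha0 SJ m0 thb mth mc ms L2).
have D (k : R -> R) c' : sqi mu R0 w k -> ip mu R0 w k (fun t => qre (c' * phi t)) =
    ip mu R0 w k (fun t => qre (c' * psi t)).
  move=> sk; rewrite /ip /Rintegral; congr fine; apply: ae_eq_integral.
  - exact: mR0.
  - exact: (measurable_int _ (sqi_mul mR0 (@mw _ _) gw0 sk (L1 c'))).
  - exact: (measurable_int _ (sqi_mul mR0 (@mw _ _) gw0 sk (L2 c'))).
  - have aF := ae_filter_ringOfSetsType mu.
    by move: ae; apply: filterS => t H; rewrite /= in_itv/= andbT => /H ->.
by rewrite (D _ _ (sqi_kerC alpha0 mth)) (D _ _ (sqi_kerS alpha0 mth)).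
Qed.

End Aslice_map.

(** * The two bases and the isometry *)

Section bergman_coefficients.
Context {R : realType}.
Variables (r alpha : R) (I : quat R).
Hypotheses (r0 : 0 < r) (alpha0 : 0 < alpha) (SI : usphere I).
Notation mu := (@lebesgue_measure R).
Notation R0 := (`[0, +oo[%classic : set (measurableTypeR R)).
Notation w := (gamma_weight alpha).
Notation gw0 := (gamma_weight_ge0 alpha0).
Notation lag := (lag alpha).
Notation coef := (qcoef mu R0 w lag).
Notation qL2w := (qL2 mu R0 w).
Notation nu := (plane_measure R).
Notation ball := (slice_ball r I).
Notation W := (slice_weight r alpha I).
Notation Bnorm f := (L2_norm nu ball W (fun z => f (slice_pt I z))).
Implicit Types (f : quat R -> quat R) (b : nat -> quat R).
Notation Acf := (Acoef r alpha).

Let mB : measurable (ball : set (measurableTypeR R * measurableTypeR R)).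
Proof. exact: measurable_ball. Qed.
Let mW : measurable_fun ball W.
Proof. by apply: measurable_funTS; exact: measurable_weight. Qed.
Let W0 z : ball z -> 0 <= W z.
Proof. by move=> _; exact: weight_ge0. Qed.

(** The weights of the Bergman norm and the factors in Acoef compensate each other,
    so the squared Bergman norm of a series with coefficients Acoef b is the sum of
    the |b n|^2. *)
Lemma Acoef_mom b n : `|Acf b n| ^+ 2 * mom r alpha I r n = `|b n| ^+ 2.
Proof.
have l0 := lnorm2_gt0 alpha0 n; have rn : r ^+ n != 0 by rewrite expf_neq0// gt_eqF.
rewrite mom_r// /Acoef normrZ exprMn -normrX ger0_norm ?sqr_ge0// exprMn sqr_sqrtr ?ltW//.
have -> : r ^+ (2 * n) = (r ^+ n) ^+ 2 by rewrite mulnC exprM.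
by rewrite exprVn; field; rewrite rn gt_eqF.
Qed.

Lemma Acoef_inv (a : nat -> quat R) : exists b, Acf b = a.
Proof.
exists (fun n => (r ^+ n / Num.sqrt (lnorm2 alpha n)) *: a n); apply/funext => n.
have l0 : Num.sqrt (lnorm2 alpha n) != 0 by rewrite gt_eqF// sqrtr_gt0 lnorm2_gt0.
have rn : r ^+ n != 0 by rewrite expf_neq0// gt_eqF.
by rewrite /Acoef scalerA -[RHS]scale1r; congr (_ *: _); rewrite exprVn; field; rewrite ?rn ?l0.
Qed.

Lemma ps_bergman f b (M : R) : ps_on f (Acf b) r -> (forall N, \sum_(n < N) `|b n| ^+ 2 <= M) ->
  fs_mem (bergman r alpha I) f /\ Bnorm f ^+ 2 <= M.
Proof.
move=> fa bM.
have H : (\int[nu]_(z in ball) (`|f (slice_pt I z)| ^+ 2 * W z)%:E <= M%:E)%E.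
  apply: (bergman_le r0 alpha0 SI fa) => N; apply: le_trans (bM N).
  by apply: ler_sum => n _; rewrite Acoef_mom.
have L : L2_mem nu ball W (fun z => f (slice_pt I z)).
  by split; [exact: (qmeasurable_ps I fa)|exact: le_lt_trans H (ltry _)].
split; first by split=> //; exact: ps_slice_regular fa.
rewrite (L2_norm_sqr nu W0); have [i _] := qL2_norm mB (proj1 (L2_qL2 nu mB mW W0 _) L).
by rewrite -lee_fin /Rintegral fineK//; exact: integrable_fin_num i.
Qed.

Lemma bergman_ps_le f b N : ps_on f (Acf b) r -> fs_mem (bergman r alpha I) f ->
  \sum_(n < N) `|b n| ^+ 2 <= Bnorm f ^+ 2.
Proof.
move=> fa [_ L]; rewrite (L2_norm_sqr nu W0).
have [i _] := qL2_norm mB (proj1 (L2_qL2 nu mB mW W0 _) L).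
apply: le_trans (bergman_ge r0 alpha0 SI fa N i).
by apply: ler_sum => n _; rewrite Acoef_mom.
Qed.

Lemma bergman_expand f : fs_mem (bergman r alpha I) f -> exists b, ps_on f (Acf b) r.
Proof.
move=> [fr _]; have [a fa] := slice_regular_ps r0 fr.
by have [b ba] := Acoef_inv a; exists b; rewrite ba.
Qed.

Lemma f_basis_mul n q (p : quat R) : f_basis r alpha n q * p = q ^+ n * Acf (fun=> p) n.
Proof.
rewrite /f_basis /Acoef.
have -> : n%:R + alpha + 1 = alpha + n%:R + 1 by rewrite (addrC n%:R).
rewrite -/(lnorm2 alpha n) exprZn scalerA -scalerAl -scalerAr; congr (_ *: _).
exact: mulrC.
Qed.

(** A remainder of the expansion is again a power series, to which the norm estimate
    ps_bergman applies. *)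
Lemma ps_tail f b N : ps_on f (Acf b) r ->
  ps_on (fun q => f q - \sum_(k < N) f_basis r alpha k q * b k)
        (Acf (fun n => if (n < N)%N then 0 else b n)) r.
Proof.
move=> fa q qr; pose b' n := if (n < N)%N then 0 else b n.
rewrite -(cvg_shiftn N).
have H0 : psum (Acf b') q N = 0.
  rewrite /psum big1// => n _; rewrite /Acoef /b' ltn_ord scaler0 mulr0//.
have HN : \sum_(k < N) f_basis r alpha k q * b k = psum (Acf b) q N.
  by apply: eq_bigr => k _; exact: f_basis_mul.
have E M : psum (Acf b') q (M + N) = psum (Acf b) q (M + N) - psum (Acf b) q N.
  elim: M => [|M ih]; first by rewrite add0n subrr.
  rewrite addSn /psum !big_ord_recr/= -!/(psum _ _ _) ih [RHS]addrAC; congr (_ + _ * _).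
  by rewrite /Acoef /b' ltnNge leq_addl.
rewrite HN; suff -> : (fun M => psum (Acf b') q (M + N)) =
    (fun M => psum (Acf b) q (M + N) - psum (Acf b) q N).
  apply: (@cvgB _ (quat R)); last exact: cvg_cst.
  by have := fa q qr; rewrite -(cvg_shiftn N).
exact/funext.
Qed.

Lemma sum_tail b N M : \sum_(n < M + N) `|if (n < N)%N then 0 else b n : quat R| ^+ 2 =
  \sum_(n < M + N) `|b n| ^+ 2 - \sum_(n < N) `|b n| ^+ 2.
Proof.
elim: M => [|M ih].
  by rewrite add0n subrr big1// => n _; rewrite ltn_ord normr0 expr0n.
by rewrite addSn !big_ord_recr/= ih ltnNge leq_addl/= addrAC.
Qed.

Lemma sum_limit b (M : R) : (forall N, \sum_(n < N) `|b n| ^+ 2 <= M) ->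
  exists L : R, \sum_(n < N) `|b n| ^+ 2 @[N --> \oo] --> L /\
    forall N, \sum_(n < N) `|b n| ^+ 2 <= L.
Proof.
move=> bM; pose s N := \sum_(n < N) `|b n| ^+ 2.
have nd : nondecreasing_seq s.
  apply/nondecreasing_seqP => N; rewrite /s big_ord_recr/= lerDl exprn_ge0//.
have cs : cvgn s by apply: nondecreasing_is_cvgn => //; exists M => _ [N _ <-]; exact: bM.
exists (limn s); split; first exact: cs.
by move=> N; exact: (nondecreasing_cvgn_le nd cs N).
Qed.

Lemma phi_basisE n : phi_basis alpha n = (fun t => (lag n t)%:A).
Proof. by []. Qed.

Let lag_comp n : [/\ (fun x => qre ((lag n x)%:A : quat R)) = lag n,
  (fun x => qi ((lag n x)%:A : quat R)) = (fun=> 0), (fun x => qj ((lag n x)%:A : quat R)) = (fun=> 0) &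
  (fun x => qk ((lag n x)%:A : quat R)) = (fun=> 0)].
Proof. by split; apply/funext => x /=; rewrite ?mulr1 ?mulr0. Qed.

Lemma phi_basis_qL2 n : qL2w (phi_basis alpha n).
Proof.
rewrite phi_basisE; have [e1 e2 e3 e4] := lag_comp n.
apply: (qL2_of_comp mR0 (@mw _ _) gw0); rewrite ?e1 ?e2 ?e3 ?e4.
- exact: sqi_lag.
- exact: sqi0.
- exact: sqi0.
- exact: sqi0.
Qed.

Let ip0 g : ip mu R0 w (fun=> 0) g = 0.
Proof.
rewrite /ip /Rintegral; under eq_integral do rewrite !mul0r.
by rewrite integral0.
Qed.

Lemma phi_basis_coef n k : coef (phi_basis alpha n) k = (n == k)%:R%:A.
Proof.
rewrite phi_basisE /qcoef; have [e1 e2 e3 e4] := lag_comp n; rewrite ?e1 ?e2 ?e3 ?e4.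
by rewrite (ip_lag alpha0) !ip0; apply: quatP => /=; rewrite ?mulr1 ?mulr0.
Qed.

Lemma phi_basis_norm n : L2_norm mu R0 w (phi_basis alpha n) ^+ 2 = 1.
Proof.
rewrite (L2_norm_sqr mu gw0); have [_ ->] := qL2_norm mR0 (phi_basis_qL2 n).
rewrite phi_basisE; have [e1 e2 e3 e4] := lag_comp n; rewrite ?e1 ?e2 ?e3 ?e4.
by rewrite (ip_lag alpha0) !ip0 eqxx !addr0.
Qed.

Lemma Aslice_phi_basis n q : `|q| < r -> Aslice r alpha (phi_basis alpha n) q = f_basis r alpha n q.
Proof.
move=> qr; have H := Aslice_ps r0 alpha0 (phi_basis_qL2 n) qr.
apply: (@qcvg_unique R _ _ _ H); apply: cvg_near_cst; near=> N.
have nN : (n < N)%N by near: N; exact: nbhs_infty_gt.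
rewrite /psum (bigD1 (Ordinal nN))//= big1 => [|k kn].
  by rewrite addr0 -[RHS]mulr1 f_basis_mul /Acoef phi_basis_coef eqxx scale1r.
rewrite /Acoef phi_basis_coef.
have -> : (n == k) = false by apply/negbTE; move: kn; rewrite -val_eqE/= eq_sym.
by rewrite scale0r scaler0 mulr0.
Unshelve. all: by end_near. Qed.

Lemma f_basis_ps n : ps_on (f_basis r alpha n) (Acf (fun k => (n == k)%:R%:A)) r.
Proof.
move=> q qr; rewrite -Aslice_phi_basis//.
have -> : (fun k => (n == k)%:R%:A) = coef (phi_basis alpha n).
  by apply/funext => k; rewrite phi_basis_coef.
exact: (Aslice_ps r0 alpha0 (phi_basis_qL2 n)).
Qed.

Let delta_sum n N : \sum_(k < N) `|(n == k :> nat)%:R%:A : quat R| ^+ 2 = (n < N)%:R :> R.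
Proof.
have E (x : R) : `|x%:A : quat R| ^+ 2 = x ^+ 2 by rewrite qnorm_real real_normK ?num_real.
under eq_bigr do rewrite E.
elim: N => [|N ih]; first by rewrite big_ord0.
rewrite big_ord_recr/= ih; have [->|nN] := eqVneq n N.
  by rewrite ltnn ltnSn expr1n add0r.
by rewrite expr0n addr0 [in RHS]ltnS [in RHS]leq_eqVlt (negbTE nN).
Qed.

Lemma f_basis_mem n : fs_mem (bergman r alpha I) (f_basis r alpha n).
Proof.
have [|//] := @ps_bergman _ _ 1 (@f_basis_ps n).
by move=> N; rewrite delta_sum lern1 leq_b1.
Qed.

(** cross_zero gives the real part of the inner product against every constant
    factor, which determines the quaternion. *)
Lemma f_basis_orth m n : m != n -> fs_inner (bergman r alpha I) (f_basis r alpha m) (f_basis r alpha n) = 0.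
Proof.
move=> mn; rewrite /= /L2_inner.
pose l k := r^-1 ^+ k * Num.sqrt (lnorm2 alpha k).
have fE k q : f_basis r alpha k q = q ^+ k * (l k)%:A.
  by rewrite -[LHS]mulr1 f_basis_mul.
have K c : \int[nu]_(z in ball) qre (c * (W z *:
    (qconj (f_basis r alpha n (slice_pt I z)) * f_basis r alpha m (slice_pt I z)))) = 0.
  rewrite -(@cross_zero R r alpha I SI r n m ((l n)%:A * qconj c) (l m)%:A r0); last by rewrite eq_sym.
  apply: eq_Rintegral => z _; rewrite !fE !qconjM.
  by move: (qconj (slice_pt I z ^+ n)) (slice_pt I z ^+ m) => x y /=; ring.
apply: quatP; rewrite /qintegral /=.
- by rewrite -[RHS](K 1); apply: eq_Rintegral => z _ /=; ring.
- by rewrite -[RHS](K (Quat 0 (-1) 0 0)); apply: eq_Rintegral => z _ /=; ring.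
- by rewrite -[RHS](K (Quat 0 0 (-1) 0)); apply: eq_Rintegral => z _ /=; ring.
- by rewrite -[RHS](K (Quat 0 0 0 (-1))); apply: eq_Rintegral => z _ /=; ring.
Qed.

Lemma bergman_basis : orthogonal_basis (bergman r alpha I) (f_basis r alpha).
Proof.
split.
- exact: f_basis_mem.
- move=> n; have := @bergman_ps_le _ _ n.+1 (@f_basis_ps n) (f_basis_mem n).
  rewrite delta_sum ltnSn => h; apply: contraTN h => /eqP h.
  by rewrite -ltNge -[ltLHS]/(fs_norm (bergman r alpha I) (f_basis r alpha n) ^+ 2) h expr0n.
- exact: f_basis_orth.
move=> f Bf e e0; have [b fb] := bergman_expand Bf.
have [L [cL bL]] := sum_limit (fun N => bergman_ps_le N fb Bf).
have e2 : 0 < e ^+ 2 by rewrite exprn_gt0.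
have Le : L - e ^+ 2 < L by rewrite gtrBl.
have [N _ HN] := cvgr_gt _ cL _ Le.
have {}HN := HN N (leqnn N); rewrite /= in HN.
exists N, b.
have [|_ H] := @ps_bergman _ _ (L - \sum_(n < N) `|b n| ^+ 2) (@ps_tail _ _ N fb).
  move=> M; apply: (@le_trans _ _ (\sum_(n < M + N) `|if (n < N)%N then 0 else b n : quat R| ^+ 2)).
    rewrite -!(big_mkord xpredT (fun n => `|if (n < N)%N then 0 else b n : quat R| ^+ 2)).
    by rewrite (big_cat_nat (leq0n M) (leq_addr N M))/= lerDl sumr_ge0.
  by rewrite sum_tail lerD2r.
rewrite -(@ltr_pXn2r _ 2)// ?nnegrE ?sqrtr_ge0 ?(ltW e0)//.
by apply: le_lt_trans H _; rewrite ltrBlDr addrC -ltrBlDr.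
Qed.

Lemma L2alpha_basis : orthogonal_basis (L2alpha alpha) (phi_basis alpha).
Proof.
have M (f : measurableTypeR R -> quat R) : fs_mem (L2alpha alpha) f <-> qL2w f by exact: (L2_qL2 mu mR0 (@mw _ _) gw0 f).
split.
- by move=> n; apply/M; exact: phi_basis_qL2.
- move=> n; apply/eqP => h; have := phi_basis_norm n.
  by rewrite -[L2_norm _ _ _ _]/(fs_norm (L2alpha alpha) (phi_basis alpha n)) h expr0n => /eqP; rewrite eq_sym oner_eq0.
- move=> m n mn; rewrite /= /L2_inner.
  have K : \int[mu]_(t in R0) (lag m t * lag n t * w t) = 0.
    by have := ip_lag alpha0 m n; rewrite (negbTE mn).
  have Z : \int[mu]_(t in R0) (0 : R) = 0 by rewrite /Rintegral integral0.
  have E : (fun t => w t *: (qconj (phi_basis alpha n t) * phi_basis alpha m t)) =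
      (fun t => (lag m t * lag n t * w t)%:A).
    apply/funext => t; rewrite !phi_basisE; move: (lag m t) (lag n t) (w t) => x y v.
    by apply: quatP => /=; ring.
  rewrite E; apply: quatP; rewrite /qintegral [LHS]/= [RHS]/=.
  - by rewrite -[RHS]K; apply: eq_Rintegral => t _; exact: mulr1.
  - by rewrite -[RHS]Z; apply: eq_Rintegral => t _; exact: mulr0.
  - by rewrite -[RHS]Z; apply: eq_Rintegral => t _; exact: mulr0.
  - by rewrite -[RHS]Z; apply: eq_Rintegral => t _; exact: mulr0.
move=> f /M Lf e e0; have e2 : 0 < e ^+ 2 by rewrite exprn_gt0.
have cL := qparseval mR0 (@mw _ _) gw0 (sqi_lag alpha0) (ip_lag alpha0) (integrable_gamma_weight alpha0) (lag_complete alpha0) Lf.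
have Le : L2_norm mu R0 w f ^+ 2 - e ^+ 2 < L2_norm mu R0 w f ^+ 2 by rewrite gtrBl.
have [N _ HN] := cvgr_gt _ cL _ Le.
have {}HN := HN N (leqnn N); rewrite /= in HN.
exists N, (coef f).
rewrite -(@ltr_pXn2r _ 2)// ?nnegrE ?sqrtr_ge0 ?(ltW e0)//.
have := qdist mR0 (@mw _ _) gw0 (sqi_lag alpha0) (ip_lag alpha0) N Lf => H.
rewrite -[ltLHS]/(L2_norm mu R0 w (fun x => f x - \sum_(k < N) (lag k x)%:A * coef f k) ^+ 2) H.
by rewrite ltrBlDr addrC -ltrBlDr.
Qed.

(** One inequality between the norms comes from Bessel's inequality and the upper
    bound of the Bergman norm, the other from completeness and the lower bound. For
    surjectivity, a Bergman function has square summable b by the lower bound, and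
    qriesz provides a function with these Laguerre coefficients. *)
Lemma Aslice_isometry : unitary_isometry (L2alpha alpha) (bergman r alpha I) (Aslice r alpha).
Proof.
have M (f : measurableTypeR R -> quat R) : fs_mem (L2alpha alpha) f <-> qL2w f by exact: (L2_qL2 mu mR0 (@mw _ _) gw0 f).
have B (f : measurableTypeR R -> quat R) N (Lf : qL2w f) := qbessel mR0 (@mw _ _) gw0 (sqi_lag alpha0) (ip_lag alpha0) N Lf.
have A (f : measurableTypeR R -> quat R) (Lf : qL2w f) := ps_bergman (@Aslice_ps _ _ _ r0 alpha0 f Lf) (fun N => B f N Lf).
split.
- by move=> f /M /A[].
- by move=> f g /M Lf /M Lg fg q qr; exact: (Aslice_ae r0 alpha0 Lf Lg qr fg).
- by move=> f g a b /M Lf /M Lg q qr; exact: (Aslice_linear r0 alpha0 a b Lf Lg qr).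
- move=> f /M Lf; have [Am Ale] := A f Lf.
  have cL := qparseval mR0 (@mw _ _) gw0 (sqi_lag alpha0) (ip_lag alpha0) (integrable_gamma_weight alpha0) (lag_complete alpha0) Lf.
  have Age : L2_norm mu R0 w f ^+ 2 <= Bnorm (Aslice r alpha f) ^+ 2.
    rewrite -(cvg_lim _ cL)//; apply: limr_le; first exact/cvgP/cL.
    by apply: nearW => N; exact: (bergman_ps_le N (@Aslice_ps _ _ _ r0 alpha0 f Lf) Am).
  rewrite /= -[LHS]ger0_norm ?sqrtr_ge0// -[RHS]ger0_norm ?sqrtr_ge0//.
  rewrite -!sqrtr_sqr; congr Num.sqrt; apply/le_anti.
  by rewrite Ale Age.
move=> g Bg; have [b gb] := bergman_expand Bg.
have [f [Lf fb]] := qriesz mR0 (@mw _ _) gw0 (sqi_lag alpha0) (ip_lag alpha0) (integrable_gamma_weight alpha0)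
   (fun N => bergman_ps_le N gb Bg).
exists f; first exact/M.
move=> q qr; apply: (@qcvg_unique R _ _ _ (Aslice_ps r0 alpha0 Lf qr)).
have -> : Acf (coef f) = Acf b by apply/funext => n; rewrite /Acoef fb.
exact: gb.
Qed.

End bergman_coefficients.

Theorem theorem4p3 (R : realType) (r alpha : R) (r_gt0 : 0 < r)
    (alpha_gt0 : 0 < alpha) (I : quat R) (SI : usphere I) :
  [/\ (forall phi, fs_mem (L2alpha alpha) phi -> forall q, qball r q ->
         qintegrable lebesgue_measure `[0, +oo[
           (Aslice_integrand r alpha phi q)),
      unitary_isometry (L2alpha alpha) (bergman r alpha I) (Aslice r alpha),
      (forall n q, qball r q ->
         Aslice r alpha (phi_basis alpha n) q = f_basis r alpha n q),
      orthogonal_basis (L2alpha alpha) (phi_basis alpha) &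
      orthogonal_basis (bergman r alpha I) (f_basis r alpha)].
Proof.
split.
- move=> phi Lphi q qr; apply: Aslice_qintegrable => //.
  exact: (proj1 (L2_qL2 _ mR0 (@mw _ _) (gamma_weight_ge0 alpha_gt0) phi)).
- exact: Aslice_isometry.
- by move=> n q qr; exact: Aslice_phi_basis.
- exact: L2alpha_basis.
- exact: bergman_basis.
Qed.
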